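(* Let $M$ be a general hyperbolic $3$-manifold and let $f:\Sigma\to M$ be a compact h-mapped surface, i.e. $\Sigma$ is a compact triangulated hyperbolic surface with distinguished vertices $v_1,\dots,v_n\in\partial\Sigma$ and $f$ is an h-map relative to $\{v_1,\dots,v_n\}$. Suppose that each arc in $\partial\Sigma-\{v_1,\dots,v_n\}$ is geodesic. Let $\theta_i$ be the exterior angle at $v_i$ with respect to the geodesics in the boundary of $\Sigma$. Then $$\mathrm{Area}(\Sigma)\le \sum_i\theta_i-2\pi\chi(\Sigma).$$
   Context: A general hyperbolic $3$-manifold is a $3$-manifold $M$, possibly with (cornered) boundary, with an atlas of charts into $\mathbb{H}^3$ whose transition maps are restrictions of isometries of $\mathbb{H}^3$, given the length metric induced by the resulting Riemannian metric. Standing requirements: the metric is complete (hence geodesic); $M$ has a locally finite triangulation by tetrahedra each isometric to a hyperbolic tetrahedron of $\mathbb{H}^3$, with discrete vertex set (so $\partial M$ is triangulated by totally geodesic hyperbolic triangles), and the induced triangulation of the universal cover is carried by the developing map to tetrahedra in general position; every boundary point has a neighborhood isometric with a subspace of a metric ball of $\mathbb{H}^3$. A hyperbolic triangle in $M$ is a totally geodesic subset isometric to a geodesic triangle of $\mathbb{H}^2$ (developing into a totally geodesic plane of $\mathbb{H}^3$); degenerate triangles (a straight segment or a point, with appropriate vertices) are allowed. A triangulated hyperbolic surface is a triangulated metric surface, with or without boundary, each of whose triangles is isometric to a (possibly degenerate) hyperbolic triangle. A map $f:\Sigma\to M$ sending each triangle to a hyperbolic triangle is an h-map relative to $\{v_1,\dots,v_n\}\subset\partial\Sigma$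 if at each interior vertex the sum of the angles of the image triangles of its stellar neighborhood is $\ge 2\pi$, and at each boundary vertex $v\neq v_i$ the corresponding sum is $\ge\pi$. ''Geodesic'' for boundary arcs means that the image under $f$ is geodesic in $M$. The angle between two geodesics $c,c'$ issuing from the same point is $\limsup_{t,t'\to0}$ of the Euclidean comparison angles at that point for $c(t),c'(t')$. The exterior angle between an oriented geodesic $l_1$ ending at a point and an oriented geodesic $l_2$ starting from it is $\pi$ minus the angle in $M$ between $l_1$ with reversed orientation and $l_2$; $\theta_i$ is this exterior angle between the two boundary geodesics meeting at $v_i$. *)

(* Defs.v *)
From HB Require Import structures.
From mathcomp Require Import all_boot all_order all_algebra.
From mathcomp Require Import all_classical all_reals all_analysis.

Set Implicit Arguments.
Unset Strict Implicit.
Unset Printing Implicit Defensive.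

Import Order.TTheory GRing.Theory Num.Theory.
Import numFieldNormedType.Exports.

Local Open Scope ring_scope.

(* Hyperbolic n-space is the upper sheet of the hyperboloid of Minkowski space
   R^(n,1); coordinate 0 is the timelike one. *)
Section HyperbolicSpace.
Context {R : realType}.

Definition mink n (x y : 'rV[R]_n.+1) : R :=
  - (x 0 ord0 * y 0 ord0)
  + \sum_(i < n) x 0 (lift ord0 i) * y 0 (lift ord0 i).

Definition hyp n : set 'rV[R]_n.+1 :=
  [set x | mink x x = -1 /\ 0 < x 0 ord0]%classic.

(* arcosh (- mink x y) *)
Definition hdist n (x y : 'rV[R]_n.+1) : R :=
  ln (- mink x y + Num.sqrt (mink x y ^+ 2 - 1)).

Definition hisometry n (g : 'rV[R]_n.+1 -> 'rV[R]_n.+1) : Prop :=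
  set_bij (@hyp n) (@hyp n) g /\
  (forall x y, hyp x -> hyp y -> hdist (g x) (g y) = hdist x y).

(* The point at distance u from p on the geodesic from p to q.  If p = q the
   inverse is that of 0, which is 0, and the value at u = 0 is p. *)
Definition hgeod n (p q : 'rV[R]_n.+1) (u : R) : 'rV[R]_n.+1 :=
  let cosh_l := - mink p q in
  let sinh_l := Num.sqrt (cosh_l ^+ 2 - 1) in
  ((expR u + expR (- u)) / 2) *: p +
  ((expR u - expR (- u)) / 2 / sinh_l) *: (q - cosh_l *: p).

(* The geodesic convex hull of the points p i with P i: a set in the
   hyperboloid is geodesically convex iff the cone on it is convex. *)
Definition hface n k (P : pred 'I_k) (p : 'I_k -> 'rV[R]_n.+1) :
    set 'rV[R]_n.+1 :=
  [set x | hyp x /\ exists a : 'I_k -> R,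
     [/\ forall i, 0 <= a i, forall i, ~~ P i -> a i = 0
       & x = \sum_i a i *: p i]]%classic.

Definition hhull n k (p : 'I_k -> 'rV[R]_n.+1) : set 'rV[R]_n.+1 :=
  hface xpredT p.

Definition hyperboloid_pt (z : R * R) : 'rV[R]_3 :=
  \row_i [:: Num.sqrt (1 + z.1 ^+ 2 + z.2 ^+ 2); z.1; z.2]`_i.

(* In the coordinates (x, y) the metric induced on x0 = sqrt (1 + x^2 + y^2) is
   I - (x, y)^T (x, y) / x0^2, of determinant 1 / x0^2: the area form is
   dx dy / x0. *)
Definition hyp_area (A : set 'rV[R]_3) : \bar R :=
  (\int[lebesgue_measure \x lebesgue_measure]_(z in
      [set z : R * R | A (hyperboloid_pt z)]%classic)
    ((Num.sqrt (1 + z.1 ^+ 2 + z.2 ^+ 2))^-1)%:E)%E.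

End HyperbolicSpace.

Section Topology.
Context {R : realType}.
Local Open Scope classical_set_scope.

Definition homeo (X Y : topologicalType) (A : set X) (B : set Y)
    (f : X -> Y) (g : Y -> X) : Prop :=
  [/\ forall x, A x -> B (f x) /\ g (f x) = x,
      forall y, B y -> A (g y) /\ f (g y) = y,
      {within A, continuous f} & {within B, continuous g}].

Definition is_path (X : topologicalType) (x y : X) (c : R -> X) : Prop :=
  [/\ {within `[0, 1], continuous c}, c 0 = x & c 1 = y].

Definition simply_connected (X : topologicalType) : Prop :=
  (forall x y : X, exists c, is_path x y c) /\
  (forall (x : X) c, is_path x x c ->
     exists H : R * R -> X,
       [/\ {within `[0, 1] `*` `[0, 1], continuous H},
           forall t, 0 <= t <= 1 -> H (0, t) = c t,
           forall t, 0 <= t <= 1 -> H (1, t) = x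
         & forall s, 0 <= s <= 1 -> H (s, 0) = x /\ H (s, 1) = x]).

Definition covering_map (X Y : topologicalType) (pr : X -> Y) : Prop :=
  (forall y, exists x, pr x = y) /\
  (forall y, exists N : set Y, [/\ open N, N y &
     exists (J : Type) (V : J -> set X) (s : J -> Y -> X),
       [/\ forall j, open (V j) /\ homeo (V j) N pr (s j),
           forall j j' x, V j x -> V j' x -> j = j'
         & pr @^-1` N = \bigcup_j V j]]).

Definition half_space3 : set 'rV[R]_3 := [set w | 0 <= w 0 0].

(* 3-manifold with boundary in the topological sense, and its boundary *)
Definition top_3manifold (X : topologicalType) : Prop :=
  forall x : X, exists (N : set X) (W : set 'rV[R]_3) f g,
    [/\ open N, N x, open W & homeo N (W `&` half_space3) f g].

Definition mfd_boundary (X : topologicalType) : set X :=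
  [set x | ~ exists (N : set X) (W : set 'rV[R]_3) f g,
    [/\ open N, N x, open W & homeo N W f g]].

End Topology.

(* Length of c : [0, 1] -> X measured in H^3-valued charts: the supremum, over
   the subdivisions 0 = t_0 <= t_1 <= ... <= t_m = 1 with c [t_(j-1), t_j]
   inside the domain of a chart k_j, of the sum of the hyperbolic distances
   between the k_j-images of c t_(j-1) and c t_j.  A subdivision is the list of
   the pairs (k_j, t_j). *)
Section ChartLength.
Context {R : realType} (X A : Type).
Variables (U : A -> set X) (phi : A -> X -> 'rV[R]_4) (c : R -> X).

Fixpoint subdivision (a : R) (s : seq (A * R)) : Prop :=
  if s is (k, t) :: s' then
    [/\ a <= t, forall u, a <= u <= t -> U k (c u) & subdivision t s']
  else a = 1.

Fixpoint chart_sum (a : R) (s : seq (A * R)) : R :=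
  if s is (k, t) :: s' then
    hdist (phi k (c a)) (phi k (c t)) + chart_sum t s'
  else 0.

Definition chart_length : \bar R :=
  ereal_sup [set (chart_sum 0 s)%:E | s in subdivision 0]%classic.

End ChartLength.

Definition hlength {R : realType} (c : R -> 'rV[R]_4) : \bar R :=
  chart_length (fun _ : unit => @hyp R 3) (fun _ x => x) c.

(* T maps the subset K of H^n into X and, read in the charts, is locally
   distance-preserving into H^3; for K convex, this says that T is a local
   isometry that develops onto an isometric copy of K lying in a totally
   geodesic copy of H^n. *)
Definition develops_isometrically {R : realType} (X A : Type)
    (U : A -> set X) (phi : A -> X -> 'rV[R]_4)
    n (K : set 'rV[R]_n.+1) (T : 'rV[R]_n.+1 -> X) : Prop :=
  forall x, K x -> exists (k : A) (e : R), 0 < e /\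
    forall y z, K y -> K z -> hdist x y < e -> hdist x z < e ->
      [/\ U k (T y), U k (T z)
        & hdist (phi k (T y)) (phi k (T z)) = hdist y z].

Section GeneralHyperbolicManifold.
Local Open Scope classical_set_scope.

Record gen_hyp_3manifold (R : realType) := GenHyp3Manifold {
  carrier :> metricType R;
  mfd_top : @top_3manifold R carrier;
  mfd_complete : forall F : set_system carrier,
    ProperFilter F -> cauchy F -> exists x : carrier, F --> x;

  (* the atlas *)
  chart : Type;
  cdom : chart -> set carrier;
  cmap : chart -> carrier -> 'rV[R]_4;
  cdom_open : forall k, open (cdom k);
  cdom_cover : forall x, exists k, cdom k x;
  cmap_hyp : forall k x, cdom k x -> hyp (cmap k x);
  cmap_homeo : forall k, exists g,
    homeo (cdom k) (cmap k @` cdom k) (cmap k) g;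
  (* one isometry for each component of the overlap *)
  cmap_transition : forall k k' x, cdom k x -> cdom k' x ->
    exists g, hisometry g /\ \forall y \near x, cmap k' y = g (cmap k y);

  (* the distance is the length metric *)
  mdist_length : forall x y : carrier,
    (mdist x y)%:E = ereal_inf
      [set chart_length cdom cmap c | c in is_path x y];

  (* neighborhoods of boundary points; the isometry is for length metrics *)
  bdry_ball : forall x, @mfd_boundary R carrier x ->
    exists (N : set carrier) (psi : carrier -> 'rV[R]_4) g p (r : R),
      [/\ nbhs x N, homeo N (psi @` N) psi g, hyp p,
          forall y, N y -> hyp (psi y) /\ hdist p (psi y) < r
        & forall c : R -> carrier, {within `[0, 1], continuous c} ->
            (forall t, 0 <= t <= 1 -> N (c t)) ->
            chart_length cdom cmap c = hlength (psi \o c)];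

  (* the triangulation: the i-th tetrahedron is the image under tet i of the
     hyperbolic tetrahedron with vertices tvtx i *)
  tetra : Type;
  tvtx : tetra -> 'I_4 -> 'rV[R]_4;
  tet : tetra -> 'rV[R]_4 -> carrier;
  tvtx_hyp : forall i j, hyp (tvtx i j);
  tvtx_free : forall i, row_free (\matrix_j tvtx i j);
  tet_inj : forall i, set_inj (hhull (tvtx i)) (tet i);
  tet_isom : forall i,
    develops_isometrically cdom cmap (hhull (tvtx i)) (tet i);
  tet_cover : forall x, exists i, (tet i @` hhull (tvtx i)) x;
  tet_meet : forall i i', i <> i' ->
    exists P P' : pred 'I_4,
      tet i @` hhull (tvtx i) `&` tet i' @` hhull (tvtx i') =
        tet i @` hface P (tvtx i) /\
      tet i @` hface P (tvtx i) = tet i' @` hface P' (tvtx i');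
  tet_locfin : forall x : carrier, exists N : set carrier, nbhs x N /\
    finite_set [set i | tet i @` hhull (tvtx i) `&` N !=set0];
  tvtx_discrete : forall i j, \forall y \near tet i (tvtx i j),
    forall i' j', y = tet i' (tvtx i' j') -> y = tet i (tvtx i j);

  (* universal cover, developing map, and general position of the developed
     tetrahedra: their four vertices do not lie in a totally geodesic plane *)
  ucover : topologicalType;
  uproj : ucover -> carrier;
  ucover_sc : @simply_connected R ucover;
  uproj_cover : covering_map uproj;
  dev : ucover -> 'rV[R]_4;
  dev_chart : forall y k, cdom k (uproj y) ->
    exists g, hisometry g /\ \forall z \near y, dev z = g (cmap k (uproj z));
  dev_tet : forall i (lift_i : 'rV[R]_4 -> ucover),
    {within hhull (tvtx i), continuous lift_i} ->
    (forall x, hhull (tvtx i) x -> uproj (lift_i x) = tet i x) ->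
    dev @` (lift_i @` hhull (tvtx i)) =
      hhull (fun j => dev (lift_i (tvtx i j))) /\
    row_free (\matrix_j dev (lift_i (tvtx i j)))
}.

End GeneralHyperbolicManifold.

Section GeodesicsAngles.
Context {R : realType} {M : metricType R}.

Definition geodesic (l : R) (c : R -> M) : Prop :=
  forall t, 0 <= t <= l -> exists2 e, 0 < e &
    forall s s', 0 <= s <= l -> 0 <= s' <= l ->
      `|s - t| < e -> `|s' - t| < e -> mdist (c s) (c s') = `|s - s'|.

Definition comparison_angle (x y z : M) : R :=
  acos ((mdist x y ^+ 2 + mdist x z ^+ 2 - mdist y z ^+ 2)
        / (2 * mdist x y * mdist x z)).

(* The angle at c 0 = c' 0 of c : [0, l] -> M and c' : [0, l'] -> M, as the
   limsup of comparison angles for t, t' -> 0+.  If l or l' is 0, as happens in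
   a triangle with coincident vertices, there are no comparison angles, the
   limsup is -oo and the angle is fine -oo = 0. *)
Definition angle (l : R) (c : R -> M) (l' : R) (c' : R -> M) : R :=
  fine (limf_esup
    (fun z : R * R => (comparison_angle (c 0) (c z.1) (c' z.2))%:E)
    (within [set z : R * R | z.1 <= l /\ z.2 <= l']%classic
       (filter_prod (0 : R)^'+%classic (0 : R)^'+%classic))).

End GeodesicsAngles.

(* A compact triangulated hyperbolic surface: finitely many triangles of H^2,
   possibly degenerate, some of whose sides are glued in pairs by isometries.
   A corner is a pair (t, i), i being a vertex of t.  An oriented side
   (t, i, b) of t issues from the corner (t, i) and goes to the next vertex of
   t (b = true) or to the previous one (b = false).  Unglued sides are the
   fixed points of glue, and form the boundary.  Any gluing in which no side is
   folded onto itself gives a surface. *)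
Section Sides.
Context {face : Type}.

Definition send (s : face * 'I_3 * bool) : face * 'I_3 :=
  (s.1.1, if s.2 then ordS s.1.2 else ord_pred s.1.2).

Definition srev (s : face * 'I_3 * bool) : face * 'I_3 * bool :=
  (send s, ~~ s.2).

End Sides.

Record tri_hyp_surface (R : realType) := TriHypSurface {
  face : finType;
  vtx : face * 'I_3 -> 'rV[R]_3;
  glue : face * 'I_3 * bool -> face * 'I_3 * bool;
  vtx_hyp : forall c, hyp (vtx c);
  glueK : involutive glue;
  glue_rev : forall s, glue (srev s) = srev (glue s);
  glue_nofold : forall s, glue s != srev s;
  glue_length : forall s,
    hdist (vtx (glue s).1) (vtx (send (glue s))) =
    hdist (vtx s.1) (vtx (send s))
}.

Section Surface.
Context {R : realType} (S : tri_hyp_surface R).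
Local Open Scope set_scope.

Definition corner : finType := (face S * 'I_3)%type.
Definition side : finType := (corner * bool)%type.

Definition slength (s : side) : R := hdist (vtx s.1) (vtx (send s)).

Definition triangle (t : face S) : set 'rV[R]_3 := hhull (fun i => vtx (t, i)).

(* A vertex of S is the set of the corners of triangles that lie at it. *)
Definition corner_adj : rel corner :=
  fun c c' => [exists b, (glue (c, b)).1 == c'].

Definition vertices : {set {set corner}} :=
  equivalence_partition (connect corner_adj) [set: corner].

Definition vertex_of (c : corner) : {set corner} := finset.pblock vertices c.

Definition edges : {set {set side}} :=
  [set [set s; srev s; glue s; srev (glue s)] | s : side].

Definition boundary_vertices : {set {set corner}} :=
  [set v in vertices | [exists c in v, exists b, glue (c, b) == (c, b)]].

Definition euler_char : int := #|vertices|%:Z - #|edges|%:Z + #|face S|%:Z.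

Definition area : \bar R := (\sum_(t : face S) hyp_area (triangle t))%E.

(* D is the set of distinguished vertices.  A boundary chain is a sequence
   e :: s of consecutive boundary sides with no vertex of D between them; these
   are the subarcs of the components of the complement of D in the boundary.
   When both ends are in D, it is a whole component. *)
Definition bd_next (D : {set {set corner}}) : rel side :=
  fun e e' => [&& glue e' == e', e' != srev e,
    vertex_of e'.1 == vertex_of (send e) & vertex_of e'.1 \notin D].

Definition bd_chain (D : {set {set corner}}) (e : side) (s : seq side) : bool :=
  (glue e == e) && path (bd_next D) e s.

Definition bd_arc (D : {set {set corner}}) (e : side) (s : seq side) : bool :=
  [&& bd_chain D e s, vertex_of e.1 \in D & vertex_of (send (last e s)) \in D].

Definition chain_length (e : side) (s : seq side) : R :=
  \sum_(x <- e :: s) slength x.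

End Surface.

(* A map from S to M is given by its restrictions f t to the triangles. *)
Section HMaps.
Context {R : realType} (M : gen_hyp_3manifold R) (S : tri_hyp_surface R).
Variable f : face S -> 'rV[R]_3 -> M.

Definition side_path (s : side S) (u : R) : M :=
  f s.1.1 (hgeod (vtx s.1) (vtx (send s)) u).

Definition corner_angle (c : corner S) : R :=
  angle (slength (c, true)) (side_path (c, true))
        (slength (c, false)) (side_path (c, false)).

Definition angle_sum (v : {set corner S}) : R := \sum_(c in v) corner_angle c.

(* In the order of the conditions: f is well defined on the quotient S; it is
   isometric from each triangle of S onto a hyperbolic triangle of M, which may
   be immersed; angle sums at interior, then at boundary vertices. *)
Definition h_map (D : {set {set corner S}}) : Prop :=
  [/\ forall (s : side S) u, 0 <= u <= slength s ->
        side_path s u = side_path (glue s) u,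
      forall t, develops_isometrically (@cdom R M) (@cmap R M)
                  (triangle t) (f t),
      forall v, v \in vertices S -> v \notin boundary_vertices S ->
        2 * pi <= angle_sum v
    & forall v, v \in boundary_vertices S -> v \notin D -> pi <= angle_sum v].

(* concatenation of the images of consecutive sides, by arc length *)
Fixpoint chain_path (e : side S) (s : seq (side S)) (u : R) : M :=
  if s is e' :: s' then
    if u <= slength e then side_path e u
    else chain_path e' s' (u - slength e)
  else side_path e u.

Definition geodesic_boundary (D : {set {set corner S}}) : Prop :=
  (forall e s, bd_chain D e s -> geodesic (chain_length e s) (chain_path e s))
  /\ (forall e s, bd_arc D e s -> 0 < chain_length e s).

(* Both boundary arcs are taken as issuing from v, which reverses the one that
   ends at v for the orientation of the boundary. *)
Definition is_exterior_angle (D : {set {set corner S}}) (v : {set corner S})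
    (theta : R) : Prop :=
  exists e1 s1 e2 s2,
    [/\ bd_arc D e1 s1 /\ bd_arc D e2 s2,
        vertex_of e1.1 = v /\ vertex_of e2.1 = v,
        e1 != e2
      & theta = pi - angle (chain_length e1 s1) (chain_path e1 s1)
                           (chain_length e2 s2) (chain_path e2 s2)].

End HMaps.

(* Main.v *)
(* Gauss-Bonnet with inequalities.  A nondegenerate triangle has area at most pi
   minus the sum of its angles, and the local isometry f does not increase
   angles between geodesics, so the same bound holds with the angles measured in
   M.  Summed over the triangles and regrouped by vertices, with angle sum at
   least 2 pi at an interior vertex, at least pi at an ordinary boundary vertex
   and, by the triangle inequality for angles, at least pi - theta v at a
   distinguished vertex v, this gives
     Area <= pi F - 2 pi V + pi V_b + \sum theta,
   and 3 F + V_b <= 2 E turns the right-hand side into \sum theta - 2 pi chi.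

   Degenerate triangles break the argument at distinguished vertices only, where
   a side of length 0 makes all the angles beside it 0.  But the area of such a
   triangle is 0 and so is its angle sum, which leaves an excess of pi to
   distribute; [slack] gives it to the corners at distinguished vertices. *)

From HB Require Import structures.
Require Import Defs.
From mathcomp Require Import all_boot all_order all_algebra.
From mathcomp Require Import ring lra.
From mathcomp Require Import all_classical all_reals all_analysis.
From mathcomp Require Import measurable_realfun.

Set Implicit Arguments.
Unset Strict Implicit.
Unset Printing Implicit Defensive.

Import Order.TTheory GRing.Theory Num.Theory.
Import numFieldNormedType.Exports.
Local Open Scope ring_scope.

(** * Hyperbolic functions *)

(** Only upper bounds are proved, for areas and for angles in [M]. The image of a triangle need not
    be embedded, and all that is known of it globally is that [f] does not increase distances. With
    exact distances near a vertex, this bounds the limsup angle by the hyperbolic one, which is the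
    direction required. The area of a triangle comes from a Stokes formula. In coordinates (t, h)
    around a geodesic, h being the signed distance to it, the area form is d(sinh h) dt, and along a
    geodesic edge the integral of sinh h dt is the variation of the angle of the edge with the
    curves of constant h. The area is thus bounded by a signed sum of three edge terms, which
    regroup at the vertices into pi minus the angles. The triangle inequality for angles applies to
    consecutive sides, whereas a vertex is an unordered class of corners. These have to be
    enumerated in the order of rotation, from one boundary side to the other. The same enumeration
    shows that a boundary vertex is the origin of two boundary sides, whence the term V_b in the
    count of edges. *)

Section HyperbolicFunctions.
Context {R : realType}.
Implicit Types x y t u : R.

Definition cosh x : R := (expR x + expR (- x)) / 2.
Definition sinh x : R := (expR x - expR (- x)) / 2.

Lemma cosh0 : cosh 0 = 1.
Proof. by rewrite /cosh oppr0 expR0; lra. Qed.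

Lemma sinh0 : sinh 0 = 0.
Proof. by rewrite /sinh oppr0 expR0; lra. Qed.

Lemma coshN x : cosh (- x) = cosh x.
Proof. by rewrite /cosh opprK addrC. Qed.

Lemma sinhN x : sinh (- x) = - sinh x.
Proof. by rewrite /sinh opprK; lra. Qed.

Lemma coshD x y : cosh (x + y) = cosh x * cosh y + sinh x * sinh y.
Proof. by rewrite /cosh /sinh opprD !expRD; lra. Qed.

Lemma sinhD x y : sinh (x + y) = sinh x * cosh y + cosh x * sinh y.
Proof. by rewrite /cosh /sinh opprD !expRD; lra. Qed.

Lemma coshB x y : cosh (x - y) = cosh x * cosh y - sinh x * sinh y.
Proof. by rewrite coshD coshN sinhN mulrN. Qed.

Lemma sinhB x y : sinh (x - y) = sinh x * cosh y - cosh x * sinh y.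
Proof. by rewrite sinhD coshN sinhN mulrN. Qed.

Lemma cosh2 x : cosh x ^+ 2 = 1 + sinh x ^+ 2.
Proof.
have := expRxMexpNx_1 x; rewrite /cosh /sinh => h.
by rewrite !expr_div_n; field: h.
Qed.

Lemma cosh_gt0 x : 0 < cosh x.
Proof. by rewrite /cosh divr_gt0// addr_gt0// expR_gt0. Qed.

Lemma cosh_ge1 x : 1 <= cosh x.
Proof. by have := cosh2 x; have := cosh_gt0 x; have := sqr_ge0 (sinh x); nra. Qed.

Lemma sinh_le x y : x <= y -> sinh x <= sinh y.
Proof.
move=> xy; rewrite /sinh ler_pM2r ?invr_gt0//.
by rewrite lerB// ler_expR// lerN2.
Qed.

Lemma sinh_lt x y : x < y -> sinh x < sinh y.
Proof.
move=> xy; rewrite /sinh ltr_pM2r ?invr_gt0//.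
by rewrite ltrB// ltr_expR// ltrN2.
Qed.

Lemma sinh_ge0 x : 0 <= x -> 0 <= sinh x.
Proof. by move/sinh_le; rewrite sinh0. Qed.

Lemma sinh_gt0 x : 0 < x -> 0 < sinh x.
Proof. by move/sinh_lt; rewrite sinh0. Qed.

Lemma sinh_inj : injective sinh.
Proof.
move=> x y e; case: (ltgtP x y) => // /sinh_lt; by rewrite e ltxx.
Qed.

Lemma is_derive_expRN x : is_derive x 1 (fun x => expR (- x)) (- expR (- x)).
Proof.
have -> : - expR (- x) = expR (- x) * - 1 by rewrite mulrN1.
apply: (@is_derive1_comp _ expR -%R).
Qed.

Lemma is_derive_cosh x : is_derive x 1 cosh (sinh x).
Proof.
have h := is_derive_expRN x.
rewrite (_ : cosh = (2^-1) \*: (expR + (fun x => expR (- x)))); last first.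
  by apply/funext => z; rewrite /cosh mulrC.
by apply: is_derive_eq; rewrite /sinh mulrC.
Qed.

Lemma is_derive_sinh x : is_derive x 1 sinh (cosh x).
Proof.
have h := is_derive_expRN x.
rewrite (_ : sinh = (2^-1) \*: (expR - (fun x => expR (- x)))); last first.
  by apply/funext => z; rewrite /sinh mulrC.
by apply: is_derive_eq; rewrite /cosh opprK mulrC.
Qed.

Lemma continuous_cosh : continuous cosh.
Proof.
move=> x; apply: differentiable_continuous; apply/derivable1_diffP.
by have [] := is_derive_cosh x.
Qed.

Lemma continuous_sinh : continuous sinh.
Proof.
move=> x; apply: differentiable_continuous; apply/derivable1_diffP.
by have [] := is_derive_sinh x.
Qed.

Lemma le_sinh x : 0 <= x -> x <= sinh x.
Proof.
move=> x0; rewrite -subr_ge0.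
have D y : is_derive y 1 (sinh - id) (cosh y - 1).
  by have := is_derive_sinh y => h; apply: is_derive_eq.
have : (sinh - id) 0 <= (sinh - id) x.
  apply: ger0_derive1_ndecr => //.
  - by move=> y _; rewrite derive1E derive_val subr_ge0 cosh_ge1.
  - apply: continuous_subspaceT => y.
    apply: differentiable_continuous; apply/derivable1_diffP.
    by have [] := D y.
by rewrite !fctE/= sinh0 subrr.
Qed.

(** This is exp (- 2 x) >= 1 - 2 x multiplied out. It makes sinh t * sinh t' comparable to t * t'
    for small t and t', up to a factor close to 1. *)
Lemma sinh_le_expR x : 0 <= x -> sinh x <= x * expR x.
Proof.
move=> x0; rewrite /sinh ler_pdivrMr//.
have h := expR_ge1Dx (- (2 * x)).
have e : expR (- x) = expR x * expR (- (2 * x)).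
  by rewrite -expRD; congr expR; ring.
rewrite e; have := expR_gt0 x; nra.
Qed.

Lemma cosh_sub x y : cosh x - cosh y = 2 * sinh ((x + y) / 2) * sinh ((x - y) / 2).
Proof.
have {1}-> : x = (x + y) / 2 + (x - y) / 2 by lra.
have {3}-> : y = (x + y) / 2 - (x - y) / 2 by lra.
by rewrite coshD coshB; ring.
Qed.

Lemma cosh_lt x y : 0 <= x -> x < y -> cosh x < cosh y.
Proof.
move=> x0 xy; rewrite -subr_gt0 cosh_sub.
by apply: mulr_gt0; [apply: mulr_gt0 => //|]; apply: sinh_gt0; lra.
Qed.

(** By [cosh_sub] and sinh u >= u. It carries a bound on cosh from the hyperbolic law of cosines
    over to the square that enters the Euclidean one. *)
Lemma sqr_sub_le_cosh x y : 0 <= y -> y <= x ->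
  x ^+ 2 - y ^+ 2 <= 2 * (cosh x - cosh y).
Proof.
move=> y0 yx; rewrite cosh_sub.
have h1 : (x + y) / 2 <= sinh ((x + y) / 2) by apply: le_sinh; lra.
have h2 : (x - y) / 2 <= sinh ((x - y) / 2) by apply: le_sinh; lra.
nra.
Qed.

Definition arcosh x : R := ln (x + Num.sqrt (x ^+ 2 - 1)).

Lemma arcoshK x : 1 <= x -> cosh (arcosh x) = x.
Proof.
move=> x1; rewrite /cosh /arcosh.
set s := Num.sqrt _.
have s0 : 0 <= s by rewrite sqrtr_ge0.
have s2 : s ^+ 2 = x ^+ 2 - 1 by rewrite sqr_sqrtr//; nra.
have p : 0 < x + s by lra.
rewrite expRN lnK ?posrE//.
apply: (mulIf (lt0r_neq0 p)).
by field: s2; rewrite lt0r_neq0.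
Qed.

Lemma arcosh_ge0 x : 1 <= x -> 0 <= arcosh x.
Proof. by move=> x1; apply: ln_ge0; rewrite -[1]addr0 lerD// sqrtr_ge0. Qed.

Lemma cosh_inj x y : 0 <= x -> 0 <= y -> cosh x = cosh y -> x = y.
Proof.
move=> x0 y0 e; case: (ltgtP x y) => // /cosh_lt.
- by move/(_ x0); rewrite e ltxx.
- by move/(_ y0); rewrite e ltxx.
Qed.

Lemma coshK x : 0 <= x -> arcosh (cosh x) = x.
Proof.
move=> x0; apply: cosh_inj => //; first by rewrite arcosh_ge0// cosh_ge1.
by rewrite arcoshK// cosh_ge1.
Qed.

Lemma sinhE x : 0 <= x -> sinh x = Num.sqrt (cosh x ^+ 2 - 1).
Proof.
by move=> x0; rewrite cosh2 addrC addKr sqrtr_sqr ger0_norm// sinh_ge0.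
Qed.

Lemma arcosh_le x y : 1 <= x -> x <= y -> arcosh x <= arcosh y.
Proof.
move=> x1 xy; rewrite leNgt; apply/negP => /cosh_lt.
rewrite arcosh_ge0; last lra.
by rewrite !arcoshK ?(le_trans x1)// => /(_ isT); rewrite ltNge xy.
Qed.

Definition arsinh x : R := ln (x + Num.sqrt (1 + x ^+ 2)).

Lemma arsinhK : cancel arsinh sinh.
Proof.
move=> x; rewrite /sinh /arsinh.
set s := Num.sqrt _.
have s0 : 0 <= s by rewrite sqrtr_ge0.
have s2 : s ^+ 2 = 1 + x ^+ 2 by rewrite sqr_sqrtr//; nra.
have p : 0 < x + s.
  have : `|x| < s by rewrite -(@ltr_pXn2r _ 2)// ?nnegrE// s2 real_normK ?num_real//; lra.
  by rewrite ltr_norml => /andP[]; lra.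
rewrite expRN lnK ?posrE//.
apply: (mulIf (lt0r_neq0 p)).
by field: s2; rewrite lt0r_neq0.
Qed.

Lemma sqrt_1sinh2 x : Num.sqrt (1 + sinh x ^+ 2) = cosh x.
Proof. by rewrite -cosh2 sqrtr_sqr gtr0_norm// cosh_gt0. Qed.

End HyperbolicFunctions.

(** * The hyperboloid *)

(* The unit vector tangent at p to the geodesic from p to q; it is 0 if p = q,
   where the inverse is that of 0. *)
HB.lock Definition hdir {R : realType} {n : nat} (p q : 'rV[R]_n.+1) : 'rV[R]_n.+1 :=
  (sinh (hdist p q))^-1 *: (q - cosh (hdist p q) *: p).

Section Hyperboloid.
Context {R : realType} {n : nat}.
Implicit Types (x y z u v w p q r : 'rV[R]_n.+1) (a b c d t : R).

Lemma minkC x y : mink x y = mink y x.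
Proof.
by rewrite /mink mulrC; congr (_ + _); apply: eq_bigr => i _; rewrite mulrC.
Qed.

Lemma minkDl x y z : mink (x + y) z = mink x z + mink y z.
Proof.
rewrite /mink mxE mulrDl opprD addrACA -big_split/=; congr (_ + _).
by apply: eq_bigr => i _; rewrite mxE mulrDl.
Qed.

Lemma minkZl a x y : mink (a *: x) y = a * mink x y.
Proof.
rewrite /mink mxE mulrDr mulrN mulrA big_distrr/=; congr (_ + _).
by apply: eq_bigr => i _; rewrite mxE mulrA.
Qed.

Lemma minkDr x y z : mink x (y + z) = mink x y + mink x z.
Proof. by rewrite minkC minkDl !(minkC x). Qed.

Lemma minkZr a x y : mink x (a *: y) = a * mink x y.
Proof. by rewrite minkC minkZl (minkC x). Qed.

Lemma minkNl x y : mink (- x) y = - mink x y.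
Proof. by rewrite -scaleN1r minkZl mulN1r. Qed.

Lemma minkNr x y : mink x (- y) = - mink x y.
Proof. by rewrite minkC minkNl minkC. Qed.

Definition mink_lin := (minkDl, minkDr, minkNl, minkNr, minkZl, minkZr).

Lemma sum_Cauchy_Schwarz (X Y : 'I_n -> R) :
  (\sum_i X i * Y i) ^+ 2 <= (\sum_i X i ^+ 2) * (\sum_i Y i ^+ 2).
Proof.
set B := \sum_i X i * Y i; set A := \sum_i _; set C := \sum_i _.
have A0 : 0 <= A by apply: sumr_ge0 => i _; exact: sqr_ge0.
have : 0 <= C by apply: sumr_ge0 => i _; exact: sqr_ge0.
rewrite le_eqVlt => /predU1P[C0|C0].
  have Y0 i : Y i = 0.
    apply/eqP; rewrite -sqrf_eq0; apply/eqP; move/esym: C0 => /eqP.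
    rewrite /C psumr_eq0; last by move=> j _; exact: sqr_ge0.
    by move=> /allP/(_ i); rewrite mem_index_enum => /(_ isT)/eqP.
  rewrite /B big1 ?expr0n/= ?mulr_ge0// -?C0// => i _.
  by rewrite Y0 mulr0.
have : 0 <= \sum_i (C * X i - B * Y i) ^+ 2.
  by apply: sumr_ge0 => i _; exact: sqr_ge0.
have -> : \sum_i (C * X i - B * Y i) ^+ 2 = C * (A * C - B ^+ 2).
  transitivity (C ^+ 2 * A - 2 * C * B * B + B ^+ 2 * C); last by ring.
  (* The occurrences of [B] and [C] that act as scalars are abstracted, so that only the remaining
     ones are unfolded into sums. *)
  move: {1 2 4}B {1 2 3}C => b c.
  rewrite /A /B /C !big_distrr/= -sumrB -big_split/=.
  by apply: eq_bigr => i _; ring.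
by rewrite pmulr_rge0// subr_ge0.
Qed.

Let sp x y : R := \sum_(i < n) x 0 (lift ord0 i) * y 0 (lift ord0 i).

Let spCS x y : sp x y ^+ 2 <= sp x x * sp y y.
Proof. exact: sum_Cauchy_Schwarz. Qed.

Let sp_ge0 x : 0 <= sp x x.
Proof. by apply: sumr_ge0 => i _; exact: sqr_ge0. Qed.

Let minkE x y : mink x y = - (x 0 ord0 * y 0 ord0) + sp x y.
Proof. by []. Qed.

Lemma hyp_ge1 x : hyp x -> 1 <= x 0 ord0.
Proof.
by case; rewrite minkE => h x0; have := sp_ge0 x; nra.
Qed.

(** Reversed Cauchy-Schwarz inequality: if a and b are the time coordinates, the square of the
    spatial product is at most (a^2 - 1)(b^2 - 1) = (a b - 1)^2 - (a - b)^2. *)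
Lemma mink_leN1 x y : hyp x -> hyp y -> mink x y <= -1.
Proof.
move=> hx hy; have x1 := hyp_ge1 hx; have y1 := hyp_ge1 hy.
case: hx => hx _; case: hy => hy _.
move: x1 y1 hx hy (spCS x y); rewrite !minkE.
set a := x 0 ord0; set b := y 0 ord0 => x1 y1 hx hy h.
suff : sp x y <= a * b - 1 by lra.
have p : 0 <= a * b - 1 by nra.
have : sp x y ^+ 2 <= (a * b - 1) ^+ 2.
  apply: (le_trans h).
  have -> : sp x x = a * a - 1 by lra.
  have -> : sp y y = b * b - 1 by lra.
  by have := sqr_ge0 (a - b); nra.
by move=> H; rewrite leNgt; apply/negP => H'; nra.
Qed.

Let tangent_sp x w : hyp x -> mink w x = 0 ->
  w 0 ord0 ^+ 2 * x 0 ord0 ^+ 2 <= sp w w * (x 0 ord0 ^+ 2 - 1).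
Proof.
move=> [hx _] h; move: (spCS w x); move: hx h; rewrite !minkE => hx h.
have -> : sp w x = w 0 ord0 * x 0 ord0 by lra.
have -> : sp x x = x 0 ord0 ^+ 2 - 1 by lra.
by rewrite exprMn.
Qed.

(** Tangent spaces of the hyperboloid are spacelike: orthogonality to [x] and Cauchy-Schwarz bound
    the time coordinate of [w] by its spatial norm. *)
Lemma mink_tangent_ge0 x w : hyp x -> mink w x = 0 -> 0 <= mink w w.
Proof.
move=> hx h; have := tangent_sp hx h; have := hyp_ge1 hx.
rewrite minkE => x1 h1; have w0 := sp_ge0 w.
have : 0 <= x 0 ord0 ^+ 2 * (sp w w - w 0 ord0 ^+ 2) by lra.
by rewrite pmulr_rge0; [rewrite expr2; lra|nra].
Qed.

Lemma mink_tangent_eq0 x w : hyp x -> mink w x = 0 -> mink w w = 0 -> w = 0.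
Proof.
move=> hx h; have := tangent_sp hx h; have := hyp_ge1 hx.
rewrite minkE => x1 h1 h2.
have w0 : sp w w = 0 by have := sp_ge0 w; nra.
apply/rowP => j; rewrite mxE.
case: (unliftP ord0 j) => [i|] ->; last by apply/eqP; rewrite -sqrf_eq0; apply/eqP; lra.
apply/eqP; rewrite -sqrf_eq0; apply/eqP; move/eqP: w0.
rewrite psumr_eq0; last by move=> k _; exact: sqr_ge0.
by move=> /allP/(_ i); rewrite mem_index_enum => /(_ isT)/eqP.
Qed.

(** The Euclidean size of a unit tangent vector is not bounded by its Minkowski norm alone, but
    grows with the height of [x]. [hdist_nbhs] needs this bound. *)
Lemma tangent_coord_le x w j : hyp x -> mink w x = 0 -> mink w w <= 1 ->
  `|w 0 j| <= x 0 ord0.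
Proof.
move=> hx h; have := tangent_sp hx h; have x1 := hyp_ge1 hx.
rewrite minkE => h1 h2.
have w2 : sp w w <= x 0 ord0 ^+ 2 by nra.
rewrite -(@ler_pXn2r _ 2)// ?nnegrE//; last lra.
rewrite real_normK ?num_real//.
case: (unliftP ord0 j) => [i|] ->; last by have := mink_tangent_ge0 hx h; rewrite minkE; lra.
apply: le_trans w2; rewrite /sp (bigD1 i)//= -expr2 lerDl.
by apply: sumr_ge0 => k _; exact: sqr_ge0.
Qed.

Lemma mink0 x : mink 0 x = 0.
Proof. by rewrite -(scale0r 0) minkZl mul0r. Qed.

Lemma mink_comb a b c d p q u v :
  mink (a *: p + b *: u) (c *: q + d *: v) =
  a * c * mink p q + a * d * mink p v + b * c * mink u q + b * d * mink u v.
Proof. by rewrite !mink_lin; ring. Qed.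

Lemma mink_tangent_CS x u v : hyp x -> mink u x = 0 -> mink v x = 0 ->
  mink u v ^+ 2 <= mink u u * mink v v.
Proof.
move=> hx hu hv.
have q a b : 0 <= mink (a *: u + b *: v) (a *: u + b *: v).
  by apply: (@mink_tangent_ge0 x) => //; rewrite !mink_lin hu hv; ring.
have {}q a b : 0 <= a ^+ 2 * mink u u + 2 * a * b * mink u v + b ^+ 2 * mink v v.
  by have := q a b; rewrite !mink_lin (minkC v u); lra.
have u0 := mink_tangent_ge0 hx hu; have v0 := mink_tangent_ge0 hx hv.
move: u0; rewrite le_eqVlt => /predU1P[u0|u0].
  by rewrite (mink_tangent_eq0 hx hu (esym u0)) !mink0 expr0n/= mul0r.
have := q (- mink u v) (mink u u).
have -> : (- mink u v) ^+ 2 * mink u u + 2 * (- mink u v) * mink u u * mink u v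
   + mink u u ^+ 2 * mink v v = mink u u * (mink u u * mink v v - mink u v ^+ 2).
  by ring.
by rewrite pmulr_rge0// subr_ge0.
Qed.

Lemma hdistE x y : hdist x y = arcosh (- mink x y).
Proof. by rewrite /hdist /arcosh sqrrN. Qed.

Lemma cosh_hdist x y : hyp x -> hyp y -> cosh (hdist x y) = - mink x y.
Proof. by move=> hx hy; rewrite hdistE arcoshK// lerNr mink_leN1. Qed.

Lemma hdist_ge0 x y : hyp x -> hyp y -> 0 <= hdist x y.
Proof. by move=> hx hy; rewrite hdistE arcosh_ge0// lerNr mink_leN1. Qed.

Lemma hdistC x y : hdist x y = hdist y x.
Proof. by rewrite /hdist minkC. Qed.

Lemma hdistxx x : hyp x -> hdist x x = 0.
Proof. by move=> [hx _]; rewrite hdistE hx opprK -cosh0 coshK. Qed.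

(** The difference [x - y] is then tangent at [y] and null, hence 0. *)
Lemma hdist_eq0 x y : hyp x -> hyp y -> hdist x y = 0 -> x = y.
Proof.
move=> hx hy h; have := cosh_hdist hx hy; rewrite h cosh0 => m.
have [ex _] := hx; have [ey _] := hy.
apply/eqP; rewrite -subr_eq0; apply/eqP.
by apply: (@mink_tangent_eq0 y) => //; rewrite !mink_lin ?(minkC y x); lra.
Qed.

Section Direction.
Variables p q : 'rV[R]_n.+1.
Hypotheses (hp : hyp p) (hq : hyp q).
Local Notation d := (hdist p q).

Lemma hdirxx : hdir p p = 0.
Proof. by rewrite hdir.unlock hdistxx// sinh0 invr0 scale0r. Qed.

Lemma mink_hdir : mink (hdir p q) p = 0.
Proof.
have [ep _] := hp.
by rewrite hdir.unlock !mink_lin ep (minkC q) cosh_hdist//; ring.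
Qed.

Lemma hdist_gt0 : p != q -> 0 < d.
Proof.
by move=> pq; rewrite lt0r hdist_ge0// andbT; apply: contra pq => /eqP /hdist_eq0 ->.
Qed.

Lemma hdir_unit : p != q -> mink (hdir p q) (hdir p q) = 1.
Proof.
move=> /hdist_gt0 d0; have [ep _] := hp; have [eq _] := hq.
have s0 := sinh_gt0 d0.
rewrite hdir.unlock !mink_lin ep eq (minkC q).
have -> : mink p q = - cosh d by rewrite cosh_hdist// opprK.
have h := cosh2 d.
by field: h; rewrite lt0r_neq0.
Qed.

Lemma hdir_le1 : mink (hdir p q) (hdir p q) <= 1.
Proof.
have [e|/hdir_unit ->//] := eqVneq p q.
by rewrite -e hdirxx mink0.
Qed.

Lemma hdir_decomp : q = cosh d *: p + sinh d *: hdir p q.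
Proof.
have [e|/hdist_gt0 d0] := eqVneq p q.
  by rewrite -e hdistxx// cosh0 sinh0 scale1r scale0r addr0.
rewrite hdir.unlock scalerA mulfV ?scale1r; last by rewrite lt0r_neq0// sinh_gt0.
by rewrite addrC subrK.
Qed.

Lemma hgeodE t : hgeod p q t = cosh t *: p + sinh t *: hdir p q.
Proof.
rewrite /hgeod -/(cosh t) -/(sinh t) -cosh_hdist//.
by rewrite -sinhE ?hdist_ge0// hdir.unlock scalerA.
Qed.

Lemma hgeod0 : hgeod p q 0 = p.
Proof. by rewrite hgeodE cosh0 sinh0 scale1r scale0r addr0. Qed.

Lemma hgeod_end : hgeod p q d = q.
Proof. by rewrite hgeodE -hdir_decomp. Qed.

Lemma hgeod_comb t : p != q ->
  hgeod p q t = (sinh (d - t) / sinh d) *: p + (sinh t / sinh d) *: q.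
Proof.
move=> /hdist_gt0 d0; rewrite hgeodE hdir.unlock sinhB.
rewrite scalerA scalerBr addrCA addrC scalerA -scaleNr -scalerDl.
congr (_ *: _ + _); field; by rewrite lt0r_neq0// sinh_gt0.
Qed.

Lemma hgeod_hull t : 0 <= t <= d -> exists a b, [/\ 0 <= a, 0 <= b,
  hgeod p q t = a *: p + b *: q & hyp (hgeod p q t)].
Proof.
move=> /andP[t0 td].
have [e|pq] := eqVneq p q.
  have t00 : t = 0.
    by apply/eqP; rewrite eq_le t0 andbT (le_trans td)// -e hdistxx.
  exists 1, 0; rewrite t00 hgeod0 scale1r scale0r addr0.
  by split.
have d0 := hdist_gt0 pq; have s0 := sinh_gt0 d0.
have a0 : 0 <= sinh (d - t) / sinh d by rewrite divr_ge0 ?sinh_ge0 ?subr_ge0// ltW.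
have b0 : 0 <= sinh t / sinh d by rewrite divr_ge0 ?sinh_ge0// ltW.
exists (sinh (d - t) / sinh d), (sinh t / sinh d).
rewrite -hgeod_comb//; split => //; split.
  rewrite hgeodE mink_comb (minkC p (hdir _ _)) mink_hdir hdir_unit//.
  by have [-> _] := hp; have := cosh2 t; lra.
rewrite hgeod_comb// !mxE.
have [_ p0] := hp; have [_ q0] := hq.
have ab : 0 < sinh (d - t) / sinh d \/ 0 < sinh t / sinh d.
  move: t0; rewrite le_eqVlt => /predU1P[<-|t0].
    by left; rewrite subr0 divr_gt0.
  by right; rewrite divr_gt0// sinh_gt0.
by case: ab => ?; nra.
Qed.

Lemma hgeod_hyp t : 0 <= t <= d -> hyp (hgeod p q t).
Proof. by move=> /hgeod_hull[a [b []]]. Qed.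

Lemma hdist_hgeod t s : 0 <= t <= d -> 0 <= s <= d ->
  hdist (hgeod p q t) (hgeod p q s) = `|t - s|.
Proof.
have [e|pq] := eqVneq p q.
  rewrite -{1 2}e hdistxx// => /andP[t0 t1] /andP[u0 u1].
  have -> : t = 0 by lra.
  have -> : s = 0 by lra.
  by rewrite subrr normr0 hdistxx// hgeod0.
move=> ht hu; apply: cosh_inj => //; first by apply: hdist_ge0; exact: hgeod_hyp.
rewrite (cosh_hdist (hgeod_hyp ht) (hgeod_hyp hu)) !hgeodE mink_comb (minkC p (hdir _ _)) mink_hdir hdir_unit//.
have [-> _] := hp.
have -> : cosh `|t - s| = cosh (t - s).
  by case: (ger0P (t - s)) => // _; rewrite coshN.
by rewrite coshB; ring.
Qed.

End Direction.

(** Law of cosines at the middle point: the product of the two directions from [y] is at least -1 by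
    Cauchy-Schwarz, so cosh of the third side is at most cosh of the sum of the other two. *)
Lemma hdist_triangle y x z : hyp x -> hyp y -> hyp z ->
  hdist x z <= hdist x y + hdist y z.
Proof.
move=> hx hy hz.
have a0 : 0 <= hdist x y by apply: hdist_ge0.
have b0 : 0 <= hdist y z by apply: hdist_ge0.
rewrite -(coshK (addr_ge0 a0 b0)) hdistE arcosh_le//.
  by rewrite lerNr mink_leN1.
have ex := hdir_decomp hy hx; have ez := hdir_decomp hy hz.
have hu := mink_hdir hy hx; have hv := mink_hdir hy hz.
have u1 := hdir_le1 hy hx; have v1 := hdir_le1 hy hz.
move: (hdir y x) (hdir y z) ex ez hu hv u1 v1 => u v ex ez hu hv u1 v1.
rewrite (hdistC y x) in ex.
have -> : - mink x z = cosh (hdist x y) * cosh (hdist y z)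
    - sinh (hdist x y) * sinh (hdist y z) * mink u v.
  rewrite {1}ex {1}ez mink_comb (minkC y v) hu hv.
  by have [-> _] := hy; ring.
have c := mink_tangent_CS hy hu hv.
have u0 := mink_tangent_ge0 hy hu; have v0 := mink_tangent_ge0 hy hv.
have {}c : mink u v ^+ 2 <= 1 by nra.
have {}c : - 1 <= mink u v by nra.
rewrite coshD.
have := mulr_ge0 (sinh_ge0 a0) (sinh_ge0 b0); nra.
Qed.

End Hyperboloid.

(** * Angles in metric spaces *)

Section Angles.
Context {R : realType} {M : metricType R}.
Implicit Types (c : R -> M) (x y z : M) (l t e d A : R).
Local Open Scope classical_set_scope.

Lemma at_right0P (P : set R) :
  ((0 : R)^'+ P) <-> exists2 d, 0 < d & forall t, 0 < t < d -> P t.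
Proof.
split.
- move=> /nbhs_ballP[d /= d0 H]; exists d => // t /andP[t0 td].
  by apply: H => //=; rewrite /ball/= sub0r normrN gtr0_norm.
- move=> [d d0 H]; apply/nbhs_ballP; exists d => //= t /=.
  by rewrite /ball/= sub0r normrN => td t0; apply: H; rewrite t0 (le_lt_trans _ td)// ler_norm.
Qed.

Lemma angle_filterP l l' (V : set (R * R)) :
  within [set z : R * R | z.1 <= l /\ z.2 <= l']
    (filter_prod (0 : R)^'+ (0 : R)^'+) V <->
  exists2 d, 0 < d & forall t t', 0 < t < d -> 0 < t' < d ->
    t <= l -> t' <= l' -> V (t, t').
Proof.
split.
- move=> [[P Q] /= [/at_right0P[d d0 hP] /at_right0P[d' d'0 hQ]] H].
  exists (Num.min d d'); first by rewrite lt_min d0.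
  move=> t t' /andP[t0 td] /andP[t'0 t'd] tl tl'.
  move: td t'd; rewrite !lt_min => /andP[td _] /andP[_ td'].
  apply: (H (t, t')) => //=; split; [apply: hP|apply: hQ]; first by rewrite t0.
  by rewrite t'0.
- move=> [d d0 H].
  exists ([set t | 0 < t < d], [set t | 0 < t < d]) => /=.
    by split; apply/at_right0P; exists d.
  by move=> [t t'] /= [ht ht'] [hl hl']; exact: H.
Qed.

Lemma comparison_arg x y z :
  -1 <= (mdist x y ^+ 2 + mdist x z ^+ 2 - mdist y z ^+ 2)
        / (2 * mdist x y * mdist x z) <= 1.
Proof.
(* A zero distance makes the denominator 0, whose inverse is 0; the argument is then 0. *)
have := mdist_ge0 x y; rewrite le_eqVlt => /predU1P[<-|a0].
  by rewrite mulr0 mul0r invr0 mulr0; lra.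
have := mdist_ge0 x z; rewrite le_eqVlt => /predU1P[<-|b0].
  by rewrite mulr0 invr0 mulr0; lra.
have h1 := metric_triangle y x z; rewrite (metric_sym y x) in h1.
have h2 := metric_triangle x y z.
have h3 := metric_triangle x z y; rewrite (metric_sym z y) in h3.
have e0 := mdist_ge0 y z.
have p : 0 < 2 * mdist x y * mdist x z by rewrite !mulr_gt0.
by rewrite ler_pdivlMr// ler_pdivrMr//; apply/andP; split; nra.
Qed.

Lemma comparison_angle_ge0 x y z : 0 <= comparison_angle x y z.
Proof. exact/acos_ge0/comparison_arg. Qed.

Lemma comparison_angle_lepi x y z : comparison_angle x y z <= pi.
Proof. exact/acos_lepi/comparison_arg. Qed.

Lemma comparison_angleC x y z : comparison_angle x y z = comparison_angle x z y.
Proof.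
rewrite /comparison_angle (metric_sym z y) (addrC (mdist x z ^+ 2)).
by rewrite (mulrAC 2 (mdist x y)).
Qed.

Section Limsup.
Variables (l l' : R) (c c' : R -> M).

Let L := limf_esup
    (fun z : R * R => (comparison_angle (c 0) (c z.1) (c' z.2))%:E)
    (within [set z : R * R | z.1 <= l /\ z.2 <= l']
       (filter_prod (0 : R)^'+ (0 : R)^'+)).

Let angleE : angle l c l' c' = fine L. Proof. by []. Qed.

(** The filter is then improper: it contains the empty set, over which the supremum is -oo, and
    [fine] sends -oo to 0. *)
Lemma angle_zero_length : l <= 0 \/ l' <= 0 -> angle l c l' c' = 0.
Proof.
move=> h; rewrite angleE; suff -> : L = -oo%E by [].
apply/eqP; rewrite -leeNy_eq; apply: ereal_inf_lbound; exists set0.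
  apply/angle_filterP; exists 1 => // t t' /andP[t0 _] /andP[t'0 _] tl tl'.
  by case: h => h; exfalso; lra.
by rewrite image_set0 ereal_sup0.
Qed.

Hypotheses (l0 : 0 < l) (l'0 : 0 < l').

Let L_ge0 : (0 <= L)%E.
Proof.
apply: le_ereal_inf_tmp => _ [V /angle_filterP[d d0 hV] <-].
pose t := Num.min (d / 2) (Num.min l l').
have t0 : 0 < t by rewrite !lt_min l0 l'0 divr_gt0.
have td : t < d by rewrite (@le_lt_trans _ _ (d / 2)) ?ge_min ?lexx//; lra.
have tl : t <= l by rewrite /t !ge_min lexx orbT.
have tl' : t <= l' by rewrite /t !ge_min lexx !orbT.
apply: le_trans (ereal_sup_ubound _); last first.
  by exists (t, t) => //; apply: hV => //; rewrite t0.
by rewrite lee_fin comparison_angle_ge0.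
Qed.

Let L_lepi : (L <= pi%:E)%E.
Proof.
apply: (@le_trans _ _ (ereal_sup ((fun z : R * R =>
    (comparison_angle (c 0) (c z.1) (c' z.2))%:E) @` setT))).
  apply: ereal_inf_lbound; exists setT => //.
  by apply/angle_filterP; exists 1.
apply: ge_ereal_sup => _ [z _ <-].
by rewrite lee_fin comparison_angle_lepi.
Qed.

Let L_fin : L = (angle l c l' c')%:E.
Proof.
rewrite angleE fineK// fin_numE; apply/andP; split; apply/eqP => h.
  by move: L_ge0; rewrite h.
by move: L_lepi; rewrite h.
Qed.

Lemma angle_ge_comparison e : 0 < e ->
  exists2 d, 0 < d & forall t t', 0 < t < d -> 0 < t' < d ->
    comparison_angle (c 0) (c t) (c' t') <= angle l c l' c' + e.
Proof.
move=> e0.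
have : (L < (angle l c l' c' + e)%:E)%E by rewrite L_fin lte_fin; lra.
move/ereal_inf_lt => [_ [V /angle_filterP[d d0 hV] <-] hs].
exists (Num.min d (Num.min l l')); first by rewrite !lt_min d0 l0.
move=> t t' /andP[t0 td] /andP[t'0 t'd].
move: td t'd; rewrite !lt_min => /and3P[td tl _] /and3P[t'd _ tl'].
rewrite -lee_fin; apply: le_trans (ltW hs); apply: ereal_sup_ubound.
by exists (t, t') => //; apply: hV; rewrite ?t0 ?t'0// ltW.
Qed.

Lemma angle_le A d : 0 < d ->
  (forall t t', 0 < t < d -> 0 < t' < d ->
    comparison_angle (c 0) (c t) (c' t') <= A) ->
  angle l c l' c' <= A.
Proof.
move=> d0 h; rewrite -lee_fin -L_fin.
apply: (@le_trans _ _ (ereal_sup ((fun z : R * R =>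
    (comparison_angle (c 0) (c z.1) (c' z.2))%:E) @`
    [set z : R * R | 0 < z.1 < d /\ 0 < z.2 < d]))).
  apply: ereal_inf_lbound; eexists; last by [].
  by apply/angle_filterP; exists d.
by apply: ge_ereal_sup => _ [[t t'] [? ?] <-]; rewrite lee_fin; exact: h.
Qed.

End Limsup.

Lemma angle_ge0 l c l' c' : 0 <= angle l c l' c'.
Proof.
have [l0|l0] := leP l 0; first by rewrite angle_zero_length//; left.
have [l'0|l'0] := leP l' 0; first by rewrite angle_zero_length//; right.
apply/ler_addgt0Pr => e e0.
have [d d0 /(_ (d / 2) (d / 2))] := angle_ge_comparison c c' l0 l'0 e0.
have hd : 0 < d / 2 < d by apply/andP; split; lra.
by move=> /(_ hd hd); apply: le_trans; exact: comparison_angle_ge0.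
Qed.

Lemma angle_le_pi l c l' c' : angle l c l' c' <= pi.
Proof.
have [l0|l0] := leP l 0; first by rewrite angle_zero_length ?pi_ge0//; left.
have [l'0|l'0] := leP l' 0; first by rewrite angle_zero_length ?pi_ge0//; right.
by apply: (@angle_le _ _ _ _ l0 l'0 _ 1) => // t t' _ _; exact: comparison_angle_lepi.
Qed.

(** A limsup at 0 sees only the germs of the curves; the lengths matter only through being
    positive. *)
Lemma angle_germ l1 l1' l2 l2' c1 c1' c2 c2' d :
  0 < l1 -> 0 < l1' -> 0 < l2 -> 0 < l2' -> 0 < d ->
  (forall t, 0 <= t < d -> c1 t = c2 t) ->
  (forall t, 0 <= t < d -> c1' t = c2' t) ->
  angle l1 c1 l1' c1' <= angle l2 c2 l2' c2'.
Proof.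
move=> l10 l1'0 l20 l2'0 d0 h h'; apply/ler_addgt0Pr => e e0.
have [d' d'0 H] := angle_ge_comparison c2 c2' l20 l2'0 e0.
apply: (@angle_le _ _ _ _ l10 l1'0 _ (Num.min d d')); first by rewrite lt_min d0.
move=> t t'; rewrite !lt_min => /and3P[t0 td td'] /and3P[t'0 t'd t'd'].
have z0 : 0 <= (0 : R) < d by rewrite lexx.
rewrite (h _ z0) (h t) ?td ?(ltW t0)// (h' t') ?t'd ?(ltW t'0)//.
by apply: H; rewrite ?t0 ?t'0.
Qed.

Lemma angleC l c l' c' : c 0 = c' 0 -> angle l c l' c' = angle l' c' l c.
Proof.
suff H l1 c1 l2 c2 : c1 0 = c2 0 -> angle l1 c1 l2 c2 <= angle l2 c2 l1 c1.
  by move=> h; apply/eqP; rewrite eq_le !H.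
move=> h.
have [l0|l0] := leP l1 0; first by rewrite angle_zero_length ?angle_ge0//; left.
have [l'0|l'0] := leP l2 0; first by rewrite angle_zero_length ?angle_ge0//; right.
apply/ler_addgt0Pr => e e0.
have [d d0 H] := angle_ge_comparison c2 c1 l'0 l0 e0.
apply: (@angle_le _ _ _ _ l0 l'0 _ d) => // t t' ht ht'.
by rewrite comparison_angleC h; exact: H.
Qed.

Definition unit_speed_at0 c : Prop :=
  exists2 d, 0 < d & forall t, 0 < t < d -> mdist (c 0) (c t) = t.

Lemma comparison_angle_gt x y z A : 0 <= A <= pi ->
  0 < mdist x y -> 0 < mdist x z -> A < comparison_angle x y z ->
  mdist x y ^+ 2 + mdist x z ^+ 2 - 2 * mdist x y * mdist x z * cos A <
  mdist y z ^+ 2.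
Proof.
move=> hA a0 b0 h.
have p : 0 < 2 * mdist x y * mdist x z by rewrite !mulr_gt0.
have k := comparison_angle_lepi x y z; have k0 := comparison_angle_ge0 x y z.
have : cos (comparison_angle x y z) < cos A by rewrite ltr_cos ?in_itv//= k0.
rewrite /comparison_angle acosK ?in_itv/= ?comparison_arg// ltr_pdivrMr//.
lra.
Qed.

Lemma comparison_angle_le x y z A : 0 <= A <= pi ->
  0 < mdist x y -> 0 < mdist x z -> comparison_angle x y z <= A ->
  mdist y z ^+ 2 <=
  mdist x y ^+ 2 + mdist x z ^+ 2 - 2 * mdist x y * mdist x z * cos A.
Proof.
move=> hA a0 b0 h.
have p : 0 < 2 * mdist x y * mdist x z by rewrite !mulr_gt0.
have k := comparison_angle_lepi x y z; have k0 := comparison_angle_ge0 x y z.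
have : cos A <= cos (comparison_angle x y z) by rewrite leNgt ltr_cos ?in_itv//= ?k0// -leNgt.
rewrite /comparison_angle acosK ?in_itv/= ?comparison_arg// ler_pdivlMr//.
lra.
Qed.

(* In the plane, let two sides t', t'' make with a ray from their common origin
   the angles of cosines c1, c2 and sines s1, s2, of total less than pi.  The ray
   meets the third side at distance t, and m, n are the ratios in which it is
   divided there. *)
Lemma planar_hinge (t' t'' s1 c1 s2 c2 : R) : 0 < t' -> 0 < t'' ->
  0 < s1 -> 0 < s2 -> c1 ^+ 2 + s1 ^+ 2 = 1 -> c2 ^+ 2 + s2 ^+ 2 = 1 ->
  0 < s1 * c2 + c1 * s2 ->
  exists t m n : R, [/\ 0 < t, t <= Num.max t' t'',
    0 <= m /\ 0 <= n, m + n = 1 &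
    let E := t' ^+ 2 + t'' ^+ 2 - 2 * t' * t'' * (c1 * c2 - s1 * s2) in
    t' ^+ 2 + t ^+ 2 - 2 * t' * t * c1 = m ^+ 2 * E /\
    t ^+ 2 + t'' ^+ 2 - 2 * t * t'' * c2 = n ^+ 2 * E].
Proof.
move=> p' p'' ps1 ps2 e1 e2 ps.
have f1 : c1 ^+ 2 = 1 - s1 ^+ 2 by lra.
have f2 : c2 ^+ 2 = 1 - s2 ^+ 2 by lra.
have D0 : 0 < t' * s1 + t'' * s2 by rewrite addr_gt0// mulr_gt0.
set D := t' * s1 + _ in D0.
have Dn : D != 0 by rewrite lt0r_neq0.
pose t := t' * t'' * (s1 * c2 + c1 * s2) / D.
pose m := t' * s1 / D; pose n := t'' * s2 / D.
have m0 : 0 <= m by rewrite ltW// divr_gt0// mulr_gt0.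
have n0 : 0 <= n by rewrite ltW// divr_gt0// mulr_gt0.
have mn : m + n = 1 by rewrite /m /n -mulrDl mulfV.
have tE : t = n * (t' * c1) + m * (t'' * c2) by rewrite /t /m /n; field.
have t's : t' * s1 = m * (t' * s1 + t'' * s2) by rewrite /m -/D divfK.
have t''s : t'' * s2 = n * (t' * s1 + t'' * s2) by rewrite /n -/D divfK.
exists t, m, n; split => //.
- by rewrite divr_gt0// !mulr_gt0.
(* By [tE], [t] is an average of the projections t' c1 and t'' c2 of the two sides on the ray. *)
- have c11 : c1 <= 1 by nra.
  have c21 : c2 <= 1 by nra.
  have h1 : t' <= Num.max t' t'' by rewrite le_max lexx.
  have h2 : t'' <= Num.max t' t'' by rewrite le_max lexx orbT.
  rewrite tE -[leRHS]mul1r -mn addrC mulrDl.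
  by apply: lerD; apply: ler_wpM2l => //; nra.
- have n1 : n = 1 - m by lra.
  split.
    have -> : t' ^+ 2 + t ^+ 2 - 2 * t' * t * c1 =
      (t - t' * c1) ^+ 2 + (t' * s1) ^+ 2 by ring: f1.
    have -> : t - t' * c1 = m * (t'' * c2 - t' * c1) by rewrite tE n1; ring.
    by rewrite t's; ring: f1 f2.
  have m1 : m = 1 - n by lra.
  have -> : t ^+ 2 + t'' ^+ 2 - 2 * t * t'' * c2 =
    (t - t'' * c2) ^+ 2 + (t'' * s2) ^+ 2 by ring: f2.
  have -> : t - t'' * c2 = n * (t' * c1 - t'' * c2) by rewrite tE m1; ring.
  by rewrite t''s; ring: f1 f2.
Qed.

(** By contradiction: a large comparison angle between c' and c'' puts c' t' and c'' t'' farther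
    apart than the third side [f] of a planar hinge with angles x and y. Taking t on the middle
    curve where the planar ray meets that side, the other two comparison angles give distances at
    most m f and n f, which add up to f. *)
Lemma angle_triangle l l' l'' c c' c'' : 0 < l -> 0 < l' -> 0 < l'' ->
  c 0 = c' 0 -> c 0 = c'' 0 ->
  unit_speed_at0 c -> unit_speed_at0 c' -> unit_speed_at0 c'' ->
  angle l' c' l'' c'' <= angle l' c' l c + angle l c l'' c''.
Proof.
move=> l0 l'0 l''0 e' e'' [d3 d30 u] [d4 d40 u'] [d5 d50 u''].
set A := angle l' c' l'' c''; set a := angle l' c' l c; set b := angle l c l'' c''.
rewrite leNgt; apply/negP => H.
pose e := (A - a - b) / 4.
have e0 : 0 < e by rewrite divr_gt0//; lra.
have a0 : 0 <= a by apply: angle_ge0.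
have b0 : 0 <= b by apply: angle_ge0.
have Api : A <= pi by apply: angle_le_pi.
have [d1 d10 h1] := angle_ge_comparison c' c l'0 l0 e0.
have [d2 d20 h2] := angle_ge_comparison c c'' l0 l''0 e0.
pose d := Num.min d1 (Num.min d2 (Num.min d3 (Num.min d4 d5))).
have d0 : 0 < d by rewrite !lt_min d10 d20 d30 d40.
have dP t : 0 < t -> t < d ->
    [/\ 0 < t < d1, 0 < t < d2, 0 < t < d3, 0 < t < d4 & 0 < t < d5].
  by move=> t0; rewrite !lt_min => /and5P[-> -> -> -> ->]; rewrite t0.
have [t' [t'' [ht' ht'' hA]]] : exists t' t'', [/\ 0 < t' < d, 0 < t'' < d &
    A - e < comparison_angle (c' 0) (c' t') (c'' t'')].
  apply: contrapT => N.
  suff : A <= A - e by lra.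
  apply: (@angle_le _ _ _ _ l'0 l''0 _ d) => // t t' ht ht'.
  by rewrite leNgt; apply/negP => ?; apply: N; exists t, t'.
move: ht' ht'' => /andP[t'0 t'd] /andP[t''0 t''d].
have [t'1 t'2 t'3 t'4 t'5] := dP _ t'0 t'd.
have [t''1 t''2 t''3 t''4 t''5] := dP _ t''0 t''d.
(* The gap A - a - b is 4 e: x and y exceed a + e and b + e, the bounds on the comparison angles,
   while their sum A - e stays below a comparison angle that is attained. *)
pose x := a + 3 / 2 * e; pose y := b + 3 / 2 * e.
have xy : x + y = A - e by rewrite /x /y /e; lra.
have x0 : 0 < x by rewrite /x; lra.
have y0 : 0 < y by rewrite /y; lra.
have sx : 0 < sin x by apply: sin_gt0_pi; apply/andP; split; lra.
have sy : 0 < sin y by apply: sin_gt0_pi; apply/andP; split; lra.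
have sxy : 0 < sin x * cos y + cos x * sin y.
  by rewrite -sinD; apply: sin_gt0_pi; apply/andP; split; lra.
have [t [m [n [t0 tm [m0 n0] mn]]]] := planar_hinge t'0 t''0 sx sy
  (cos2Dsin2 x) (cos2Dsin2 y) sxy.
rewrite -cosD /= => -[E1 E2].
have td : t < d by rewrite (le_lt_trans tm)// gt_max t'd.
have [t1 t2 t3 t4 t5] := dP _ t0 td.
have U' : mdist (c' 0) (c' t') = t' by apply: u'.
have U'' : mdist (c' 0) (c'' t'') = t'' by rewrite -e' e''; apply: u''.
have V : mdist (c' 0) (c t) = t by rewrite -e'; apply: u.
have V'' : mdist (c 0) (c'' t'') = t'' by rewrite e''; apply: u''.
have V0 : mdist (c 0) (c t) = t by apply: u.
have g : t' ^+ 2 + t'' ^+ 2 - 2 * t' * t'' * cos (x + y) <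
    mdist (c' t') (c'' t'') ^+ 2.
  have := @comparison_angle_gt (c' 0) (c' t') (c'' t'') (x + y); rewrite U' U''; apply => //.
    by apply/andP; split; lra.
  by rewrite xy.
have g1 : mdist (c' t') (c t) ^+ 2 <= t' ^+ 2 + t ^+ 2 - 2 * t' * t * cos x.
  have := @comparison_angle_le (c' 0) (c' t') (c t) x; rewrite U' V; apply => //.
    by apply/andP; split; lra.
  by apply: (le_trans (h1 _ _ t'1 t1)); rewrite /x -/a; lra.
have g2 : mdist (c t) (c'' t'') ^+ 2 <= t ^+ 2 + t'' ^+ 2 - 2 * t * t'' * cos y.
  have := @comparison_angle_le (c 0) (c t) (c'' t'') y; rewrite V0 V''; apply => //.
    by apply/andP; split; lra.
  by apply: (le_trans (h2 _ _ t2 t''2)); rewrite /y -/b; lra.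
rewrite E1 in g1; rewrite E2 in g2.
set F := t' ^+ 2 + _ - _ in g g1 g2.
have F0 : 0 <= F.
  rewrite /F; have := cos_le1 (x + y); have := mulr_gt0 t'0 t''0.
  by have := sqr_ge0 (t' - t''); nra.
have := sqr_sqrtr F0; set f := Num.sqrt F => fE.
have f0 : 0 <= f by exact: sqrtr_ge0.
have k1 : mdist (c' t') (c t) <= m * f.
  by rewrite -(@ler_pXn2r _ 2)// ?nnegrE ?mdist_ge0 ?mulr_ge0// exprMn fE.
have k2 : mdist (c t) (c'' t'') <= n * f.
  by rewrite -(@ler_pXn2r _ 2)// ?nnegrE ?mdist_ge0 ?mulr_ge0// exprMn fE.
have k3 := metric_triangle (c' t') (c t) (c'' t'').
have : f < mdist (c' t') (c'' t'').
  by rewrite -(@ltr_pXn2r _ 2)// ?nnegrE ?mdist_ge0// fE.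
have : m * f + n * f = f by rewrite -mulrDl mn mul1r.
lra.
Qed.

End Angles.

(** * Local isometries from convex sets *)

Local Open Scope classical_set_scope.

(* Real induction from v down to u. *)
Lemma itv_local_ind {R : realType} (u v : R) (P : R -> Prop) : u <= v -> P v ->
  (forall x, u <= x <= v -> exists2 e : R, 0 < e & forall a b, u <= a -> a <= b ->
     b <= v -> `|a - x| < e -> `|b - x| < e -> P b -> P a) ->
  P u.
Proof.
move=> uv Pv H.
pose E := [set a : R | u <= a <= v /\ P a].
have Ev : E v by split => //; rewrite uv lexx.
have hE : has_inf E by split; [exists v|exists u => a [/andP[]]].
set x := inf E.
have ux : u <= x by apply: lb_le_inf; [exists v|move=> a [/andP[]]].
have xv : x <= v by apply: ge_inf => //; case: hE.
have [|e e0 He] := H x; first by rewrite ux.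
have [b [/andP[ub bv] Pb] bx] := inf_adherent e0 hE.
have xb : x <= b by apply: ge_inf; [case: hE|split => //; rewrite ub].
pose a := Num.max u (x - e / 2).
have ua : u <= a by rewrite le_max lexx.
have ax : a <= x by rewrite ge_max ux /=; lra.
have Pa : P a.
  apply: (He a b) => //; [lra| |].
  - rewrite ler0_norm ?subr_le0// opprB; have : x - e / 2 <= a by rewrite le_max lexx orbT.
    lra.
  - by rewrite ger0_norm ?subr_ge0//; move: bx; rewrite -/x; lra.
have xa : x <= a.
  by apply: ge_inf; [case: hE|split => //; rewrite ua (le_trans ax)].
suff <- : a = u by [].
by move: xa; rewrite /a /Num.max; case: ifP => // _; lra.
Qed.

Section HdistTopology.
Context {R : realType} {n : nat}.

(** In q = cosh d p + sinh d u, all coordinates of p and u are bounded by the time coordinate p0 of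
    p. Hence no coordinate moves by more than p0 ((cosh d - 1) + sinh d) = p0 (exp d - 1), and this
    fixes the radius. *)
Lemma hdist_nbhs (p : 'rV[R]_n.+1) (V : set 'rV[R]_n.+1) : hyp p -> nbhs p V ->
  exists2 e : R, 0 < e & forall q, hyp q -> hdist p q < e -> V q.
Proof.
move=> hp /nbhs_ballP[r /= r0 rV].
have p1 := hyp_ge1 hp; have p0 : 0 < p 0 ord0 by lra.
have r1 : 1 < 1 + r / p 0 ord0 by rewrite ltrDl divr_gt0.
exists (ln (1 + r / p 0 ord0)); first by rewrite ln_gt0.
move=> q hq; set d := hdist p q => dr.
have d0 : 0 <= d by apply: hdist_ge0.
have {}dr : p 0 ord0 * (expR d - 1) < r.
  have : expR d < 1 + r / p 0 ord0.
    by rewrite -[ltRHS]lnK ?posrE ?ltr_expR//; lra.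
  by rewrite -ltrBlDl ltr_pdivlMr// mulrC.
apply: rV; split => // i j; rewrite ord1 /ball/=.
apply: le_lt_trans dr.
have -> : p 0 j - q 0 j = - ((cosh d - 1) * p 0 j + sinh d * hdir p q 0 j).
  by rewrite {1}(hdir_decomp hp hq) !mxE -/d; ring.
rewrite normrN (le_trans (ler_normD _ _))// (normrM (cosh d - 1)) (normrM (sinh d)).
have c1 := cosh_ge1 d; have s0 := sinh_ge0 d0.
rewrite (ger0_norm s0) ger0_norm; last lra.
have uj := tangent_coord_le j hp (mink_hdir hp hq) (hdir_le1 hp hq).
have pj : `|p 0 j| <= p 0 ord0.
  case: (unliftP ord0 j) => [i'|] ->; last by rewrite ger0_norm; lra.
  have [ep _] := hp; rewrite -(@ler_pXn2r _ 2)// ?nnegrE ?ltW//.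
  rewrite real_normK ?num_real//.
  move: ep; rewrite /mink (bigD1 i')//=.
  have : 0 <= \sum_(i < n | i != i') p 0 (lift ord0 i) * p 0 (lift ord0 i).
    by apply: sumr_ge0 => k _; exact: sqr_ge0.
  by rewrite !expr2; lra.
have -> : expR d - 1 = (cosh d - 1) + sinh d by rewrite /cosh /sinh; lra.
by rewrite mulrDr; apply: lerD; rewrite mulrC; apply: ler_pM; rewrite ?normr_ge0//; lra.
Qed.

Definition hconvex (K : set 'rV[R]_n.+1) : Prop :=
  K `<=` hyp (n:=n) /\
  forall y z t, K y -> K z -> 0 <= t <= hdist y z -> K (hgeod y z t).

Lemma hconvex_hhull k (p : 'I_k -> 'rV[R]_n.+1) : hconvex (hhull p).
Proof.
split=> [x [] //|y z t [hy [a [a0 _ ya]]] [hz [b [b0 _ zb]]] ht].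
have [r [s [r0 s0 e h]]] := hgeod_hull hy hz ht.
split => //; exists (fun i => r * a i + s * b i); split => //.
- by move=> i; rewrite addr_ge0 ?mulr_ge0.
- rewrite e ya zb !scaler_sumr -big_split/=; apply: eq_bigr => i _.
  by rewrite !scalerA scalerDl.
Qed.

End HdistTopology.

(** * Lengths of paths in the manifold *)

Section ChartLength.
Context {R : realType} (M : gen_hyp_3manifold R).
Local Notation U := (@cdom R M).
Local Notation phi := (@cmap R M).
Implicit Types (c : R -> M).

Definition path_cont c : Prop := {within `[0, 1], continuous c}.

Lemma path_cont_nbhs c (x : R) (V : set M) : path_cont c -> 0 <= x <= 1 ->
  nbhs (c x) V -> exists2 e : R, 0 < e & forall y, 0 <= y <= 1 -> `|y - x| < e -> V (c y).
Proof.
move=> /subspace_continuousP/(_ x) h hx hV.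
have := h; rewrite /= in_itv/= => /(_ hx) /(_ V hV).
move=> /nbhs_ballP[e /= e0 H]; exists e => // y hy yx.
by apply: H => //=; rewrite /ball/= ?in_itv//= distrC.
Qed.

Lemma path_contP c :
  (forall x (V : set M), 0 <= x <= 1 -> nbhs (c x) V ->
    exists2 e : R, 0 < e & forall y, 0 <= y <= 1 -> `|y - x| < e -> V (c y)) ->
  path_cont c.
Proof.
move=> h; apply/subspace_continuousP => x; rewrite /= in_itv/= => hx V hV.
have [e e0 H] := h x V hx hV.
apply/nbhs_ballP; exists e => //= y; rewrite /ball/= in_itv/= => yx hy.
by apply: H => //; rewrite distrC.
Qed.

(** Compactness of [u, 1] in the form of real induction: near each parameter the path stays in a
    single chart. *)
Lemma subdivision_exists c (u : R) : path_cont c -> 0 <= u <= 1 ->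
  exists s, subdivision U c u s.
Proof.
move=> hc /andP[u0 u1].
apply: (itv_local_ind (P := fun u => exists s, subdivision U c u s) u1).
  by exists [::].
move=> x /andP[ux x1].
have hx : 0 <= x <= 1 by rewrite (le_trans u0)//.
have [k kx] := cdom_cover (c x).
have [|e e0 H] := @path_cont_nbhs c x (U k) hc hx.
  exact: open_nbhs_nbhs (conj (cdom_open k) kx).
exists e => // a b ua ab b1 ax bx [s hs].
exists ((k, b) :: s); split => // y /andP[ay yb].
apply: H; first by apply/andP; split; lra.
by move: ax bx; rewrite !ltr_norml => /andP[? ?] /andP[? ?]; apply/andP; split; lra.
Qed.

Lemma chart_sum_ge0 c s (a : R) : subdivision U c a s -> 0 <= chart_sum phi c a s.
Proof.
elim: s a => //= -[k t] s IH a /= [at_ hU /IH h].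
rewrite addr_ge0// hdist_ge0//; apply: cmap_hyp; apply: hU; rewrite ?lexx ?at_//.
Qed.

Lemma chart_length_ge c s : subdivision U c 0 s ->
  ((chart_sum phi c 0 s)%:E <= chart_length U phi c)%E.
Proof. by move=> h; apply: ereal_sup_ubound; exists s. Qed.

(** The part of the path up to u, reparametrized by [0, 1], competes in the infimum defining the
    distance. Any subdivision of it extends to one of the whole path, which can only increase the
    sum. *)
Lemma mdist_le_chart_length c (u : R) : path_cont c -> 0 <= u <= 1 ->
  ((mdist (c 0) (c u))%:E <= chart_length U phi c)%E.
Proof.
move=> hc /andP[u0 u1].
pose c' s := c (u * s).
have hc' : is_path (c 0) (c u) c'.
  split; [|by rewrite /c' mulr0|by rewrite /c' mulr1].
  apply: path_contP => x V /andP[x0 x1] hV.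
  have [|e e0 H] := path_cont_nbhs hc _ hV; first by apply/andP; split; nra.
  exists e => // y /andP[y0 y1] yx; apply: H; first by apply/andP; split; nra.
  rewrite -mulrBr normrM ger0_norm//; apply: le_lt_trans yx.
  by rewrite ler_piMl.
apply: (@le_trans _ _ (chart_length U phi c')).
  by rewrite mdist_length; apply: ereal_inf_lbound; exists c'.
apply: ge_ereal_sup => _ [s hs <-].
have u01 : 0 <= u <= 1 by rewrite u0.
have [s0 hs0] := subdivision_exists hc u01.
suff [s' hs' ss'] : exists2 s', subdivision U c (u * 0) s' &
    chart_sum phi c' 0 s <= chart_sum phi c (u * 0) s'.
  rewrite mulr0 in hs' ss'.
  by apply: le_trans (chart_length_ge hs'); rewrite lee_fin.
elim: s (0 : R) hs => [a /= ->|[k t] s IH a /= [at_ hU hs]].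
  by rewrite mulr1; exists s0 => //; exact: chart_sum_ge0.
have [s' hs' ss'] := IH _ hs.
exists ((k, u * t) :: s'); last by rewrite /= lerD2l.
split => //; first by rewrite ler_wpM2l.
move=> v /andP[v1 v2]; move: u0; rewrite le_eqVlt => /predU1P[u00|u0].
  have -> : v = u * a by move: v1 v2; rewrite -u00 !mul0r; lra.
  by apply: hU; rewrite lexx at_.
have -> : v = u * (v / u) by rewrite mulrC divfK// lt0r_neq0.
by apply: hU; rewrite ler_pdivlMr// ler_pdivrMr// mulrC v1 mulrC v2.
Qed.

End ChartLength.

(** * Developed convex sets: globally 1-Lipschitz, locally isometric *)

Section LocalIsometry.
Context {R : realType} (M : gen_hyp_3manifold R) {n : nat}.
Variables (K : set 'rV[R]_n.+1) (T : 'rV[R]_n.+1 -> M).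
Local Notation U := (@cdom R M).
Local Notation phi := (@cmap R M).
Hypotheses (hK : hconvex K) (hT : develops_isometrically U phi K T).

Let Khyp x : K x -> hyp x. Proof. by have [h _] := hK; exact: h. Qed.

(** Continuity of [T]: it is a map preserving [hdist] followed by the continuous inverse of a
    chart. *)
Lemma develop_nbhs x (V : set M) : K x -> nbhs (T x) V ->
  exists2 e : R, 0 < e & forall y, K y -> hdist x y < e -> V (T y).
Proof.
move=> Kx hV.
have [k [e [e0 he]]] := hT Kx.
have [Ukx _ _] : [/\ U k (T x), U k (T x) & hdist (phi k (T x)) (phi k (T x)) = hdist x x].
  by apply: he; rewrite ?hdistxx//; exact: Khyp.
have [g [h1 h2 _ cg]] := cmap_homeo k.
have img : (phi k @` U k) (phi k (T x)) by exists (T x).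
move/subspace_continuousP: cg => /(_ _ img).
have [_ gx] := h1 _ Ukx.
have {}hV : nbhs (g (phi k (T x))) V by rewrite gx.
move=> /(_ V hV) hW.
have [e' e'0 H] := hdist_nbhs (cmap_hyp Ukx) hW.
exists (Num.min e e'); first by rewrite lt_min e0.
move=> y Ky; rewrite lt_min => /andP[ye ye'].
have xe : hdist x x < e by rewrite hdistxx//; exact: Khyp.
have [_ Uky dxy] := he x y Kx Ky xe ye.
have [_ gy] := h1 _ Uky; rewrite -gy; apply: H.
- exact: cmap_hyp.
- by rewrite dxy.
- by exists (T y).
Qed.

(** [develops_isometrically] provides one chart at each point, but a subdivision may use any chart.
    The transition isometry near [T x] passes from one to the other. *)
Lemma develop_chart x k : K x -> U k (T x) -> exists2 e : R, 0 < e &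
  forall y z, K y -> K z -> hdist x y < e -> hdist x z < e ->
    hdist (phi k (T y)) (phi k (T z)) = hdist y z.
Proof.
move=> Kx Ukx; have [k' [e [e0 he]]] := hT Kx.
have xe : hdist x x < e by rewrite hdistxx//; exact: Khyp.
have [Uk'x _ _] := he x x Kx Kx xe xe.
have [g [[_ gi] hg]] := cmap_transition Uk'x Ukx.
have [e' e'0 H] := develop_nbhs Kx hg.
exists (Num.min e e'); first by rewrite lt_min e0.
move=> y z Ky Kz; rewrite !lt_min => /andP[ye ye'] /andP[ze ze'].
have [Uy Uz d] := he y z Ky Kz ye ze.
by rewrite (H y Ky ye') (H z Kz ze') gi//; exact: cmap_hyp.
Qed.

Section Segment.
Variables (y z : 'rV[R]_n.+1).
Hypotheses (Ky : K y) (Kz : K z).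
Local Notation l := (hdist y z).
Let c (s : R) := T (hgeod y z (s * l)).

Let l0 : 0 <= l. Proof. by apply: hdist_ge0; exact: Khyp. Qed.

Let sl s : 0 <= s <= 1 -> 0 <= s * l <= l.
Proof. by move=> /andP[s0 s1]; rewrite mulr_ge0//= ler_piMl. Qed.

Let Kg s : 0 <= s <= 1 -> K (hgeod y z (s * l)).
Proof. by move=> /sl h; have [_] := hK; apply. Qed.

Let dg s t : 0 <= s <= 1 -> 0 <= t <= 1 ->
  hdist (hgeod y z (s * l)) (hgeod y z (t * l)) = `|s - t| * l.
Proof.
move=> /sl hs /sl ht; rewrite hdist_hgeod//; [|exact: Khyp..].
by rewrite -mulrBl normrM (ger0_norm l0).
Qed.

Let close e : 0 < e -> exists2 e' : R, 0 < e' & forall s t, 0 <= s <= 1 ->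
  0 <= t <= 1 -> `|s - t| < e' ->
  hdist (hgeod y z (s * l)) (hgeod y z (t * l)) < e.
Proof.
move=> e0; have l1 : 0 < l + 1 by have := l0; lra.
exists (e / (l + 1)); first by rewrite divr_gt0.
move=> s t hs ht; rewrite dg// ltr_pdivlMr// => h.
by apply: le_lt_trans h; rewrite ler_wpM2l//; lra.
Qed.

Let segment_cont : path_cont c.
Proof.
apply: path_contP => x V hx hV.
have [e e0 H] := develop_nbhs (Kg hx) hV.
have [e' e'0 H'] := close e0.
exists e' => // s hs sx; apply: H; first exact: Kg.
by rewrite hdistC; apply: H'.
Qed.

(** Distances are preserved only near each point of the segment; the triangle inequality propagates
    the upper bound along it. *)
Let segment_chart k a t : 0 <= a -> a <= t -> t <= 1 ->
  (forall u, a <= u <= t -> U k (c u)) ->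
  hdist (phi k (c a)) (phi k (c t)) <= (t - a) * l.
Proof.
move=> a0 at_ t1 hU.
apply: (@itv_local_ind _ _ _
   (fun b => hdist (phi k (c b)) (phi k (c t)) <= (t - b) * l) at_).
  by rewrite subrr mul0r hdistxx//; apply: cmap_hyp; apply: hU; rewrite at_ lexx.
move=> x /andP[ax xt].
have hx : 0 <= x <= 1 by apply/andP; split; lra.
have hUx : U k (c x) by apply: hU; rewrite ax.
have [e e0 H] := develop_chart (Kg hx) hUx.
have [e' e'0 H'] := close e0.
exists e' => // b b' ab bb' b't bx b'x hb.
have Hb : 0 <= b <= 1 by apply/andP; split; lra.
have Hb' : 0 <= b' <= 1 by apply/andP; split; lra.
have := @hdist_triangle _ _ (phi k (c b')) (phi k (c b)) (phi k (c t)).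
move=> /(_ _ _ _)/le_trans; apply.
- by apply: cmap_hyp; apply: hU; apply/andP; split; lra.
- by apply: cmap_hyp; apply: hU; apply/andP; split; lra.
- by apply: cmap_hyp; apply: hU; rewrite at_ lexx.
rewrite /c H; [|exact: Kg|exact: Kg| |].
- by rewrite dg// distrC ger0_norm ?subr_ge0//; move: hb; rewrite /c; nra.
- by apply: H' => //; rewrite distrC.
- by apply: H' => //; rewrite distrC.
Qed.

(** The image of the segment from [y] to [z] is a path, and the bounds of [segment_chart] telescope
    over any subdivision of it. *)
Lemma mdist_le_hdist : mdist (T y) (T z) <= hdist y z.
Proof.
have hc : is_path (T y) (T z) c.
  split => //; rewrite /c ?mul0r ?mul1r ?hgeod0 ?hgeod_end//; exact: Khyp.
rewrite -lee_fin mdist_length; apply: (@le_trans _ _ (chart_length U phi c)).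
  by apply: ereal_inf_lbound; exists c.
apply: ge_ereal_sup => _ [s hs <-]; rewrite lee_fin.
suff H a : 0 <= a -> subdivision U c a s -> a <= 1 /\ chart_sum phi c a s <= (1 - a) * l.
  by have [] := H 0 (lexx _) hs; rewrite subr0 mul1r.
elim: s a {hs} => [a a0 /= ->|[k t] s IH a a0 /= [at_ hU hs]].
  by rewrite subrr mul0r.
have t0 : 0 <= t by lra.
have [t1 h] := IH t t0 hs.
split; first lra.
by have := segment_chart a0 at_ t1 hU; lra.
Qed.

End Segment.

(* A path from T y to T z either stays in the chart, where it is at least as long
   as the distance of its endpoints, or leaves a ball that is large compared with
   hdist y z. *)
Lemma develop_locally_isometric x : K x -> exists2 e : R, 0 < e &
  forall y z, K y -> K z -> hdist x y < e -> hdist x z < e ->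
    mdist (T y) (T z) = hdist y z.
Proof.
move=> Kx; have [k [e [e0 he]]] := hT Kx.
have xe : hdist x x < e by rewrite hdistxx//; exact: Khyp.
have [Ukx _ _] := he x x Kx Kx xe xe.
have [r /= r0 rU] : nbhs_ball (T x) (U k).
  by apply/nbhs_ballP; apply: open_nbhs_nbhs; split => //; exact: cdom_open.
rewrite ballEmdist in rU.
(* With y and z within r / 4 of x, [hdist y z] is below r / 2, while a path from [T y] leaving the
   ball of radius r covers at least 3 r / 4. *)
exists (Num.min e (r / 4)); first by rewrite lt_min e0 divr_gt0.
move=> y z Ky Kz; rewrite !lt_min => /andP[ye yr] /andP[ze zr].
have [_ Uz d] := he y z Ky Kz ye ze.
apply/eqP; rewrite eq_le mdist_le_hdist//=.
rewrite -lee_fin mdist_length; apply: le_ereal_inf_tmp => _ [c [hc c0 c1] <-].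
have [inU|] := pselect (forall u, 0 <= u <= 1 -> U k (c u)).
  have : subdivision U c 0 [:: (k, 1)] by split.
  by move=> /chart_length_ge; rewrite /= addr0 c0 c1 d.
move=> /existsNP[u /not_implyP[hu nU]].
apply: le_trans (mdist_le_chart_length hc hu); rewrite lee_fin c0.
have h1 : r <= mdist (T x) (c u) by rewrite leNgt; apply/negP => /rU.
have h2 := metric_triangle (T x) (T y) (c u).
have h3 := mdist_le_hdist Kx Ky.
have h4 := hdist_triangle (Khyp Ky) (Khyp Kx) (Khyp Kz).
have := hdist_triangle (Khyp Ky) (Khyp Kx) (Khyp Kz).
rewrite (hdistC y x); lra.
Qed.

End LocalIsometry.

Local Close Scope classical_set_scope.

(** * Angles of developed triangles *)

Definition hangle {R : realType} n (p q r : 'rV[R]_n.+1) : R :=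
  acos (mink (hdir p q) (hdir p r)).

Section DevelopedAngle.
Context {R : realType} (M : gen_hyp_3manifold R) {n : nat}.
Variables (K : set 'rV[R]_n.+1) (T : 'rV[R]_n.+1 -> M).
Hypotheses (hK : hconvex K)
  (hT : develops_isometrically (@cdom R M) (@cmap R M) K T).

Let Khyp x : K x -> hyp x. Proof. by have [h _] := hK; exact: h. Qed.

Lemma mink_hdir_itv (p q r : 'rV[R]_n.+1) : hyp p -> hyp q -> hyp r ->
  -1 <= mink (hdir p q) (hdir p r) <= 1.
Proof.
move=> hp hq hr.
have c := mink_tangent_CS hp (mink_hdir hp hq) (mink_hdir hp hr).
have u1 := hdir_le1 hp hq; have v1 := hdir_le1 hp hr.
have u0 := mink_tangent_ge0 hp (mink_hdir hp hq).
have v0 := mink_tangent_ge0 hp (mink_hdir hp hr).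
have {}c : mink (hdir p q) (hdir p r) ^+ 2 <= 1.
  by apply: (le_trans c); exact: mulr_ile1.
by apply/andP; split; nra.
Qed.

Lemma develop_unit_speed p q : K p -> K q -> p != q ->
  unit_speed_at0 (fun t => T (hgeod p q t)).
Proof.
move=> Kp Kq pq; have hp := Khyp Kp; have hq := Khyp Kq.
have d0 := hdist_gt0 hp hq pq.
have [e e0 H] := develop_locally_isometric hK hT Kp.
exists (Num.min e (hdist p q)); first by rewrite lt_min e0.
move=> t; rewrite lt_min => /and3P[t0 te td].
have ht : 0 <= t <= hdist p q by rewrite !ltW.
have h0 : 0 <= (0 : R) <= hdist p q by rewrite lexx ltW.
have dt : hdist p (hgeod p q t) = t.
  by rewrite -{1}(hgeod0 hp hq) hdist_hgeod// sub0r normrN ger0_norm// ltW.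
rewrite (hgeod0 hp hq) H ?dt ?hdistxx//.
by have [_] := hK; apply.
Qed.

(** For small t and t', unit speed makes the two sides at the vertex exact, and the third side D in
    H^n bounds the one in [M]. The law of cosines reads cosh D - cosh (t - t') = sinh t sinh t' (1 -
    C), to be compared with D^2 - (t - t')^2 = 2 t t' (1 - C) in the plane. *)
Lemma develop_angle_le p q r : K p -> K q -> K r -> p != q -> p != r ->
  angle (hdist p q) (fun t => T (hgeod p q t))
        (hdist p r) (fun t => T (hgeod p r t)) <= hangle p q r.
Proof.
move=> Kp Kq Kr pq pr; have hp := Khyp Kp; have hq := Khyp Kq; have hr := Khyp Kr.
have q0 := hdist_gt0 hp hq pq; have r0 := hdist_gt0 hp hr pr.
set al := hangle p q r; set C := mink (hdir p q) (hdir p r).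
have Citv : -1 <= C <= 1 by exact: mink_hdir_itv.
have [C1 C2] := andP Citv.
have CE : cos al = C by rewrite acosK// in_itv.
have al0 : 0 <= al by exact: acos_ge0.
apply/ler_addgt0Pr => e e0.
have [hpi|hpi] := leP pi (al + e); first exact: le_trans (angle_le_pi _ _ _ _) hpi.
have aeI : 0 <= al + e <= pi by apply/andP; split; lra.
set C' := cos (al + e).
have CC' : C' < C.
  by rewrite -CE ltr_cos ?in_itv//=; [lra|apply/andP; split; lra].
have [d1 d10 s1] := develop_unit_speed Kp Kq pq.
have [d2 d20 s2] := develop_unit_speed Kp Kr pr.
(* As 1 - C <= 2, this gives m (1 - C) <= 1 - C'. Taking t and t' below ln m / 2 makes the factor
   exp (t + t') smaller than m. *)
pose m := 1 + (C - C') / 2.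
have m1 : 1 < m by rewrite /m; lra.
have lm : 0 < ln m by rewrite ln_gt0.
pose d := Num.min (Num.min d1 d2) (Num.min (ln m / 2) (Num.min (hdist p q) (hdist p r))).
have d0 : 0 < d by rewrite !lt_min d10 d20 q0 r0; rewrite divr_gt0.
apply: (@angle_le _ _ _ _ _ _ q0 r0 _ d) => // t t'.
rewrite !lt_min => /andP[t0 /andP[/andP[td1 _] /and3P[tm tq _]]].
move=> /andP[t'0 /andP[/andP[_ t'd2] /and3P[t'm _ t'r]]].
have E1 := s1 t (introT andP (conj t0 td1)).
have E2 := s2 t' (introT andP (conj t'0 t'd2)).
have E0 : T (hgeod p q 0) = T (hgeod p r 0) by rewrite !hgeod0.
rewrite -E0 in E2.
rewrite leNgt; apply/negP => /(comparison_angle_gt aeI).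
rewrite E1 E2 => /(_ t0 t'0); apply/negP; rewrite -leNgt -/C'.
have ht : 0 <= t <= hdist p q by rewrite !ltW.
have ht' : 0 <= t' <= hdist p r by rewrite !ltW.
have [_ Kg] := hK.
have K1 := Kg _ _ _ Kp Kq ht; have K2 := Kg _ _ _ Kp Kr ht'.
have := mdist_le_hdist hK hT K1 K2.
set x := hgeod p q t; set y := hgeod p r t'; set D := hdist x y => hD.
have D0 : 0 <= D by apply: hdist_ge0; apply: Khyp.
have cD : cosh D = cosh t * cosh t' - sinh t * sinh t' * C.
  rewrite cosh_hdist; [|exact: Khyp..].
  rewrite /x /y !hgeodE// mink_comb (minkC p (hdir p r)).
  rewrite (mink_hdir hp hq) (mink_hdir hp hr).
  by have [-> _] := hp; rewrite -/C; ring.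
have D2 : mdist (T x) (T y) ^+ 2 <= D ^+ 2.
  by rewrite ler_pXn2r// ?nnegrE ?mdist_ge0.
apply: (le_trans D2).
have sC : cosh D - cosh (t - t') = sinh t * sinh t' * (1 - C).
  by rewrite cD coshB; ring.
have st := sinh_ge0 (ltW t0); have st' := sinh_ge0 (ltW t'0).
have sle : sinh t * sinh t' <= t * t' * m.
  have h1 := sinh_le_expR (ltW t0); have h2 := sinh_le_expR (ltW t'0).
  apply: (le_trans (ler_pM st st' h1 h2)).
  rewrite mulrACA -expRD ler_wpM2l ?mulr_ge0 ?ltW//.
  by rewrite -[ltRHS]lnK ?posrE; [rewrite ltr_expR; lra|lra].
have ca : cosh `|t - t'| = cosh (t - t') by case: (ger0P (t - t')) => // _; rewrite coshN.
have aD : `|t - t'| <= D.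
  rewrite leNgt; apply/negP => /(cosh_lt D0); rewrite ca; apply/negP; rewrite -leNgt.
  by rewrite -subr_ge0 sC; apply: mulr_ge0; [exact: mulr_ge0|lra].
have := sqr_sub_le_cosh (normr_ge0 (t - t')) aD.
rewrite ca sC real_normK ?num_real// => h.
have tt : 0 < t * t' by exact: mulr_gt0.
have k : sinh t * sinh t' * (1 - C) <= t * t' * (1 - C').
  apply: (@le_trans _ _ (t * t' * m * (1 - C))); first by apply: ler_wpM2r => //; lra.
  by rewrite -mulrA ler_pM2l// /m; nra.
by move: h k; rewrite !expr2; lra.
Qed.

End DevelopedAngle.

(** * Area in cylindrical coordinates *)

Local Open Scope classical_set_scope.

(** The integral is a supremum over the simple functions below the extension by 0, so a pointwise
    comparison of these extensions is enough, for arbitrary sets. *)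
Lemma ge0_le_integral_restrict d (T : measurableType d) (R : realType)
    (mu : {measure set T -> \bar R}) (A B : set T) (f g : T -> \bar R) :
  (forall x, A x -> (0 <= f x)%E) -> (forall x, B x -> (0 <= g x)%E) ->
  (forall x, A x -> f x = 0%E \/ B x /\ (f x <= g x)%E) ->
  (\int[mu]_(x in A) f x <= \int[mu]_(x in B) g x)%E.
Proof.
move=> f0 g0 fg; rewrite !ge0_integralE//.
apply: ereal_sup_le => _ [h hf <-]; exists h => // x.
apply: (le_trans (hf x)); rewrite !patchE.
have gB : (0 <= if x \in B then g x else 0)%E by case: ifPn => // /set_mem; exact: g0.
case: ifPn => // /set_mem /fg[->//|[Bx fgx]].
by rewrite mem_set.
Qed.

(** * The substitution x = c sinh t on measurable sets *)

Section SinhDensity.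
Context {R : realType}.
Variable c : R.
Hypothesis c0 : 0 < c.
Local Notation mu := (@lebesgue_measure R).

Let f (x : R) : \bar R := ((Num.sqrt (c ^+ 2 + x ^+ 2))^-1)%:E.

Let den_gt0 x : 0 < c ^+ 2 + x ^+ 2.
Proof. by have := exprn_gt0 2 c0; have := sqr_ge0 x; lra. Qed.

Let sqrt_gt0 x : 0 < Num.sqrt (c ^+ 2 + x ^+ 2).
Proof. by rewrite sqrtr_gt0. Qed.

Let f_cont : continuous (fun x : R => (Num.sqrt (c ^+ 2 + x ^+ 2))^-1).
Proof.
move=> x; apply: cvgV; first by rewrite lt0r_neq0.
apply: continuous_comp; last exact: sqrt_continuous.
by apply: cvgD; [exact: cvg_cst|exact: exprn_continuous].
Qed.

Let f_meas : measurable_fun setT f.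
Proof. by apply/measurable_EFinP; apply: continuous_measurable_fun; exact: f_cont. Qed.

Let f_ge0 x : (0 <= f x)%E.
Proof. by rewrite lee_fin invr_ge0 ltW. Qed.

Definition sinh_density (A : set (measurableTypeR R)) : \bar R := (\int[mu]_(x in A) f x)%E.

Let sinh_density0 : sinh_density set0 = 0%E.
Proof. exact: integral_set0. Qed.

Let sinh_density_ge0 A : (0 <= sinh_density A)%E.
Proof. by apply: integral_ge0. Qed.

Let sinh_density_sigma : semi_sigma_additive sinh_density.
Proof. exact: semi_sigma_additive_nng_induced. Qed.

HB.instance Definition _ := isMeasure.Build _ _ _ sinh_density
  sinh_density0 sinh_density_ge0 sinh_density_sigma.

Let psi (x : R) : R := arsinh (x / c).

Let psi_meas : measurable_fun setT psi.
Proof.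
apply: nondecreasing_measurable => // x y xy; rewrite leNgt; apply/negP => /sinh_lt.
by rewrite !arsinhK ltr_pM2r ?invr_gt0// ltNge xy.
Qed.

Let sinhM_deriv (x : R) : is_derive x (1 : R) (c \*: (sinh : R -> R)) (c * cosh x).
Proof. by have h := is_derive_sinh x; apply: is_derive_eq. Qed.

Let sinhM_cont : continuous (c \*: (sinh : R -> R)).
Proof.
move=> x; apply: differentiable_continuous; apply/derivable1_diffP.
by have [] := sinhM_deriv x.
Qed.

Let sinhM_derive1 : (c \*: (sinh : R -> R))^`() = (fun x => c * cosh x).
Proof. by apply/funext => x; rewrite derive1E; have h := sinhM_deriv x; rewrite derive_val. Qed.

Let coshM_cont : continuous (fun x => c * cosh x).
Proof. by move=> x; apply: cvgM; [exact: cvg_cst|exact: continuous_cosh]. Qed.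

Let density_itv a b : a <= b ->
  sinh_density `[c * sinh a, c * sinh b] = (b - a)%:E.
Proof.
move=> ab; rewrite /sinh_density /f.
rewrite (@integration_by_substitution_increasing _ (c \*: sinh)
  (fun x => (Num.sqrt (c ^+ 2 + x ^+ 2))^-1)) => //.
- transitivity (\int[mu]_(x in `[a, b]) (cst 1%E x))%E.
    apply: eq_integral => x _; rewrite sinhM_derive1/=; congr EFin.
    change ((Num.sqrt (c ^+ 2 + (c * sinh x) ^+ 2))^-1 * (c * cosh x) = 1).
    rewrite exprMn -{1}[c ^+ 2]mulr1 -mulrDr sqrtrM ?sqr_ge0//.
    rewrite sqrt_1sinh2 sqrtr_sqr gtr0_norm// mulVf// mulf_neq0// lt0r_neq0//.
    exact: cosh_gt0.
  rewrite integral_cst//= mul1e lebesgue_measure_itv/= lte_fin.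
  by case: ltP => // ba; congr EFin; lra.
- by move=> x y _ _ xy /=; rewrite ltr_pM2l// sinh_lt.
- by move=> x _; rewrite sinhM_derive1; exact: coshM_cont.
- rewrite sinhM_derive1; apply/cvg_ex; exists (c * cosh a).
  by apply: cvg_at_right_filter; exact: coshM_cont.
- rewrite sinhM_derive1; apply/cvg_ex; exists (c * cosh b).
  by apply: cvg_at_left_filter; exact: coshM_cont.
- split.
  + by move=> x _; have [] := sinhM_deriv x.
  + by apply: cvg_at_right_filter; exact: sinhM_cont.
  + by apply: cvg_at_left_filter; exact: sinhM_cont.
- exact: continuous_subspaceT.
Qed.

(** Integration by substitution covers intervals only. The density defines a measure whose image
    under x -> arsinh (x / c) gives every interval its length, so this image is Lebesgue measure. *)
Lemma integral_sinh_density (B : set R) : measurable B ->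
  (\int[mu]_(x in B) ((Num.sqrt (c ^+ 2 + x ^+ 2))^-1)%:E)%E =
  mu [set t | B (c * sinh t)].
Proof.
move=> mB; set B' := [set t | _].
have sK x : c * sinh (psi x) = x by rewrite arsinhK mulrC divfK// lt0r_neq0.
have psiB : psi @^-1` B' = B.
  by apply/seteqP; split => x; rewrite /B'/= sK.
have mB' : measurable B'.
  rewrite /B' -[X in measurable X]setTI; apply: (continuous_measurable_fun sinhM_cont) => //.
suff -> : mu B' = pushforward sinh_density
   (psi : measurableTypeR R -> measurableTypeR R) B' by rewrite /pushforward psiB.
apply: lebesgue_measure_unique => //=.
move=> _ [[a b] _ <-] /=; rewrite /pushforward.
have e : psi @^-1` `]a, b] = `]c * sinh a, c * sinh b].
  have H y : (a < y <= b) = (c * sinh a < c * sinh y <= c * sinh b).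
    rewrite ltr_pM2l// ler_pM2l//; congr (_ && _).
      by apply/idP/idP => [/sinh_lt//|h]; rewrite ltNge; apply/negP => /sinh_le; rewrite leNgt h.
    by apply/idP/idP => [/sinh_le//|h]; rewrite leNgt; apply/negP => /sinh_lt; rewrite ltNge h.
  by apply/seteqP; split => x; rewrite /= !in_itv/= (H (psi x)) sK.
rewrite e lebesgue_measure_itv/= lte_fin; case: ltP => [ab|ba].
  rewrite -EFinB -density_itv ?ltW// /sinh_density [RHS]integral_itv_obnd_cbnd//.
  exact: measurable_funTS.
by rewrite set_itv_ge ?measure0// -leNgt bnd_simp ler_pM2l// sinh_le.
Qed.

End SinhDensity.

Section CylindricalCoordinates.
Context {R : realType}.
Local Notation mu := (@lebesgue_measure R).

(* The geodesic {x_2 = 0} is parametrized by arc length t, and the fibres of the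
   orthogonal projection to it by y = sinh h, h being the signed distance to it:
   the area form is dt dy. *)
Definition cyl (t y : R) : 'rV[R]_3 :=
  hyperboloid_pt (Num.sqrt (1 + y ^+ 2) * sinh t, y).

Definition cyl_map (z : R * R) : R * R := (Num.sqrt (1 + z.2 ^+ 2) * sinh z.1, z.2).

Let sqrt_meas : measurable_fun setT (fun y : R => Num.sqrt (1 + y ^+ 2)).
Proof.
apply: continuous_measurable_fun => y.
apply: continuous_comp; last exact: sqrt_continuous.
by apply: cvgD; [exact: cvg_cst|exact: exprn_continuous].
Qed.

Let cyl_map_meas : measurable_fun setT cyl_map.
Proof.
apply: measurable_fun_pair => //; apply: measurable_funM.
  exact: (measurableT_comp sqrt_meas).
apply: measurableT_comp => //.
by apply: continuous_measurable_fun; exact: continuous_sinh.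
Qed.

Lemma hyp_area_weight_measurable : measurable_fun setT
  (fun z : R * R => (Num.sqrt (1 + z.1 ^+ 2 + z.2 ^+ 2))^-1).
Proof.
(* The absolute value keeps the root positive for every [u], so that [h] is continuous on the whole
   line. *)
pose h (u : R) := (Num.sqrt (1 + `|u|))^-1.
have -> : (fun z : R * R => (Num.sqrt (1 + z.1 ^+ 2 + z.2 ^+ 2))^-1) =
    (fun z => h (z.1 ^+ 2 + z.2 ^+ 2)).
  by apply/funext => z; rewrite /h ger0_norm ?addr_ge0 ?sqr_ge0// addrA.
apply: (measurableT_comp (f := h)); last first.
  by apply: measurable_funD; exact: measurable_funX.
apply: continuous_measurable_fun => u; apply: cvgV.
  by rewrite lt0r_neq0// sqrtr_gt0; have := normr_ge0 u; lra.
apply: (@continuous_comp _ _ _ (fun u : R => 1 + `|u|) Num.sqrt); last exact: sqrt_continuous.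
by apply: cvgD; [exact: cvg_cst|exact: norm_continuous].
Qed.

Let cyl_meas (A : set 'rV[R]_3) :
  measurable [set z : R * R | A (hyperboloid_pt z)] ->
  measurable [set z : R * R | A (cyl z.1 z.2)].
Proof. by move=> mA; rewrite -[X in measurable X]setTI; exact: (cyl_map_meas measurableT mA). Qed.

Let xsection_cyl (A : set 'rV[R]_3) t :
  xsection [set z : R * R | A (cyl z.1 z.2)] t = [set y | A (cyl t y)].
Proof. by apply/seteqP; split => y; rewrite /xsection/= inE. Qed.

(** At fixed y the weight is the density with c^2 = 1 + y^2, which the substitution x = c sinh t
    turns into dt. Fubini is used once to integrate over x first, and once more to exchange t and
    y. *)
Lemma hyp_area_cyl (A : set 'rV[R]_3) :
  measurable [set z : R * R | A (hyperboloid_pt z)] ->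
  hyp_area A = (\int[mu]_t mu [set y | A (cyl t y)])%E.
Proof.
set A' := [set z | _] => mA'.
have den0 (z : R * R) : 0 < Num.sqrt (1 + z.1 ^+ 2 + z.2 ^+ 2).
  by rewrite sqrtr_gt0; have := sqr_ge0 z.1; have := sqr_ge0 z.2; lra.
pose f (z : R * R) : \bar R := ((Num.sqrt (1 + z.1 ^+ 2 + z.2 ^+ 2))^-1)%:E.
have f0 z : (0 <= f z)%E by rewrite lee_fin invr_ge0 ltW.
have mf : measurable_fun setT f.
  by apply/measurable_EFinP; exact: hyp_area_weight_measurable.
pose A'' := [set z : R * R | A (cyl z.1 z.2)].
have mA'' : measurable A'' by exact: cyl_meas.
rewrite /hyp_area -/A' integral_mkcond fubini_tonelli2; last 2 first.
- apply/(measurable_restrictT _ mA'); exact: measurable_funTS.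
- by move=> z; rewrite patchE; case: ifP.
transitivity (\int[mu]_y (mu (ysection A'' y)))%E.
  apply: eq_integral => y _; rewrite /fubini_G.
  have c0 : 0 < Num.sqrt (1 + y ^+ 2) by rewrite sqrtr_gt0; have := sqr_ge0 y; lra.
  have mB : measurable (ysection A' y) by exact: measurable_ysection.
  transitivity (\int[mu]_(x in ysection A' y)
      ((Num.sqrt (Num.sqrt (1 + y ^+ 2) ^+ 2 + x ^+ 2))^-1)%:E)%E.
    rewrite [RHS]integral_mkcond; apply: eq_integral => x _; rewrite !patchE mem_ysection.
    rewrite sqr_sqrtr; last by have := sqr_ge0 y; lra.
    by rewrite addrAC.
  rewrite (integral_sinh_density c0 mB); congr (mu _).
have := indic_fubini_tonelli mu mu mA''.
under eq_integral do rewrite indic_fubini_tonelli_FE//.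
under [in X in _ = X]eq_integral do rewrite indic_fubini_tonelli_GE//.
move=> <-; apply: eq_integral => t _ /=; by rewrite xsection_cyl.
Qed.

(** The fibres over the two ends a and b are left unconstrained: they have measure zero and may
    contain vertical edges. For a = b the area is 0. *)
Lemma hyp_area_strip (A : set 'rV[R]_3) (a b : R) (f g F G : R -> R) :
  measurable [set z : R * R | A (hyperboloid_pt z)] -> a <= b ->
  (forall t y, A (cyl t y) -> [/\ a <= t <= b & (a < t < b -> f t <= y <= g t)]) ->
  (forall t, a < t < b -> f t <= g t) ->
  (forall t, a <= t <= b -> {for t, continuous f}) ->
  (forall t, a <= t <= b -> {for t, continuous g}) ->
  (forall t, a <= t <= b -> is_derive t (1 : R) F (f t)) ->
  (forall t, a <= t <= b -> is_derive t (1 : R) G (g t)) ->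
  (hyp_area A <= (G b - G a - (F b - F a))%:E)%E.
Proof.
move=> mA ab hA fg cf cg dF dG; rewrite hyp_area_cyl//.
have fgc t : a <= t <= b -> {for t, continuous (g \- f)}.
  by move=> ht; apply: cvgB; [exact: cg|exact: cf].
have GFd t : a <= t <= b -> is_derive t (1 : R) (G \- F) (g t - f t).
  by move=> ht; have h1 := dF t ht; have h2 := dG t ht; apply: is_deriveB.
have GFc t : a <= t <= b -> {for t, continuous (G \- F)}.
  move=> /GFd h; apply: differentiable_continuous; apply/derivable1_diffP.
  by have [] := h.
have -> : (G b - G a - (F b - F a))%:E = (\int[mu]_(t in `]a, b[) (g t - f t)%:E)%E.
  move: ab; rewrite le_eqVlt => /predU1P[e|ab].
    by rewrite e !subrr set_itv_ge ?bnd_simp ?ltxx// integral_set0.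
  rewrite -(@integral_itv_bndoo _ _ _ _ true false); last first.
    apply/measurable_EFinP.
    apply: subspace_continuous_measurable_fun => //.
    apply: continuous_in_subspaceT => t; rewrite inE/= in_itv/= => /andP[h1 h2].
    by apply: fgc; rewrite !ltW.
  rewrite (@continuous_FTC2 _ (g \- f) (G \- F))//.
  - by rewrite -EFinB /=; congr EFin; ring.
  - apply: continuous_in_subspaceT => t; rewrite inE/= in_itv/= => h.
    exact: fgc.
  - split.
    + move=> t; rewrite in_itv/= => /andP[h1 h2].
      by have [] := GFd t; rewrite ?ltW.
    + by apply: cvg_at_right_filter; apply: GFc; rewrite lexx ltW.
    + by apply: cvg_at_left_filter; apply: GFc; rewrite lexx ltW.
  - move=> t; rewrite in_itv/= => /andP[h1 h2].
    have h : is_derive t (1 : R) (G \- F) (g t - f t) by apply: GFd; rewrite !ltW.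
    by rewrite derive1E derive_val.
pose m t : \bar R := mu [set y | A (cyl t y)].
have mm : measurable_fun setT m.
  have := @measurable_fun_xsection _ _ _ _ _ mu _ (cyl_meas mA).
  by congr measurable_fun; apply/funext => t /=; rewrite xsection_cyl.
have mtop t y : A (cyl t y) -> a <= t <= b by move=> /hA[].
apply: (@le_trans _ _ (\int[mu]_(t in `[a, b]) m t)%E).
  apply: ge0_le_integral_restrict => // t _.
  have [h|h] := boolP (a <= t <= b).
    by right; split => //=; rewrite in_itv.
  left; rewrite (_ : [set y | _] = set0) ?measure0//.
  by apply/seteqP; split => y //= /mtop; move: h => /negP.
rewrite integral_itv_bndoo; last exact: measurable_funTS.
apply: ge0_le_integral_restrict => // t; rewrite /= in_itv/= => ht.
  by rewrite lee_fin subr_ge0 fg.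
right; split => //.
apply: (@le_trans _ _ (mu `[f t, g t])).
  apply: le_measure; rewrite ?inE//=.
    by rewrite -xsection_cyl; exact: measurable_xsection (cyl_meas mA).
  by move=> y /= /hA[_ /(_ ht)]; rewrite in_itv.
rewrite lebesgue_measure_itv/= lte_fin; case: ltP => // _.
by rewrite lee_fin subr_ge0 fg.
Qed.

End CylindricalCoordinates.

Local Close Scope classical_set_scope.

(** * Strips along a geodesic *)

Section Frame.
Context {R : realType}.
Implicit Types (t h : R) (x y z : 'rV[R]_3).

Definition pt t h : 'rV[R]_3 :=
  \row_i [:: cosh h * cosh t; cosh h * sinh t; sinh h]`_i.

(* With pt t h, [frame_h t] and [frame_v t h] form an orthonormal basis of
   Minkowski space. *)
Definition frame_h t : 'rV[R]_3 := \row_i [:: sinh t; cosh t; 0]`_i.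

Definition frame_v t h : 'rV[R]_3 :=
  \row_i [:: sinh h * cosh t; sinh h * sinh t; cosh h]`_i.

(** On the hyperboloid, the sign tells on which side of the geodesic through [x] and [y] the point
    [z] lies. *)
Definition det3 x y z : R :=
  x 0 0 * (y 0 1 * z 0 2 - y 0 2 * z 0 1)
  - x 0 1 * (y 0 0 * z 0 2 - y 0 2 * z 0 0)
  + x 0 2 * (y 0 0 * z 0 1 - y 0 1 * z 0 0).

Lemma mink3E x y : mink x y = - (x 0 0 * y 0 0) + x 0 1 * y 0 1 + x 0 2 * y 0 2.
Proof.
rewrite /mink !big_ord_recl big_ord0 addr0 addrA.
have -> : lift ord0 (ord0 : 'I_2) = 1 :> 'I_3 by apply/val_inj.
by have -> : lift ord0 (lift ord0 (ord0 : 'I_1)) = 2 :> 'I_3 by apply/val_inj.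
Qed.

Lemma frame_expansion t h x y :
  mink x y = - (mink x (pt t h) * mink y (pt t h))
    + mink x (frame_h t) * mink y (frame_h t)
    + mink x (frame_v t h) * mink y (frame_v t h).
Proof.
rewrite !mink3E !mxE /=.
have h1 := cosh2 t; have h2 := cosh2 h.
ring: h1 h2.
Qed.

Lemma det3_frame t h y z : det3 (pt t h) y z =
  mink y (frame_h t) * mink z (frame_v t h)
  - mink y (frame_v t h) * mink z (frame_h t).
Proof.
rewrite /det3 !mink3E !mxE /=.
have h1 := cosh2 t; have h2 := cosh2 h.
ring: h1 h2.
Qed.

Lemma mink_pt_frame_h t h : mink (pt t h) (frame_h t) = 0.
Proof. by rewrite mink3E !mxE/=; ring. Qed.

Lemma mink_pt_frame_v t h : mink (pt t h) (frame_v t h) = 0.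
Proof. by rewrite mink3E !mxE/=; have h1 := cosh2 t; ring: h1. Qed.

Lemma hyp_pt t h : hyp (pt t h).
Proof.
split; last by rewrite mxE/= mulr_gt0// cosh_gt0.
by rewrite mink3E !mxE/=; have h1 := cosh2 t; have h2 := cosh2 h; ring: h1 h2.
Qed.

Lemma hyp_ptP x : hyp x -> exists t h, x = pt t h.
Proof.
move=> [mx x0]; exists (arsinh (x 0 1 / cosh (arsinh (x 0 2)))), (arsinh (x 0 2)).
have c0 := cosh_gt0 (arsinh (x 0 2)).
have e2 := arsinhK (x 0 2).
set h := arsinh (x 0 2) in c0 e2 *.
set t := arsinh _; have e1 : cosh h * sinh t = x 0 1.
  by rewrite arsinhK mulrC divfK// lt0r_neq0.
have e0 : cosh h * cosh t = x 0 0.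
  have p : 0 < cosh h * cosh t by rewrite mulr_gt0// cosh_gt0.
  apply/eqP; rewrite -(@eqrXn2 _ 2)// ?ltW//; apply/eqP.
  move: mx; rewrite mink3E -e1 -e2 => mx.
  have h1 := cosh2 t; have h2 := cosh2 h.
  have -> : x 0 0 ^+ 2 = 1 + (cosh h * sinh t) ^+ 2 + sinh h ^+ 2 by rewrite !expr2; lra.
  by ring: h1 h2.
apply/rowP => i; rewrite mxE; case: i => -[|[|[|//]]] p /=.
- by rewrite e0; congr (x 0 _); apply/val_inj.
- by rewrite e1; congr (x 0 _); apply/val_inj.
- by rewrite e2; congr (x 0 _); apply/val_inj.
Qed.

Lemma cyl_pt t (y : R) : cyl t y = pt t (arsinh y).
Proof.
have c : Num.sqrt (1 + y ^+ 2) = cosh (arsinh y) by rewrite -sqrt_1sinh2 arsinhK.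
apply/rowP => i; rewrite !mxE; case: i => -[|[|[|//]]] p //=.
- rewrite c -(sqrt_1sinh2 t) -[in RHS](gtr0_norm (cosh_gt0 (arsinh y))).
  rewrite -sqrtr_sqr -sqrtrM ?sqr_ge0// cosh2 arsinhK; congr Num.sqrt.
  by rewrite [(cosh _ * _) ^+ 2]exprMn cosh2 arsinhK; ring.
- by rewrite c.
- by rewrite arsinhK.
Qed.

Section Edge.
Variables tP hP tQ hQ : R.
Local Notation P := (pt tP hP).
Local Notation Q := (pt tQ hQ).

Lemma mink_frame_h : mink Q (frame_h tP) = cosh hQ * sinh (tQ - tP).
Proof. by rewrite mink3E !mxE/= sinhB; ring. Qed.

Lemma mink_frame_v :
  mink Q (frame_v tP hP) = cosh hP * sinh hQ - sinh hP * cosh hQ * cosh (tQ - tP).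
Proof. by rewrite mink3E !mxE/= coshB; ring. Qed.

Lemma hdir_frame_h :
  mink (hdir P Q) (frame_h tP) = (sinh (hdist P Q))^-1 * (cosh hQ * sinh (tQ - tP)).
Proof.
by rewrite hdir.unlock minkZl minkDl minkNl minkZl mink_pt_frame_h mulr0 subr0 mink_frame_h.
Qed.

Lemma hdir_frame_v : mink (hdir P Q) (frame_v tP hP) = (sinh (hdist P Q))^-1 *
  (cosh hP * sinh hQ - sinh hP * cosh hQ * cosh (tQ - tP)).
Proof.
by rewrite hdir.unlock minkZl minkDl minkNl minkZl mink_pt_frame_v mulr0 subr0 mink_frame_v.
Qed.

Lemma hdir_mink (r : 'rV[R]_3) : hyp r -> mink (hdir P Q) (hdir P r) =
  mink (hdir P Q) (frame_h tP) * mink (hdir P r) (frame_h tP) +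
  mink (hdir P Q) (frame_v tP hP) * mink (hdir P r) (frame_v tP hP).
Proof.
move=> hr; rewrite (frame_expansion tP hP) (mink_hdir (hyp_pt tP hP) (hyp_pt tQ hQ)).
by rewrite mul0r oppr0 add0r.
Qed.

End Edge.

(* the sine of the angle at pt t h between the geodesic to x and the curve of
   constant h *)
Definition slope t h x : R := mink (hdir (pt t h) x) (frame_v t h).

Lemma slope_itv t h x : hyp x -> -1 <= slope t h x <= 1.
Proof.
move=> hx; have [t' [h' e]] := hyp_ptP hx.
have := hdir_le1 (hyp_pt t h) hx; rewrite {1 2}e hdir_mink; last by rewrite -e.
rewrite -e -/(slope t h x); set a := mink _ _ => u.
have a0 := sqr_ge0 a; by apply/andP; split; nra.
Qed.

Lemma cos_slope t h t' h' : pt t h != pt t' h' ->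
  cos (asin (slope t h (pt t' h'))) = `|mink (hdir (pt t h) (pt t' h')) (frame_h t)|.
Proof.
move=> pq; rewrite cos_asin; last exact/slope_itv/hyp_pt.
rewrite -sqrtr_sqr; congr Num.sqrt.
have := hdir_unit (hyp_pt t h) (hyp_pt t' h') pq.
rewrite hdir_mink; last exact: hyp_pt.
by rewrite -/(slope t h (pt t' h')); lra.
Qed.

End Frame.

Definition tanh {R : realType} (h : R) : R := sinh h / cosh h.

Lemma ler_sinh {R : realType} : {mono (@sinh R) : x y / x <= y}.
Proof. exact/le_mono/sinh_lt. Qed.

Lemma ler_tanh {R : realType} : {mono (@tanh R) : x y / x <= y}.
Proof.
move=> x y; rewrite /tanh ler_pdivrMr ?cosh_gt0// mulrAC ler_pdivlMr ?cosh_gt0//.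
by rewrite -subr_le0 (mulrC (sinh y)) -sinhB -sinh0 ler_sinh subr_le0.
Qed.

Lemma asinN {R : realType} (x : R) : -1 <= x <= 1 -> asin (- x) = - asin x.
Proof.
move=> hx; rewrite -{1}(@asinK _ x) ?in_itv// -sinN sinK//.
by rewrite in_itv/= lerN2 lerNl asin_lepi2 ?asin_geNpi2.
Qed.

(** * Geodesic edges as graphs over the base geodesic *)

Section EdgeFunction.
Context {R : realType}.
Variables tP hP tQ hQ : R.
Hypothesis PQ : tP < tQ.
Local Notation P := (pt tP hP).
Local Notation Q := (pt tQ hQ).
Implicit Types (t h : R).

Lemma tanh_itv h : -1 < tanh h < 1.
Proof.
have c := cosh_gt0 h; have e := cosh2 h.
by rewrite /tanh ltr_pdivlMr// ltr_pdivrMr//; apply/andP; split; nra.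
Qed.

Let S := sinh (tQ - tP).
Let S0 : 0 < S. Proof. by rewrite sinh_gt0// subr_gt0. Qed.

(* In the coordinates (t, h), the geodesic PQ is the curve tanh h = edge_w t, and
   edge_w1 is the derivative of edge_w.  The number edge_kappa2 is the first
   integral that makes edge_angle, the angle of the geodesic with the curves of
   constant h, a primitive of edge_y = sinh h. *)
Definition edge_w t : R := (tanh hQ * sinh (t - tP) + tanh hP * sinh (tQ - t)) / S.
Definition edge_w1 t : R := (tanh hQ * cosh (t - tP) - tanh hP * cosh (tQ - t)) / S.
Definition edge_kappa2 : R :=
  1 + (tanh hQ ^+ 2 + tanh hP ^+ 2 - 2 * tanh hQ * tanh hP * cosh (tQ - tP)) / S ^+ 2.

(** [edge_w] solves w'' = w, so w'^2 - w^2 is constant. *)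
Lemma edge_kappa2E t : edge_kappa2 = 1 - edge_w t ^+ 2 + edge_w1 t ^+ 2.
Proof.
rewrite /edge_kappa2 /edge_w /edge_w1.
have -> : tQ - tP = (t - tP) + (tQ - t) by ring.
rewrite coshD; have h1 := cosh2 (t - tP); have h2 := cosh2 (tQ - t).
by field: h1 h2; rewrite lt0r_neq0.
Qed.

(** [edge_w t] combines two values of [tanh] with nonnegative coefficients, whose sum is at most 1
    because sinh a + sinh b <= sinh (a + b) for a, b >= 0. *)
Lemma edge_w_itv t : tP <= t <= tQ -> -1 < edge_w t < 1.
Proof.
move=> /andP[h1 h2].
have a0 : 0 <= sinh (t - tP) by rewrite sinh_ge0// subr_ge0.
have b0 : 0 <= sinh (tQ - t) by rewrite sinh_ge0// subr_ge0.
have ab : sinh (t - tP) + sinh (tQ - t) <= S.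
  rewrite /S; have -> : tQ - tP = (t - tP) + (tQ - t) by ring.
  by rewrite [leRHS]sinhD; apply: lerD; [rewrite ler_peMr|rewrite ler_peMl]; rewrite ?cosh_ge1.
have ab0 : 0 < sinh (t - tP) + sinh (tQ - t).
  move: h1; rewrite le_eqVlt => /predU1P[<-|h1].
    by rewrite subrr sinh0 add0r; exact: S0.
  by rewrite ltr_wpDr// sinh_gt0// subr_gt0.
have /andP[q1 q2] := tanh_itv hQ; have /andP[p1 p2] := tanh_itv hP.
rewrite /edge_w ltr_pdivlMr// ltr_pdivrMr//.
move: a0; rewrite le_eqVlt => /predU1P[a0|a0].
  by rewrite -a0 in ab ab0 *; apply/andP; split; nra.
have : (1 - tanh hP) * sinh (tQ - t) >= 0 by rewrite mulr_ge0//; lra.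
have : (1 + tanh hP) * sinh (tQ - t) >= 0 by rewrite mulr_ge0//; lra.
have : (1 - tanh hQ) * sinh (t - tP) > 0 by rewrite mulr_gt0//; lra.
have : (1 + tanh hQ) * sinh (t - tP) > 0 by rewrite mulr_gt0//; lra.
by move=> *; apply/andP; split; lra.
Qed.

Let kappa_gt t : tP <= t <= tQ -> edge_w1 t ^+ 2 < edge_kappa2.
Proof. by move=> /edge_w_itv/andP[? ?]; rewrite (edge_kappa2E t); nra. Qed.

Let tPI : tP <= tP <= tQ. Proof. by rewrite lexx ltW. Qed.

Lemma edge_kappa2_gt0 : 0 < edge_kappa2.
Proof. by apply: le_lt_trans (kappa_gt tPI); exact: sqr_ge0. Qed.

Let k := Num.sqrt edge_kappa2.
Let k0 : 0 < k. Proof. by rewrite sqrtr_gt0 edge_kappa2_gt0. Qed.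
Let k2 : k ^+ 2 = edge_kappa2. Proof. by rewrite sqr_sqrtr// ltW// edge_kappa2_gt0. Qed.

Definition edge_y t : R := edge_w t / Num.sqrt (1 - edge_w t ^+ 2).
Definition edge_angle t : R := asin (edge_w1 t / k).

Let is_derive_sinhB (a t : R) : is_derive t (1 : R) (fun t => sinh (t - a)) (cosh (t - a)).
Proof.
have h := is_derive_sinh (t - a).
rewrite -[cosh _]mulr1; apply: (@is_derive1_comp _ sinh (fun t => t - a)).
by apply: is_derive_eq; rewrite subr0.
Qed.

Let is_derive_coshB (a t : R) : is_derive t (1 : R) (fun t => cosh (t - a)) (sinh (t - a)).
Proof.
have h := is_derive_cosh (t - a).
rewrite -[sinh _]mulr1; apply: (@is_derive1_comp _ cosh (fun t => t - a)).
by apply: is_derive_eq; rewrite subr0.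
Qed.

Let is_derive_w t : is_derive t (1 : R) edge_w (edge_w1 t).
Proof.
have h1 := is_derive_sinhB tP t; have h2 := is_derive_sinhB tQ t.
rewrite (_ : edge_w = (S^-1 * tanh hQ) \*: (fun t => sinh (t - tP)) -
    (S^-1 * tanh hP) \*: (fun t => sinh (t - tQ))); last first.
  apply/funext => u; rewrite /edge_w -(opprB u tQ) sinhN.
  change ((tanh hQ * sinh (u - tP) + tanh hP * - sinh (u - tQ)) / S =
   S^-1 * tanh hQ * sinh (u - tP) - S^-1 * tanh hP * sinh (u - tQ)).
  by ring.
apply: is_derive_eq; rewrite /edge_w1 -(opprB t tQ) coshN.
change (S^-1 * tanh hQ * cosh (t - tP) - S^-1 * tanh hP * cosh (t - tQ) =
  (tanh hQ * cosh (t - tP) - tanh hP * cosh (t - tQ)) / S).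
by ring.
Qed.

Let is_derive_w1 t : is_derive t (1 : R) edge_w1 (edge_w t).
Proof.
have h1 := is_derive_coshB tP t; have h2 := is_derive_coshB tQ t.
rewrite (_ : edge_w1 = (S^-1 * tanh hQ) \*: (fun t => cosh (t - tP)) -
    (S^-1 * tanh hP) \*: (fun t => cosh (t - tQ))); last first.
  apply/funext => u; rewrite /edge_w1 -(opprB u tQ) coshN.
  change ((tanh hQ * cosh (u - tP) - tanh hP * cosh (u - tQ)) / S =
   S^-1 * tanh hQ * cosh (u - tP) - S^-1 * tanh hP * cosh (u - tQ)).
  by ring.
apply: is_derive_eq; rewrite /edge_w -(opprB t tQ) sinhN.
change (S^-1 * tanh hQ * sinh (t - tP) - S^-1 * tanh hP * sinh (t - tQ) =
  (tanh hQ * sinh (t - tP) + tanh hP * - sinh (t - tQ)) / S).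
by ring.
Qed.

(** The first integral gives 1 - (w'/k)^2 = (1 - w^2) / k^2, so the constant k cancels in the
    derivative of asin (w'/k). *)
Lemma is_derive_edge_angle t : tP <= t <= tQ ->
  is_derive t (1 : R) edge_angle (edge_y t).
Proof.
move=> ht; have /andP[w1 w2] := edge_w_itv ht.
have w0 : 0 < 1 - edge_w t ^+ 2 by nra.
have kE : 1 - (edge_w1 t / k) ^+ 2 = (1 - edge_w t ^+ 2) / k ^+ 2.
  by have e := edge_kappa2E t; rewrite -k2 in e; field: e; rewrite lt0r_neq0.
have I : -1 < edge_w1 t / k < 1.
  have : 0 < 1 - (edge_w1 t / k) ^+ 2 by rewrite kE divr_gt0// exprn_gt0.
  by move=> ?; apply/andP; split; nra.
have h := is_derive1_asin I.
have h1 := is_derive_w1 t.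
have h2 : is_derive t (1 : R) (fun t => edge_w1 t / k) (edge_w t / k).
  rewrite (_ : (fun t => edge_w1 t / k) = k^-1 \*: edge_w1); last first.
    by apply/funext => u; rewrite mulrC.
  by apply: is_derive_eq; rewrite mulrC.
rewrite (_ : edge_y t = (Num.sqrt (1 - (edge_w1 t / k) ^+ 2))^-1 * (edge_w t / k)).
  exact: (@is_derive1_comp _ asin (fun t => edge_w1 t / k)).
rewrite kE sqrtrM ?ltW// sqrtrV ?ltW ?exprn_gt0// sqrtr_sqr gtr0_norm// /edge_y.
by field; rewrite !lt0r_neq0// sqrtr_gt0.
Qed.

Lemma continuous_edge_y t : tP <= t <= tQ -> {for t, continuous edge_y}.
Proof.
move=> ht; have /andP[w1 w2] := edge_w_itv ht.
have wc : {for t, continuous edge_w}.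
  by apply: differentiable_continuous; apply/derivable1_diffP; have [] := is_derive_w t.
have w0 : 0 < 1 - edge_w t ^+ 2 by nra.
apply: cvgM; first exact: wc.
apply: cvgV; first by rewrite lt0r_neq0// sqrtr_gt0.
apply: (@continuous_comp _ _ _ (fun t => 1 - edge_w t ^+ 2) Num.sqrt); last exact: sqrt_continuous.
apply: cvgB; first exact: cvg_cst.
by apply: (@continuous_comp _ _ _ edge_w (fun x : R => x ^+ 2)); [exact: wc|exact: exprn_continuous].
Qed.

(** All factors but the last are positive: being above or below the edge becomes a linear condition
    on the point. *)
Lemma det3_edge t h : det3 P Q (pt t h) =
  cosh hP * cosh hQ * cosh h * S * (tanh h - edge_w t).
Proof.
have -> : cosh hP * cosh hQ * cosh h * S * (tanh h - edge_w t) =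
    cosh hP * cosh hQ * cosh h *
    (tanh h * S - (tanh hQ * sinh (t - tP) + tanh hP * sinh (tQ - t))).
  by rewrite /edge_w; field; rewrite lt0r_neq0.
rewrite /det3 !mxE /= /tanh /S !sinhB.
have c1 := lt0r_neq0 (cosh_gt0 hP); have c2 := lt0r_neq0 (cosh_gt0 hQ).
have c3 := lt0r_neq0 (cosh_gt0 h).
by field; rewrite c1 c2 c3.
Qed.

Let edge_h t : tP <= t <= tQ -> exists2 g, edge_y t = sinh g & edge_w t = tanh g.
Proof.
move=> ht; have /andP[w1 w2] := edge_w_itv ht.
have w0 : 0 < 1 - edge_w t ^+ 2 by nra.
exists (arsinh (edge_y t)); first by rewrite arsinhK.
rewrite /tanh -sqrt_1sinh2 arsinhK /edge_y.
have s0 : 0 < Num.sqrt (1 - edge_w t ^+ 2) by rewrite sqrtr_gt0.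
have s2 := sqr_sqrtr (ltW w0); move: (Num.sqrt (1 - _)) s0 s2 => s s0 s2.
have -> : 1 + (edge_w t / s) ^+ 2 = (s^-1) ^+ 2.
  by rewrite expr_div_n exprVn s2; field; rewrite lt0r_neq0.
by rewrite sqrtr_sqr gtr0_norm ?invr_gt0//; field; rewrite lt0r_neq0.
Qed.

Lemma le_edge_y t h : tP <= t <= tQ -> (edge_y t <= sinh h) = (edge_w t <= tanh h).
Proof. by move=> /edge_h[g -> ->]; rewrite ler_sinh ler_tanh. Qed.

Lemma ge_edge_y t h : tP <= t <= tQ -> (sinh h <= edge_y t) = (tanh h <= edge_w t).
Proof. by move=> /edge_h[g -> ->]; rewrite ler_sinh ler_tanh. Qed.

(** For a unit direction along the edge with horizontal component a, the vertical component is a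
    cosh h w'. That the squares add up to 1 forces a cosh h = 1 / k. *)
Let edge_ratio t h a : 0 < a -> edge_w t = tanh h ->
  a * a + a * cosh h * edge_w1 t * (a * cosh h * edge_w1 t) = 1 ->
  edge_w1 t / k = a * cosh h * edge_w1 t.
Proof.
move=> a0 w0 u; have e := edge_kappa2E t; have c0 := cosh_gt0 h.
have kE : a * cosh h * k = 1.
  have p : 0 < a * cosh h * k by rewrite mulr_gt0// mulr_gt0.
  apply/eqP; rewrite -(@eqrXn2 _ 2)// ?ltW//; apply/eqP.
  rewrite expr1n -[RHS]u [LHS]exprMn k2 e w0 /tanh.
  by have h2 := cosh2 h; field: h2; rewrite lt0r_neq0.
have -> : a * cosh h = k^-1.
  by apply: (mulIf (lt0r_neq0 k0)); rewrite kE mulVf// lt0r_neq0.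
by rewrite mulrC.
Qed.

Let PneQ : P != Q.
Proof.
apply/eqP => /rowP e; have := e 1; have := e 2; rewrite !mxE/= => /sinh_inj <-.
have c0 := cosh_gt0 hP.
by move=> /(mulfI (lt0r_neq0 c0))/sinh_inj eq; move: PQ; rewrite eq ltxx.
Qed.

Let sinhd_gt0 : 0 < sinh (hdist P Q).
Proof. by rewrite sinh_gt0// hdist_gt0//; exact: hyp_pt. Qed.

Lemma edge_angle_start : edge_angle tP = asin (slope tP hP Q).
Proof.
have u := hdir_unit (hyp_pt tP hP) (hyp_pt tQ hQ) PneQ.
rewrite hdir_mink in u; last exact: hyp_pt.
rewrite hdir_frame_h hdir_frame_v in u.
have c1 := lt0r_neq0 (cosh_gt0 hP); have c2 := lt0r_neq0 (cosh_gt0 hQ).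
rewrite /edge_angle /slope hdir_frame_v; congr asin.
set a := (sinh (hdist P Q))^-1 * (cosh hQ * S) in u *.
have a0 : 0 < a by rewrite /a mulr_gt0 ?invr_gt0// mulr_gt0// cosh_gt0.
have bE : (sinh (hdist P Q))^-1 *
    (cosh hP * sinh hQ - sinh hP * cosh hQ * cosh (tQ - tP)) =
    a * cosh hP * edge_w1 tP.
  rewrite /a /edge_w1 subrr cosh0 /tanh.
  by field; rewrite c1 c2 !lt0r_neq0.
rewrite bE in u *; apply: edge_ratio => //.
by rewrite /edge_w subrr sinh0 mulr0 add0r mulfK// lt0r_neq0.
Qed.

(** The sign comes from the direction at [Q] towards [P], which runs backwards in t. *)
Lemma edge_angle_end : edge_angle tQ = - asin (slope tQ hQ P).
Proof.
have QneP : Q != P by rewrite eq_sym.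
have u := hdir_unit (hyp_pt tQ hQ) (hyp_pt tP hP) QneP.
rewrite hdir_mink in u; last exact: hyp_pt.
have I := slope_itv tQ hQ (hyp_pt tP hP).
rewrite hdir_frame_h hdir_frame_v in u.
have c1 := lt0r_neq0 (cosh_gt0 hP); have c2 := lt0r_neq0 (cosh_gt0 hQ).
rewrite -asinN// /edge_angle /slope hdir_frame_v; congr asin.
rewrite (hdistC Q) -(opprB tQ tP) sinhN coshN in u *.
pose a := (sinh (hdist P Q))^-1 * (cosh hP * S).
have a0 : 0 < a by rewrite /a mulr_gt0 ?invr_gt0// mulr_gt0// cosh_gt0.
have bE : (sinh (hdist P Q))^-1 *
    (cosh hQ * sinh hP - sinh hQ * cosh hP * cosh (tQ - tP)) =
    - (a * cosh hQ * edge_w1 tQ).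
  rewrite /a /edge_w1 subrr cosh0 /tanh.
  by field; rewrite c1 c2 !lt0r_neq0.
rewrite bE opprK in u *; apply: edge_ratio => //.
  by rewrite /edge_w subrr sinh0 mulr0 addr0 mulfK// lt0r_neq0.
by rewrite -[RHS]u /a /S; ring.
Qed.

End EdgeFunction.

Local Open Scope classical_set_scope.

Section AreaMeasure.
Context {R : realType}.
Implicit Types (A B : set 'rV[R]_3).

Let weight_ge0 (z : R * R) : (0 <= ((Num.sqrt (1 + z.1 ^+ 2 + z.2 ^+ 2))^-1)%:E)%E.
Proof. by rewrite lee_fin invr_ge0 sqrtr_ge0. Qed.

Lemma hyp_area_mono A B : (forall x, hyp x -> A x -> B x) -> (hyp_area A <= hyp_area B)%E.
Proof.
move=> AB; apply: ge0_le_integral_restrict => // z /= Az; right; split => //.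
apply: AB => //; split.
  rewrite mink3E !mxE/= -expr2 sqr_sqrtr; first by ring.
  by have := sqr_ge0 z.1; have := sqr_ge0 z.2; lra.
by rewrite mxE/= sqrtr_gt0; have := sqr_ge0 z.1; have := sqr_ge0 z.2; lra.
Qed.

Definition area_measurable A := measurable [set z : R * R | A (hyperboloid_pt z)].

Lemma area_measurable_halfspace (a b c : R) :
  area_measurable [set x | 0 <= a * x 0 0 + b * x 0 1 + c * x 0 2].
Proof.
pose f (z : R * R) := a * Num.sqrt (1 + z.1 ^+ 2 + z.2 ^+ 2) + b * z.1 + c * z.2.
have mf : measurable_fun setT f.
  apply: measurable_funD; first apply: measurable_funD; apply: measurable_funM => //.
  apply: (measurableT_comp (f := @Num.sqrt R)).
    by apply: continuous_measurable_fun; exact: sqrt_continuous.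
  apply: measurable_funD; first apply: measurable_funD => //.
    exact: measurable_funX.
  exact: measurable_funX.
rewrite /area_measurable (_ : [set z | _] = f @^-1` `[0, +oo[).
  by rewrite -[X in measurable X]setTI; apply: mf => //; exact: measurable_itv.
by apply/seteqP; split => z; rewrite /= !mxE/= in_itv/= andbT.
Qed.

Lemma area_measurableI A B : area_measurable A -> area_measurable B ->
  area_measurable (A `&` B).
Proof. by move=> mA mB; exact: measurableI. Qed.

Lemma hyp_area_setU A B : area_measurable A -> area_measurable B ->
  (hyp_area (A `|` B) <= hyp_area A + hyp_area B)%E.
Proof.
rewrite /area_measurable => mA mB.
set A' := [set z | A _] in mA; set B' := [set z | B _] in mB.
rewrite /hyp_area (_ : [set z | _] = A' `|` (B' `\` A')); last first.
  apply/seteqP; split => z /=; last by case=> [|[]]; [left|right].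
  by have [h|h] := pselect (A' z); [left|case=> // ?; right].
have mBA : measurable (B' `\` A') by exact: measurableD.
rewrite ge0_integral_setU//.
- by rewrite leeD2l//; apply: ge0_le_integral_restrict => // z [? _]; right.
- by apply: measurable_funTS; apply/measurable_EFinP; exact: hyp_area_weight_measurable.
- by rewrite disj_set2E; apply/eqP/seteqP; split => z //= [? []].
Qed.

End AreaMeasure.

(** * Areas of strips, and triangles cut into strips *)

Section TriangleArea.
Context {R : realType}.
Implicit Types (t h : R) (x y z : 'rV[R]_3).

Lemma det3D x y z z' : det3 x y (z + z') = det3 x y z + det3 x y z'.
Proof. by rewrite /det3 !mxE; ring. Qed.

Lemma det3Z x y (a : R) z : det3 x y (a *: z) = a * det3 x y z.
Proof. by rewrite /det3 !mxE; ring. Qed.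

Lemma det3C x y z : det3 x y z = det3 y z x.
Proof. by rewrite /det3; ring. Qed.

Lemma det3N x y z : det3 y x z = - det3 x y z.
Proof. by rewrite /det3; ring. Qed.

(** Bounds on the coordinate t are written as linear inequalities, which are measurable and pass to
    nonnegative combinations of vertices. *)
Definition at_least t : set 'rV[R]_3 := [set x | 0 <= x 0 1 * cosh t - x 0 0 * sinh t].
Definition at_most t : set 'rV[R]_3 := [set x | 0 <= x 0 0 * sinh t - x 0 1 * cosh t].
Definition det_side (s : R) x y : set 'rV[R]_3 := [set z | 0 <= s * det3 x y z].

Lemma at_least_pt t t' h : at_least t (pt t' h) = (t <= t').
Proof.
rewrite /at_least/= !mxE/=.
have -> : cosh h * sinh t' * cosh t - cosh h * cosh t' * sinh t = cosh h * sinh (t' - t).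
  by rewrite sinhB; ring.
by rewrite pmulr_rge0 ?cosh_gt0// -sinh0 ler_sinh subr_ge0.
Qed.

Lemma at_most_pt t t' h : at_most t (pt t' h) = (t' <= t).
Proof.
rewrite /at_most/= !mxE/=.
have -> : cosh h * cosh t' * sinh t - cosh h * sinh t' * cosh t = cosh h * sinh (t - t').
  by rewrite sinhB; ring.
by rewrite pmulr_rge0 ?cosh_gt0// -sinh0 ler_sinh subr_ge0.
Qed.

Lemma at_least_meas t : area_measurable (at_least t).
Proof.
have := @area_measurable_halfspace R (- sinh t) (cosh t) 0.
by congr area_measurable; apply/seteqP; split => x; rewrite /at_least/=; congr (_ <= _); ring.
Qed.

Lemma at_most_meas t : area_measurable (at_most t).
Proof.
have := @area_measurable_halfspace R (sinh t) (- cosh t) 0.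
by congr area_measurable; apply/seteqP; split => x; rewrite /at_most/=; congr (_ <= _); ring.
Qed.

Lemma det_side_meas s x y : area_measurable (det_side s x y).
Proof.
have := @area_measurable_halfspace R (s * (x 0 1 * y 0 2 - x 0 2 * y 0 1))
  (s * (x 0 2 * y 0 0 - x 0 0 * y 0 2)) (s * (x 0 0 * y 0 1 - x 0 1 * y 0 0)).
by congr area_measurable; apply/seteqP; split => z;
  rewrite /det_side/= /det3; congr (_ <= _); ring.
Qed.

(* The integral of sinh h dt along an edge, including the vertical ones, for
   which it is 0. *)
Definition edge_total t1 h1 t2 h2 : R :=
  - asin (slope t2 h2 (pt t1 h1)) - asin (slope t1 h1 (pt t2 h2)).

Lemma edge_total_vertical t h1 h2 : edge_total t h1 t h2 = 0.
Proof.
rewrite /edge_total -asinN; last exact/slope_itv/hyp_pt.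
apply/eqP; rewrite subr_eq0; apply/eqP; congr asin.
rewrite /slope !hdir_frame_v subrr cosh0 !mulr1 (hdistC (pt t h2)).
by ring.
Qed.

Lemma edge_totalE t1 h1 t2 h2 : t1 < t2 ->
  edge_total t1 h1 t2 h2 = edge_angle t1 h1 t2 h2 t2 - edge_angle t1 h1 t2 h2 t1.
Proof. by move=> t12; rewrite edge_angle_start// edge_angle_end. Qed.

Section Strip.
Variables (s tP hP tQ hQ tX hX tY hY : R).
Local Notation P := (pt tP hP).
Local Notation Q := (pt tQ hQ).
Local Notation X := (pt tX hX).
Local Notation Y := (pt tY hY).
Hypotheses (s1 : s = 1 \/ s = -1) (XP : tX <= tP) (PQ : tP <= tQ) (QY : tQ <= tY).
Hypotheses (XY : tX < tY) (sP : det_side (- s) X Y P) (sQ : det_side (- s) X Y Q).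

Definition strip : set 'rV[R]_3 :=
  (at_least tP `&` at_most tQ) `&` (det_side s P Q `&` det_side (- s) X Y).

Lemma strip_meas : area_measurable strip.
Proof.
by apply: area_measurableI; apply: area_measurableI;
  [exact: at_least_meas|exact: at_most_meas|exact: det_side_meas|exact: det_side_meas].
Qed.

(** Points of an edge are nonnegative combinations of its ends, so a side condition that holds at
    [P] and [Q] holds along the edge. *)
Lemma edge_point t h : tP < tQ -> tP <= t <= tQ -> edge_w tP hP tQ hQ t = tanh h ->
  exists a b : R, [/\ 0 <= a, 0 <= b & pt t h = a *: P + b *: Q].
Proof.
move=> PQ' /andP[h1 h2] e.
have S0 : 0 < sinh (tQ - tP) by rewrite sinh_gt0// subr_gt0.
have c0 := cosh_gt0 h; have cP := cosh_gt0 hP; have cQ := cosh_gt0 hQ.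
have a0 : 0 <= sinh (tQ - t) by rewrite sinh_ge0// subr_ge0.
have b0 : 0 <= sinh (t - tP) by rewrite sinh_ge0// subr_ge0.
exists (cosh h * sinh (tQ - t) / (sinh (tQ - tP) * cosh hP)).
exists (cosh h * sinh (t - tP) / (sinh (tQ - tP) * cosh hQ)).
split.
- by apply: divr_ge0; apply: mulr_ge0 => //; apply: ltW.
- by apply: divr_ge0; apply: mulr_ge0 => //; apply: ltW.
have nS := lt0r_neq0 S0; have nP := lt0r_neq0 cP; have nQ := lt0r_neq0 cQ.
have e' : sinh h = cosh h * edge_w tP hP tQ hQ t.
  by rewrite e /tanh mulrC divfK// lt0r_neq0.
apply/rowP => i; rewrite !mxE; case: i => -[|[|[|//]]] p /=.
- have H : cosh t * sinh (tQ - tP) = sinh (tQ - t) * cosh tP + sinh (t - tP) * cosh tQ.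
    by rewrite !sinhB; ring.
  have -> : cosh t = (sinh (tQ - t) * cosh tP + sinh (t - tP) * cosh tQ) / sinh (tQ - tP).
    by rewrite -H mulfK.
  by field; rewrite ?nS ?nP ?nQ.
- have H : sinh t * sinh (tQ - tP) = sinh (tQ - t) * sinh tP + sinh (t - tP) * sinh tQ.
    by rewrite !sinhB; ring.
  have -> : sinh t = (sinh (tQ - t) * sinh tP + sinh (t - tP) * sinh tQ) / sinh (tQ - tP).
    by rewrite -H mulfK.
  by field; rewrite ?nS ?nP ?nQ.
- by rewrite e' /edge_w /tanh; field; rewrite nS nP nQ.
Qed.

(* The sign s tells whether the edge XY is above (1) or below (-1) the edge PQ. *)
Lemma hyp_area_strip_edge : (hyp_area strip <=
  (s * (edge_angle tX hX tY hY tQ - edge_angle tX hX tY hY tP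
    - edge_total tP hP tQ hQ))%:E)%E.
Proof.
(* If [PQ] is vertical, the strip lies in a single fibre and has area 0. *)
move: PQ; rewrite le_eqVlt => /predU1P[e|PQ'].
  rewrite -e edge_total_vertical !subrr mulr0.
  have := @hyp_area_strip _ strip tP tP (cst 0) (cst 0) (cst 0) (cst 0) strip_meas (lexx _).
  rewrite /= !subrr; apply.
  - move=> t y; rewrite cyl_pt => -[[]]; rewrite at_least_pt at_most_pt -e => h1 h2 _.
    by rewrite h1 h2; split => // /andP[h3 h4]; lra.
  - by move=> t /andP[? ?]; lra.
  - by move=> t _; exact: cvg_cst.
  - by move=> t _; exact: cvg_cst.
rewrite edge_totalE//.
pose f := edge_y tP hP tQ hQ; pose g := edge_y tX hX tY hY.
pose F := edge_angle tP hP tQ hQ; pose G := edge_angle tX hX tY hY.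
have W t : tP <= t <= tQ -> tX <= t <= tY by move=> /andP[k1 k2]; rewrite (le_trans XP k1) (le_trans k2 QY).
have posPQ h : 0 < cosh hP * cosh hQ * cosh h * sinh (tQ - tP).
  by rewrite mulr_gt0 ?sinh_gt0 ?subr_gt0// mulr_gt0 ?cosh_gt0// mulr_gt0 ?cosh_gt0.
have posXY h : 0 < cosh hX * cosh hY * cosh h * sinh (tY - tX).
  by rewrite mulr_gt0 ?sinh_gt0 ?subr_gt0// mulr_gt0 ?cosh_gt0// mulr_gt0 ?cosh_gt0.
(* The two bounding curves do not cross: [sP] and [sQ] extend from the ends of [PQ] to all of it. *)
have fg t : tP <= t <= tQ -> 0 <= s * (g t - f t).
  move=> ht; pose h := arsinh (f t).
  have fE : f t = sinh h by rewrite arsinhK.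
  have wE : edge_w tP hP tQ hQ t = tanh h.
    by apply/eqP; rewrite eq_le -le_edge_y// -ge_edge_y// -/f fE lexx.
  have [a [b [a0 b0 xE]]] := edge_point PQ' ht wE.
  have : 0 <= - s * det3 X Y (pt t h).
    rewrite xE det3D !det3Z mulrDr !(mulrCA (- s)).
    by apply: addr_ge0; apply: mulr_ge0.
  rewrite det3_edge// mulrCA pmulr_rge0// mulNr -mulrN opprB fE.
  have hXY := W _ ht.
  case: s1 => ->; rewrite ?mul1r ?mulN1r ?opprB !subr_ge0.
    by rewrite -ge_edge_y.
  by rewrite -le_edge_y.
have sec t (y : R) : strip (cyl t y) ->
    [/\ tP <= t <= tQ, 0 <= s * (y - f t) & 0 <= s * (g t - y)].
  rewrite cyl_pt => -[[]]; rewrite at_least_pt at_most_pt => h1 h2.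
  have ht : tP <= t <= tQ by rewrite h1.
  rewrite /det_side/= !det3_edge// => -[].
  rewrite (mulrCA s) (mulrCA (- s)) (pmulr_rge0 _ (posPQ _)) (pmulr_rge0 _ (posXY _)).
  move=> k1 k2; split => //.
    move: k1; case: s1 => ->; rewrite ?mul1r ?mulN1r ?opprB !subr_ge0.
      by rewrite -le_edge_y// arsinhK.
    by rewrite -ge_edge_y// arsinhK.
  move: k2; have hXY := W _ ht.
  case: s1 => ->; rewrite ?mul1r ?mulN1r ?opprK ?mul1r ?opprB !subr_ge0.
    by rewrite -ge_edge_y// arsinhK.
  by rewrite -le_edge_y// arsinhK.
case: s1 => se; rewrite se ?mul1r ?mulN1r in fg sec *.
- apply: (@hyp_area_strip _ strip tP tQ f g F G strip_meas PQ).
  + by move=> t y /sec[h1]; rewrite !mul1r !subr_ge0 => h2 h3; split => // _; rewrite h2.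
  + by move=> t /andP[h1 h2]; rewrite -subr_ge0 -[leRHS]mul1r fg ?ltW.
  + by move=> t; exact: continuous_edge_y.
  + by move=> t /W; exact: continuous_edge_y.
  + by move=> t; exact: is_derive_edge_angle.
  + by move=> t /W; exact: is_derive_edge_angle.
- rewrite opprB; apply: (@hyp_area_strip _ strip tP tQ g f G F strip_meas PQ).
  + move=> t y /sec[h1]; rewrite !mulN1r !opprB !subr_ge0 => h2 h3.
    by split => // _; rewrite h2 h3.
  + by move=> t /andP[h1 h2]; rewrite -subr_ge0 -opprB -mulN1r fg ?ltW.
  + by move=> t /W; exact: continuous_edge_y.
  + by move=> t; exact: continuous_edge_y.
  + by move=> t /W; exact: is_derive_edge_angle.
  + by move=> t; exact: is_derive_edge_angle.
Qed.

End Strip.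

Definition hcone (p q r : 'rV[R]_3) : set 'rV[R]_3 :=
  [set x | hyp x /\ exists a b c : R,
     [/\ 0 <= a, 0 <= b, 0 <= c & x = a *: p + b *: q + c *: r]].

(* The vertical line through the middle vertex cuts the triangle into two strips. *)
Lemma hyp_area_hcone (s t1 h1 t2 h2 t3 h3 : R) :
  s = 1 \/ s = -1 -> t1 <= t2 -> t2 <= t3 ->
  0 <= s * det3 (pt t1 h1) (pt t2 h2) (pt t3 h3) ->
  (hyp_area (hcone (pt t1 h1) (pt t2 h2) (pt t3 h3)) <=
   (s * (edge_total t1 h1 t3 h3 - edge_total t1 h1 t2 h2
         - edge_total t2 h2 t3 h3))%:E)%E.
Proof.
move=> s1 t12 t23 sD.
set p1 := pt t1 h1 in sD *; set p2 := pt t2 h2 in sD *; set p3 := pt t3 h3 in sD *.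
have range t h (a b c : R) : 0 <= a -> 0 <= b -> 0 <= c ->
    pt t h = a *: p1 + b *: p2 + c *: p3 -> t1 <= t <= t3.
  move=> a0 b0 c0 e.
  suff [] : at_least t1 (pt t h) /\ at_most t3 (pt t h).
    by rewrite at_least_pt at_most_pt => -> ->.
  rewrite /at_least /at_most/= e.
  have L u v k : v <= u -> at_least v (pt u k) by rewrite at_least_pt.
  have G u v k : u <= v -> at_most v (pt u k) by rewrite at_most_pt.
  have t13 := le_trans t12 t23.
  have := L t1 t1 h1 (lexx _); have := L t2 t1 h2 t12; have := L t3 t1 h3 t13.
  have := G t1 t3 h1 t13; have := G t2 t3 h2 t23; have := G t3 t3 h3 (lexx _).
  rewrite /at_least /at_most/= -/p1 -/p2 -/p3 => g3 g2 g1 l3 l2 l1.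
  clearbody p1 p2 p3; split; rewrite !mxE.
  - have := mulr_ge0 a0 l1; have := mulr_ge0 b0 l2; have := mulr_ge0 c0 l3; lra.
  - have := mulr_ge0 a0 g1; have := mulr_ge0 b0 g2; have := mulr_ge0 c0 g3; lra.
(* Otherwise the three vertices lie in one fibre and the long edge is not a graph. *)
have [t13|t31] := ltP t1 t3; last first.
  have e2 : t2 = t1 by lra.
  have e3 : t3 = t1 by lra.
  rewrite e2 e3 !edge_total_vertical !subrr mulr0.
  have := @hyp_area_strip _ (at_least t1 `&` at_most t1) t1 t1 (cst 0) (cst 0)
    (cst 0) (cst 0) (area_measurableI (at_least_meas _) (at_most_meas _)) (lexx _).
  rewrite /= !subrr => H; apply: le_trans (H _ _ _ _ _ _).
  - apply: hyp_area_mono => x /hyp_ptP[t [h ->]] [_ [a [b [c [a0 b0 c0 /range e]]]]].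
    have /andP[k1 k2] := e a0 b0 c0.
    by split; [rewrite at_least_pt|rewrite at_most_pt -e3].
  - move=> t y; rewrite cyl_pt => -[]; rewrite at_least_pt at_most_pt => k1 k2.
    by rewrite k1 k2; split => // /andP[h4 h5]; lra.
  - by move=> t /andP[? ?]; lra.
  - by move=> t _; exact: cvg_cst.
  - by move=> t _; exact: cvg_cst.
have D132 : det3 p1 p3 p2 = - det3 p1 p2 p3 by rewrite /det3; ring.
have D0 x y : det3 x y x = 0 by rewrite /det3; ring.
have D0' x y : det3 x y y = 0 by rewrite /det3; ring.
have side2 : det_side (- s) p1 p3 p2 by rewrite /det_side/= D132 mulrNN.
have side1 : det_side (- s) p1 p3 p1 by rewrite /det_side/= D0 mulr0.
have side3 : det_side (- s) p1 p3 p3 by rewrite /det_side/= D0' mulr0.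
have H1 := hyp_area_strip_edge s1 (lexx t1) t12 t23 t13 side1 side2.
have H2 := hyp_area_strip_edge s1 t12 t23 (lexx t3) t13 side2 side3.
have := leeD H1 H2; rewrite -EFinD.
have -> : s * (edge_total t1 h1 t3 h3 - edge_total t1 h1 t2 h2 - edge_total t2 h2 t3 h3) =
  s * (edge_angle t1 h1 t3 h3 t2 - edge_angle t1 h1 t3 h3 t1 - edge_total t1 h1 t2 h2)
  + s * (edge_angle t1 h1 t3 h3 t3 - edge_angle t1 h1 t3 h3 t2 - edge_total t2 h2 t3 h3).
  by rewrite (edge_totalE h1 h3 t13); ring.
apply: le_trans; apply: le_trans (hyp_area_setU _ _); [|exact: strip_meas|exact: strip_meas].
apply: hyp_area_mono => x /hyp_ptP[t [h ->]] [_ [a [b [c [a0 b0 c0 e]]]]].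
have /andP[k1 k2] := range _ _ _ _ _ a0 b0 c0 e.
have d13 : det_side (- s) p1 p3 (pt t h).
  rewrite /det_side/= e !det3D !det3Z D0 D0' D132.
  by have := mulr_ge0 b0 sD; lra.
have [k|k] := leP t t2; [left|right]; split; split => //.
- by rewrite at_least_pt.
- by rewrite at_most_pt.
- rewrite /det_side/= e !det3D !det3Z D0 D0'.
  by have := mulr_ge0 c0 sD; lra.
- by rewrite at_least_pt ltW.
- by rewrite at_most_pt.
- rewrite /det_side/= e !det3D !det3Z D0 D0'.
  have -> : det3 p2 p3 p1 = det3 p1 p2 p3 by rewrite /det3; ring.
  by have := mulr_ge0 a0 sD; lra.
Qed.

End TriangleArea.

(** * Area of hyperbolic triangles *)

Section GaussBonnet.
Context {R : realType}.
Implicit Types (p q r : 'rV[R]_3) (x : R).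

Lemma acos_cos x : `|x| <= pi -> acos (cos x) = `|x|.
Proof.
move=> hx; have -> : cos x = cos `|x| by case: (ger0P x) => // _; rewrite cosN.
by rewrite cosK// in_itv/= normr_ge0.
Qed.

Lemma acosN_cos x : `|x| <= pi -> acos (- cos x) = pi - `|x|.
Proof. by move=> hx; rewrite acosN ?acos_cos// cos_geN1 cos_le1. Qed.

(** Vertex angles are expressed by absolute values of differences of slope angles. The orientation
    of the triangle gives the sign of the sine of each difference, which removes the absolute
    value. *)
Lemma normr_sin_sign (s x : R) : s = 1 \/ s = -1 -> `|x| < pi -> s * sin x <= 0 ->
  `|x| = - (s * x).
Proof.
move=> s1; rewrite ltr_norml => /andP[x1 x2]; case: s1 => ->.
  rewrite !mul1r => h; rewrite ler0_norm// leNgt; apply/negP => x0.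
  by have := @sin_gt0_pi _ x; rewrite x0 x2 ltNge h => /(_ isT).
rewrite !mulN1r oppr_le0 opprK => h; rewrite ger0_norm// leNgt; apply/negP => x0.
have := @sin_gt0_pi _ (- x); rewrite sinN oppr_gt0 x0/= => H.
by have := H _; rewrite ltrNl x1 oppr_gt0 ltNge h => /(_ isT).
Qed.

(* Ties in the coordinate t are broken by h, so that the bounds of
   [slope_forward] hold for vertical edges too. *)
Definition lex (a b : R * R) : Prop := a.1 < b.1 \/ a.1 = b.1 /\ a.2 <= b.2.
Local Notation ptp a := (pt a.1 a.2).

Lemma lex_total a b : lex a b \/ lex b a.
Proof.
case: (ltgtP a.1 b.1) => h; [by left; left|by right; left|].
by case/orP: (le_total a.2 b.2) => k; [left; right|right; right].
Qed.

Lemma lex_trans b a c : lex a b -> lex b c -> lex a c.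
Proof.
move=> [h|[h h']] [k|[k k']]; [left|left|left|right]; lra.
Qed.

Lemma lex_le a b : lex a b -> a.1 <= b.1.
Proof. by case=> [/ltW|[->]]. Qed.

Lemma lex_wlog3 (P : R * R -> R * R -> R * R -> Prop) :
  (forall a b c, P a b c -> P b a c) -> (forall a b c, P a b c -> P a c b) ->
  (forall a b c, lex a b -> lex b c -> P a b c) -> forall a b c, P a b c.
Proof.
move=> s12 s23 H a b c.
have [ab|ba] := lex_total a b; have [bc|cb] := lex_total b c.
- exact: H.
- have [ac|ca] := lex_total a c; first by apply: s23; apply: H.
  by apply: s23; apply: s12; apply: H.
- have [ac|ca] := lex_total a c; first by apply: s12; apply: H.
  by apply: s12; apply: s23; apply: H.
- by apply: (s12); apply: s23; apply: s12; apply: H.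
Qed.

Lemma hangleC p q r : hangle p q r = hangle p r q.
Proof. by rewrite /hangle minkC. Qed.

Lemma hcone_swap12 p q r : hcone p q r `<=` hcone q p r.
Proof.
move=> x [hx [a [b [c [a0 b0 c0 e]]]]]; split => //.
by exists b, a, c; split => //; rewrite e (addrC (b *: q)).
Qed.

Lemma hcone_swap23 p q r : hcone p q r `<=` hcone p r q.
Proof.
move=> x [hx [a [b [c [a0 b0 c0 e]]]]]; split => //.
by exists a, c, b; split => //; rewrite e addrAC.
Qed.

(** A forward edge never points straight down, nor a backward one straight up. Slope angles then lie
    in intervals open at one end, so that their differences stay strictly below pi in absolute
    value. *)
Lemma slope_forward (a b : R * R) : lex a b -> ptp a != ptp b ->
  [/\ -1 < slope a.1 a.2 (ptp b), slope b.1 b.2 (ptp a) < 1,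
      0 <= mink (hdir (ptp a) (ptp b)) (frame_h a.1)
    & mink (hdir (ptp b) (ptp a)) (frame_h b.1) <= 0].
Proof.
move: a b => [t1 h1] [t2 h2] /= ab neq.
have hd : 0 < (sinh (hdist (pt t1 h1) (pt t2 h2)))^-1.
  by rewrite invr_gt0 sinh_gt0// hdist_gt0//; exact: hyp_pt.
have c1 := cosh_gt0 h1; have c2 := cosh_gt0 h2.
have u := hdir_unit (hyp_pt t1 h1) (hyp_pt t2 h2) neq.
have neq' : pt t2 h2 != pt t1 h1 by rewrite eq_sym.
have u' := hdir_unit (hyp_pt t2 h2) (hyp_pt t1 h1) neq'.
rewrite hdir_mink in u; last exact: hyp_pt.
rewrite hdir_mink in u'; last exact: hyp_pt.
rewrite -/(slope t1 h1 (pt t2 h2)) in u; rewrite -/(slope t2 h2 (pt t1 h1)) in u'.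
move: u u'; rewrite !hdir_frame_h (hdistC (pt t2 h2)) -(opprB t2) sinhN => u u'.
case: ab => /= [t12|[t12 h12]].
  have s0 : 0 < sinh (t2 - t1) by rewrite sinh_gt0// subr_gt0.
  have p1 : 0 < (sinh (hdist (pt t1 h1) (pt t2 h2)))^-1 * (cosh h2 * sinh (t2 - t1)).
    by rewrite mulr_gt0// mulr_gt0.
  have p2 : 0 < (sinh (hdist (pt t1 h1) (pt t2 h2)))^-1 * (cosh h1 * sinh (t2 - t1)).
    by rewrite mulr_gt0// mulr_gt0.
  rewrite !mulrN in u' *; split; [by nra|by nra|by rewrite ltW|by rewrite oppr_le0 ltW].
rewrite /slope !hdir_frame_v (hdistC (pt t2 h2)) t12 subrr sinh0 cosh0 oppr0 !mulr0 !mulr1.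
rewrite -t12 in hd *.
have e : cosh h1 * sinh h2 - sinh h1 * cosh h2 = sinh (h2 - h1) by rewrite sinhB; ring.
have e' : cosh h2 * sinh h1 - sinh h2 * cosh h1 = - sinh (h2 - h1) by rewrite sinhB; ring.
rewrite e e' mulrN.
have k : 0 <= (sinh (hdist (pt t1 h1) (pt t1 h2)))^-1 * sinh (h2 - h1).
  by rewrite mulr_ge0 ?(ltW hd)// sinh_ge0// subr_ge0.
move: (_ * sinh _) k => k k0; clear -k0.
by split => //; lra.
Qed.

Lemma mink_hdir_frame_h t h p : mink (hdir (pt t h) p) (frame_h t) =
  (sinh (hdist (pt t h) p))^-1 * mink p (frame_h t).
Proof. by rewrite hdir.unlock minkZl minkDl minkNl minkZl mink_pt_frame_h mulr0 subr0. Qed.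

Lemma mink_hdir_frame_v t h p : mink (hdir (pt t h) p) (frame_v t h) =
  (sinh (hdist (pt t h) p))^-1 * mink p (frame_v t h).
Proof. by rewrite hdir.unlock minkZl minkDl minkNl minkZl mink_pt_frame_v mulr0 subr0. Qed.

Lemma det3_hdir t h p q : mink (hdir (pt t h) p) (frame_h t) * mink (hdir (pt t h) q) (frame_v t h)
  - mink (hdir (pt t h) p) (frame_v t h) * mink (hdir (pt t h) q) (frame_h t) =
  (sinh (hdist (pt t h) p))^-1 * (sinh (hdist (pt t h) q))^-1 * det3 (pt t h) p q.
Proof.
rewrite det3_frame !mink_hdir_frame_h !mink_hdir_frame_v.
move: (_^-1) (_^-1) (mink _ _) (mink _ _) (mink _ _) (mink _ _) => *.
by ring.
Qed.

Let sign_aux (s P D X : R) : 0 <= P -> 0 <= s * D -> X = - (P * D) -> s * X <= 0.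
Proof.
move=> P0 sD ->; have := mulr_ge0 P0 sD; have -> : P * (s * D) = - (s * - (P * D)) by ring.
by rewrite oppr_ge0.
Qed.

Let half_itv (x y : R) : - (pi / 2) < x <= pi / 2 -> - (pi / 2) < y <= pi / 2 ->
  `|x - y| < pi.
Proof. by move=> /andP[? ?] /andP[? ?]; rewrite ltr_norml; apply/andP; split; lra. Qed.

Let half_itvN (x : R) : - (pi / 2) <= x < pi / 2 -> - (pi / 2) < - x <= pi / 2.
Proof. by move=> /andP[? ?]; apply/andP; split; lra. Qed.

(** At the outer vertices both edges leave in the same direction of t, and the angle is a difference
    of slope angles. At the middle vertex they leave in opposite directions, whence pi minus such a
    difference; this is the pi of the formula. *)
Lemma hyp_area_triangle_sorted (a b c : R * R) : lex a b -> lex b c ->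
  ptp a != ptp b -> ptp b != ptp c -> ptp a != ptp c ->
  (hyp_area (hcone (ptp a) (ptp b) (ptp c)) <=
   (pi - (hangle (ptp a) (ptp b) (ptp c) + hangle (ptp b) (ptp a) (ptp c) +
          hangle (ptp c) (ptp a) (ptp b)))%:E)%E.
Proof.
move=> ab bc nab nbc nac; have ac := lex_trans ab bc.
have [ab1 ab2 ab3 ab4] := slope_forward ab nab.
have [bc1 bc2 bc3 bc4] := slope_forward bc nbc.
have [ac1 ac2 ac3 ac4] := slope_forward ac nac.
have nba : ptp b != ptp a by rewrite eq_sym.
have ncb : ptp c != ptp b by rewrite eq_sym.
have nca : ptp c != ptp a by rewrite eq_sym.
(* The sign tells whether the middle vertex lies below (1) or above (-1) the long edge; when it lies
   on that edge, both would do. *)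
have [s s1 sD] : exists2 s : R, s = 1 \/ s = -1 & 0 <= s * det3 (ptp a) (ptp b) (ptp c).
  have [h|h] := leP 0 (det3 (ptp a) (ptp b) (ptp c)).
    by exists 1; [left|rewrite mul1r].
  by exists (-1); [right|rewrite mulN1r oppr_ge0 ltW].
have E := hyp_area_hcone s1 (lex_le ab) (lex_le bc) sD.
apply: (le_trans E); rewrite lee_fin.
have I (d e : R * R) : -1 <= slope d.1 d.2 (ptp e) <= 1 by exact/slope_itv/hyp_pt.
have L x : -1 < x -> x <= 1 -> - (pi / 2) < asin x <= pi / 2.
  by move=> x1 x2; rewrite asin_gtNpi2 ?x1// asin_lepi2// x2 ltW.
have U x : -1 <= x -> x < 1 -> - (pi / 2) <= asin x < pi / 2.
  by move=> x1 x2; rewrite asin_ltpi2 ?x1// asin_geNpi2// x1 ltW.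
have sinE (d e : R * R) : sin (asin (slope d.1 d.2 (ptp e))) = slope d.1 d.2 (ptp e).
  by rewrite asinK// in_itv/=; exact: I.
have pp := @pi_gt0 R.
have P1 : - (pi / 2) < asin (slope a.1 a.2 (ptp b)) <= pi / 2 by apply: L => //; case/andP: (I a b).
have P2 : - (pi / 2) < asin (slope a.1 a.2 (ptp c)) <= pi / 2 by apply: L => //; case/andP: (I a c).
have P3 : - (pi / 2) < asin (slope b.1 b.2 (ptp c)) <= pi / 2 by apply: L => //; case/andP: (I b c).
have P4 : - (pi / 2) <= asin (slope b.1 b.2 (ptp a)) < pi / 2 by apply: U => //; case/andP: (I b a).
have P5 : - (pi / 2) <= asin (slope c.1 c.2 (ptp a)) < pi / 2 by apply: U => //; case/andP: (I c a).
have P6 : - (pi / 2) <= asin (slope c.1 c.2 (ptp b)) < pi / 2 by apply: U => //; case/andP: (I c b).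
have C1 := cos_slope nab; have C2 := cos_slope nac; have C3 := cos_slope nbc.
have C4 := cos_slope nba; have C5 := cos_slope nca; have C6 := cos_slope ncb.
rewrite (ger0_norm ab3) in C1; rewrite (ger0_norm ac3) in C2; rewrite (ger0_norm bc3) in C3.
rewrite (ler0_norm ab4) in C4; rewrite (ler0_norm ac4) in C5; rewrite (ler0_norm bc4) in C6.
have S1 := sinE a b; have S2 := sinE a c; have S3 := sinE b c.
have S4 := sinE b a; have S5 := sinE c a; have S6 := sinE c b.
have hc1 : mink (hdir (ptp a) (ptp b)) (hdir (ptp a) (ptp c)) =
    cos (asin (slope a.1 a.2 (ptp b)) - asin (slope a.1 a.2 (ptp c))).
  by rewrite cosB C1 C2 S1 S2 hdir_mink//; exact: hyp_pt.
have hc2 : mink (hdir (ptp b) (ptp a)) (hdir (ptp b) (ptp c)) =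
    - cos (- asin (slope b.1 b.2 (ptp a)) - asin (slope b.1 b.2 (ptp c))).
  by rewrite cosB cosN sinN C4 C3 S4 S3 hdir_mink; [rewrite /slope; ring|exact: hyp_pt].
have hc3 : mink (hdir (ptp c) (ptp a)) (hdir (ptp c) (ptp b)) =
    cos (- asin (slope c.1 c.2 (ptp a)) - - asin (slope c.1 c.2 (ptp b))).
  by rewrite cosB !cosN !sinN C5 C6 S5 S6 hdir_mink; [rewrite /slope; ring|exact: hyp_pt].
have pos (x y : 'rV[R]_3) : hyp x -> hyp y -> 0 <= (sinh (hdist x y))^-1.
  by move=> hx hy; rewrite invr_ge0 sinh_ge0// hdist_ge0.
have pos2 (x y z : R * R) : 0 <= (sinh (hdist (ptp x) (ptp y)))^-1 * (sinh (hdist (ptp x) (ptp z)))^-1.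
  by apply: mulr_ge0; apply: pos; exact: hyp_pt.
have sgn1 : s * sin (asin (slope a.1 a.2 (ptp b)) - asin (slope a.1 a.2 (ptp c))) <= 0.
  by apply: (sign_aux (pos2 a b c) sD); rewrite sinB C1 C2 S1 S2 -det3_hdir opprB.
have sgn2 : s * sin (- asin (slope b.1 b.2 (ptp a)) - asin (slope b.1 b.2 (ptp c))) <= 0.
  apply: (sign_aux (pos2 b a c) sD); rewrite -mulrN -det3N -det3_hdir.
  by rewrite sinB sinN cosN C3 C4 S3 S4 /slope !mulNr opprK addrC.
have sgn3 : s * sin (- asin (slope c.1 c.2 (ptp a)) - - asin (slope c.1 c.2 (ptp b))) <= 0.
  apply: (sign_aux (pos2 c a b) sD); rewrite -(det3C (ptp c)) -det3_hdir.
  by rewrite sinB !sinN !cosN C5 C6 S5 S6 /slope !mulrN !mulNr !opprK opprB addrC.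
rewrite /hangle hc1 hc2 hc3.
set x1 := asin _ in P1 sgn1 *; set x2 := asin _ in P2 sgn1 *.
set x3 := asin _ in P3 sgn2 *; set x4 := asin _ in P4 sgn2 *.
set x5 := asin _ in P5 sgn3 *; set x6 := asin _ in P6 sgn3 *.
have a1 := half_itv P1 P2.
have a2 := half_itv (half_itvN P4) P3.
have a3 := half_itv (half_itvN P5) (half_itvN P6).
rewrite (acos_cos (ltW a1)) (acosN_cos (ltW a2)) (acos_cos (ltW a3)).
rewrite (normr_sin_sign s1 a1 sgn1) (normr_sin_sign s1 a2 sgn2) (normr_sin_sign s1 a3 sgn3).
(* Each slope angle occurs once in the edge totals and once in the vertex angles: the two sides are
   equal. *)
rewrite /edge_total -/x1 -/x2 -/x3 -/x4 -/x5 -/x6 le_eqVlt; apply/orP; left; apply/eqP.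
by ring.
Qed.

Lemma hyp_area_triangle p q r : hyp p -> hyp q -> hyp r ->
  p != q -> q != r -> p != r ->
  (hyp_area (hcone p q r) <=
   (pi - (hangle p q r + hangle q p r + hangle r p q))%:E)%E.
Proof.
move=> /hyp_ptP[t1 [h1 ->]] /hyp_ptP[t2 [h2 ->]] /hyp_ptP[t3 [h3 ->]].
move: (lex_wlog3 (P := fun a b c => ptp a != ptp b -> ptp b != ptp c -> ptp a != ptp c ->
  (hyp_area (hcone (ptp a) (ptp b) (ptp c)) <=
   (pi - (hangle (ptp a) (ptp b) (ptp c) + hangle (ptp b) (ptp a) (ptp c) +
          hangle (ptp c) (ptp a) (ptp b)))%:E)%E)) => H.
apply: (H _ _ _ (t1, h1) (t2, h2) (t3, h3)).
- move=> a b c abc ba ac bc.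
  have := abc; rewrite eq_sym => /(_ ba bc ac).
  move/(le_trans (hyp_area_mono (fun (x : 'rV[R]_3) _ => @hcone_swap12 (ptp b) (ptp a) (ptp c) x))).
  by rewrite (hangleC (ptp c)) (addrC (hangle (ptp a) _ _)).
- move=> a b c abc ac cb ab.
  have := abc; rewrite (eq_sym (ptp b)) => /(_ ab cb ac).
  move/(le_trans (hyp_area_mono (fun (x : 'rV[R]_3) _ => @hcone_swap23 (ptp a) (ptp c) (ptp b) x))).
  by rewrite (hangleC (ptp a) (ptp c) (ptp b)) (addrAC _ (hangle (ptp c) _ _)).
- by move=> a b c ab bc nab nbc nac; exact: hyp_area_triangle_sorted.
Qed.

Lemma hyp_area_degenerate p q r : hyp p -> hyp q -> hyp r ->
  p = q \/ q = r \/ p = r -> (hyp_area (hcone p q r) <= 0)%E.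
Proof.
move=> /hyp_ptP[t1 [h1 ->]] /hyp_ptP[t2 [h2 ->]] /hyp_ptP[t3 [h3 ->]].
move: (lex_wlog3 (P := fun a b c => ptp a = ptp b \/ ptp b = ptp c \/ ptp a = ptp c ->
  (hyp_area (hcone (ptp a) (ptp b) (ptp c)) <= 0)%E)) => H.
apply: (H _ _ _ (t1, h1) (t2, h2) (t3, h3)).
- move=> a b c abc e.
  apply: le_trans (hyp_area_mono (fun (x : 'rV[R]_3) _ => @hcone_swap12 (ptp b) (ptp a) (ptp c) x)) _.
  by apply: abc; case: e => [|[]]; [left|right; right|right; left].
- move=> a b c abc e.
  apply: le_trans (hyp_area_mono (fun (x : 'rV[R]_3) _ => @hcone_swap23 (ptp a) (ptp c) (ptp b) x)) _.
  by apply: abc; case: e => [|[]]; [right; right|right; left|left].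
move=> a b c ab bc e.
have D0 : det3 (ptp a) (ptp b) (ptp c) = 0.
  by case: e => [->|[->|->]]; rewrite /det3; ring.
have := @hyp_area_hcone _ 1 _ a.2 _ b.2 _ c.2 (or_introl erefl) (lex_le ab) (lex_le bc).
rewrite D0 mulr0 => /(_ (lexx _))/le_trans; apply; rewrite lee_fin mul1r.
have ptt (d f : R * R) : ptp d = ptp f -> d.1 = f.1 /\ d.2 = f.2.
  move=> /rowP ee; have := ee 1; have := ee 2; rewrite !mxE/= => /sinh_inj e2.
  by rewrite e2 => /(mulfI (lt0r_neq0 (cosh_gt0 _)))/sinh_inj ->.
case: e => [/ptt[-> ->]|[/ptt[-> ->]|/ptt[e1 e2]]].
- by rewrite edge_total_vertical subr0 subrr.
- by rewrite edge_total_vertical subr0 subrr.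
have eb : b.1 = a.1 by apply/eqP; rewrite eq_le (lex_le ab) andbT e1 (lex_le bc).
by rewrite eb -e1 !edge_total_vertical !subrr.
Qed.

End GaussBonnet.

Local Close Scope classical_set_scope.

(** * Combinatorics of the triangulation *)

Local Open Scope set_scope.

Lemma sum_I3 (V : nmodType) (F : 'I_3 -> V) (i : 'I_3) :
  \sum_j F j = F i + F (ordS i) + F (ord_pred i).
Proof.
have s0 : ordS (0 : 'I_3) = 1 by apply/val_inj.
have s1 : ordS (1 : 'I_3) = 2 by apply/val_inj.
have s2 : ordS (2 : 'I_3) = 0 by apply/val_inj.
have q0 : ord_pred (0 : 'I_3) = 2 by apply/val_inj.
have q1 : ord_pred (1 : 'I_3) = 0 by apply/val_inj.
have q2 : ord_pred (2 : 'I_3) = 1 by apply/val_inj.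
rewrite !big_ord_recl big_ord0 addr0.
have -> : lift ord0 (ord0 : 'I_2) = 1 :> 'I_3 by apply/val_inj.
have -> : lift ord0 (lift ord0 (ord0 : 'I_1)) = 2 :> 'I_3 by apply/val_inj.
have : [\/ i = 0, i = 1 | i = 2].
  by case: i => -[|[|[|//]]] p; [constructor 1|constructor 2|constructor 3]; apply/val_inj.
case=> ->; rewrite ?s0 ?s1 ?s2 ?q0 ?q1 ?q2 addrA //.
- by rewrite [RHS]addrC addrA.
- by rewrite -[RHS]addrA [RHS]addrC.
Qed.

Lemma ordSS (i : 'I_3) : ordS (ordS i) = ord_pred i.
Proof. by apply/val_inj; case: i => -[|[|[|//]]]. Qed.

Lemma ord_predpred (i : 'I_3) : ord_pred (ord_pred i) = ordS i.
Proof. by apply/val_inj; case: i => -[|[|[|//]]]. Qed.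

Section Combinatorics.
Context {R : realType} (S : tri_hyp_surface R).
Local Notation corner := (corner S).
Local Notation side := (side S).
Local Notation glue := (@Defs.glue R S).
Implicit Types (s x e : side) (c : corner) (D : {set {set corner}}).

(** The other side of the triangle at the same corner, as opposed to [srev], which reverses the side
    itself. *)
Definition flip s : side := (s.1, ~~ s.2).

Lemma flipK : involutive flip.
Proof. by case=> c b; rewrite /flip/= negbK. Qed.

Lemma flip_neq s : flip s != s.
Proof. by case: s => c b; rewrite xpair_eqE eqxx/=; case: b. Qed.

Lemma eq_or_flip s e : s.1 = e.1 -> s = e \/ s = flip e.
Proof.
by move: s e => [c b] [c' b'] /= ->; case: b b' => -[]; [left|right|right|left].
Qed.

Lemma srevK : involutive (@srev (face S)).
Proof.
case=> -[t i] b; rewrite /srev /send/= negbK.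
by case: b => /=; rewrite ?ordSK ?ord_predK.
Qed.

Lemma srev_neq s : srev s != s.
Proof. by case: s => c b; rewrite xpair_eqE; case: b; rewrite andbF. Qed.

Lemma corner_adj_sym : symmetric (@corner_adj R S).
Proof.
suff H c c' : corner_adj c c' -> corner_adj c' c.
  by move=> c c'; apply/idP/idP; exact: H.
move=> /existsP[b /eqP e]; apply/existsP; exists (glue (c, b)).2.
by rewrite -e -surjective_pairing glueK.
Qed.

Lemma corner_connect_equiv : equivalence_rel (connect (@corner_adj R S)).
Proof.
apply/equivalence_relP; split; first exact: connect0.
move=> c c' cc' c''; apply/idP/idP; last exact: connect_trans.
by apply: connect_trans; rewrite (sym_connect_sym corner_adj_sym).
Qed.

Lemma vertices_partition : finset.partition (vertices S) [set: corner].
Proof. by apply: equivalence_partitionP => c c' c'' _ _ _; exact: corner_connect_equiv. Qed.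

Lemma mem_vertex_of c c' : (c' \in vertex_of c) = connect (@corner_adj R S) c c'.
Proof.
rewrite /vertex_of pblock_equivalence_partition ?inE//.
by move=> ? ? ? _ _ _; exact: corner_connect_equiv.
Qed.

Lemma vertex_of_vertex c : vertex_of c \in vertices S.
Proof. by apply: pblock_mem; rewrite (cover_partition vertices_partition) inE. Qed.

Lemma mem_vertex_ofE v c : v \in vertices S -> (c \in v) = (vertex_of c == v).
Proof.
move=> hv; apply/idP/eqP => [cv|<-]; last by rewrite mem_vertex_of connect0.
by apply: def_pblock => //; have /and3P[] := vertices_partition.
Qed.

(** * Rotation about a boundary vertex *)

Definition boundary_side s := glue s == s.

Section Fan.
Variable e1 : side.
Hypothesis e1_bd : boundary_side e1.

(* From a boundary side, the rotation about its origin crosses the triangles of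
   the vertex one after the other; it is not periodic on these sides because it
   first reaches another boundary side. *)
Definition turn s : side := glue (flip s).
Definition fan i : side := iter i turn e1.

Lemma turn_inj : injective turn.
Proof. by move=> s s' /(can_inj (@glueK R S))/(can_inj flipK). Qed.

Let glue_fan i : glue (fan i.+1) = flip (fan i).
Proof. by rewrite /fan iterS /turn glueK. Qed.

Lemma fan_corners_neq n : (forall i, (i < n)%N -> ~~ boundary_side (flip (fan i))) ->
  forall i j, (i < j <= n)%N -> (fan i).1 <> (fan j).1.
Proof.
move=> noend i j /andP[ij jn] /esym/eq_or_flip[].
  (* If the fan returned to the same side, injectivity of [turn] would bring it back to [e1], and
     the side crossed just before would be [e1] itself, a boundary side. *)
  have kn : (j - i <= n)%N := leq_trans (leq_subr i j) jn.
  have k0 : (0 < j - i)%N by rewrite subn_gt0.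
  rewrite -(subnKC (ltnW ij)); move: (j - i)%N k0 kn => k k0 kn e.
  have {}e : fan k = e1.
    elim: i e {ij} => [|i IH]; first by rewrite add0n.
    by rewrite addSn => /turn_inj; exact: IH.
  case: k k0 kn e => // k _ kn e; have /negP := noend k kn; apply.
  by rewrite /boundary_side -glue_fan glueK e (eqP e1_bd).
(* If it returned to the corner through the other side, it would retrace its steps: the coincidence
   moves inwards from both ends until it meets, at a boundary side or at a side equal to its own
   flip. *)
rewrite -(subnKC ij) addSnnS; move: (j - i.+1)%N (subnKC ij) => d dj.
have {dj jn} : (i + d < n)%N by rewrite -dj addSn in jn.
have [m] := ubnP d; elim: m d i {ij} => // m IH d i dm idn e.
have : flip (fan (i + d)) = fan i.+1.
  by rewrite -glue_fan -addnS e /fan iterS.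
case: d dm idn e => [|[|d]] dm idn e.
- rewrite addn0 in idn; rewrite addn0 => e'.
  have /negP := noend i idn; apply.
  by rewrite /boundary_side -glue_fan glueK glue_fan e'.
- by rewrite addn1 => e'; have := flip_neq (fan i.+1); rewrite e' eqxx.
- move=> e'; apply: (IH d i.+1).
  + by rewrite ltnS in dm; exact: ltn_trans dm.
  + by apply: leq_ltn_trans idn; rewrite addSnnS leq_add2l.
  + by rewrite -e' flipK addSnnS.
Qed.

Lemma fan_end : exists n,
  [/\ forall i, (i < n)%N -> ~~ boundary_side (flip (fan i)),
      boundary_side (flip (fan n))
    & forall i j, (i <= n)%N -> (j <= n)%N -> (fan i).1 = (fan j).1 -> i = j].
Proof.
have ex : exists n, boundary_side (flip (fan n)).
  apply: contrapT => N.
  have noend i : ~~ boundary_side (flip (fan i)) by apply/negP => h; apply: N; exists i.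
  pose h (i : 'I_(#|corner|.+1)) : corner := (fan i).1.
  suff /leq_card : injective h by rewrite card_ord ltnn.
  move=> i j ij; apply/val_inj; case: (ltngtP (val i) (val j)) => // k; exfalso.
  - by apply: (@fan_corners_neq j (fun _ _ => noend _) i j) => //; rewrite k leqnn.
  - by apply: (@fan_corners_neq i (fun _ _ => noend _) j i) => //; rewrite k leqnn.
case: (ex_minnP ex) => n hn min; exists n.
have noend i : (i < n)%N -> ~~ boundary_side (flip (fan i)).
  by move=> k; apply/negP => /min; rewrite leqNgt k.
split=> [||i j hi hj ij]; [exact: noend|exact: hn|].
case: (ltngtP i j) => // k; exfalso.
- by apply: (fan_corners_neq noend (i := i) (j := j)) => //; rewrite k.
- by apply: (fan_corners_neq noend (i := j) (j := i)) => //; rewrite k.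
Qed.

Lemma fan_connect i : connect (@corner_adj R S) e1.1 (fan i).1.
Proof.
elim: i => [|i IH]; first exact: connect0.
apply: connect_trans IH _; apply: connect1; apply/existsP; exists (~~ (fan i).2).
by rewrite /fan iterS /turn.
Qed.

Section FanEnd.
Variable n : nat.
Hypothesis n_first : forall i, (i < n)%N -> ~~ boundary_side (flip (fan i)).
Hypothesis n_bd : boundary_side (flip (fan n)).

(** Crossing either side of a corner of the fan leads to a neighbouring corner of the fan, or
    nowhere new at the two ends, which are boundary sides. *)
Lemma fan_all c : connect (@corner_adj R S) e1.1 c -> exists2 i, (i <= n)%N & c = (fan i).1.
Proof.
move=> /connectP[p]; elim/last_ind: p c => [|p c' IH] c /=; first by move=> _ ->; exists 0%N.
rewrite rcons_path last_rcons => /andP[hp adj] ->.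
have [i ni e] := IH _ hp erefl; move: adj; rewrite e => /existsP[b /eqP <-].
have [eb|eb] := eq_or_flip (erefl : ((fan i).1, b).1 = (fan i).1).
  rewrite eb; case: i ni {e eb} => [|i] ni; first by exists 0%N => //; rewrite (eqP e1_bd).
  by exists i; [exact: ltnW|rewrite glue_fan].
rewrite eb; move: ni; rewrite leq_eqVlt => /predU1P[->|ni].
  by exists n => //; rewrite (eqP n_bd).
by exists i.+1.
Qed.

Lemma fan_boundary_side e : connect (@corner_adj R S) e1.1 e.1 -> boundary_side e ->
  e = e1 \/ e = flip (fan n).
Proof.
move=> /fan_all[i ni] /eq_or_flip[->|->] bd.
  case: i ni bd => [|i] ni bd; [by left|exfalso].
  have /negP := n_first ni; apply.
  by rewrite /boundary_side -/(turn _) -[turn _]/(fan i.+1) -glue_fan eq_sym.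
move: ni; rewrite leq_eqVlt => /predU1P[->|ni]; first by right.
by have := n_first ni; rewrite bd.
Qed.

Lemma fan_end_neq : (forall i j, (i <= n)%N -> (j <= n)%N -> (fan i).1 = (fan j).1 -> i = j) ->
  flip (fan n) != e1.
Proof.
move=> inj; apply/eqP => e.
have n0 : n = 0%N by apply: inj => //; have := congr1 fst e.
by move: e; rewrite n0 => e; have := flip_neq e1; rewrite -{2}e eqxx.
Qed.

End FanEnd.
End Fan.

Lemma vertex_of_connect c c' : connect (@corner_adj R S) c c' -> vertex_of c' = vertex_of c.
Proof.
by rewrite -mem_vertex_of mem_vertex_ofE ?vertex_of_vertex// => /eqP.
Qed.

Lemma boundary_vertexP v : reflect
  (exists2 e, boundary_side e & vertex_of e.1 = v) (v \in boundary_vertices S).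
Proof.
apply: (iffP idP) => [|[e be <-]].
  rewrite inE => /andP[hv /existsP[c /andP[cv /existsP[b gb]]]].
  by exists (c, b) => //; apply/eqP; rewrite -mem_vertex_ofE.
rewrite inE vertex_of_vertex/=; apply/existsP; exists e.1.
rewrite mem_vertex_of connect0/=; apply/existsP; exists e.2.
by rewrite -surjective_pairing.
Qed.

Lemma two_boundary_sides e : boundary_side e -> exists e',
  [/\ boundary_side e', vertex_of e'.1 = vertex_of e.1 & e' != e].
Proof.
move=> be; have [n [first end_ inj]] := fan_end be.
exists (flip (fan e n)); split => //.
- by rewrite (vertex_of_connect (fan_connect e n)).
- exact: fan_end_neq.
Qed.

(** * Counting edges and boundary vertices *)

Definition edge_of s : {set side} := [set s; srev s; Defs.glue s; srev (Defs.glue s)].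
(* Boundary edges consist of two oriented sides instead of four, so that weighting
   their sides by 2 makes the weight of every edge at most 4. *)
Definition smult s : nat := 1 + boundary_side s.

Lemma boundary_side_srev s : boundary_side (srev s) = boundary_side s.
Proof. by rewrite /boundary_side glue_rev (can_eq srevK). Qed.

Lemma sum_smult_edge s : (\sum_(x in edge_of s) smult x <= 4)%N.
Proof.
have [bs|bs] := boolP (boundary_side s).
  have -> : edge_of s = s |: [set srev s].
    by apply/setP => x; rewrite !inE (eqP bs); case: (x == s); case: (x == srev s).
  apply: (@leq_trans (smult s + smult (srev s))%N); last first.
    by rewrite /smult; do 2 case: (boundary_side _).
  by rewrite big_setU1 ?big_set1// inE eq_sym srev_neq.
have gs : boundary_side (Defs.glue s) = false.
  by apply/negbTE; move: bs; rewrite /boundary_side glueK eq_sym.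
rewrite (eq_bigr (fun=> 1%N)) => [|x]; last first.
  rewrite /smult !inE => /orP[/orP[/orP[]|]|] /eqP ->.
  - by rewrite (negbTE bs).
  - by rewrite boundary_side_srev (negbTE bs).
  - by rewrite gs.
  - by rewrite boundary_side_srev gs.
rewrite sum1_card.
have := card_size [:: s; srev s; Defs.glue s; srev (Defs.glue s)].
apply: leq_trans; apply/eq_leq/eq_card => x.
by rewrite !inE -!orbA.
Qed.

(** Double counting of weights: the total is 6 F plus the number of oriented boundary sides, of
    which each boundary vertex is the origin of two, and no edge weighs more than 4. *)
Lemma edges_bound : (3 * #|face S| + #|boundary_vertices S| <= 2 * #|edges S|)%N.
Proof.
have sE : (\sum_(s : side) smult s <= 4 * #|edges S|)%N.
  apply: (@leq_trans (\sum_(E in edges S) \sum_(x in E) smult x)%N); last first.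
    rewrite mulnC -sum_nat_const; apply: leq_sum => E /imsetP[s _ ->].
    exact: sum_smult_edge.
  rewrite (exchange_big_dep predT)//=; apply: leq_sum => s _.
  rewrite (bigD1 (edge_of s)) ?leq_addr//= inE.
  by apply/andP; split; [exact: imset_f|rewrite !inE eqxx].
have sB : (2 * #|boundary_vertices S| <= \sum_(s | boundary_side s) 1)%N.
  apply: (@leq_trans (\sum_(v in boundary_vertices S)
     \sum_(s | boundary_side s && (vertex_of s.1 == v)) 1)%N); last first.
    rewrite (exchange_big_dep boundary_side) => [|v s _ /andP[]//].
    apply: leq_sum => s bs; rewrite sum1_card.
    rewrite -(cards1 (vertex_of s.1)); apply/subset_leq_card/fintype.subsetP => v.
    by rewrite !inE => /andP[_ /andP[_ /eqP ->]].
  rewrite mulnC -sum_nat_const; apply: leq_sum => v /boundary_vertexP[e be <-].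
  have [e' [be' ve' ne]] := two_boundary_sides be.
  rewrite (bigD1 e)/=; last by rewrite be eqxx.
  by rewrite (bigD1 e')/= ?be' ?ve' ?eqxx ?ne.
have sm : (\sum_(s : side) smult s = 6 * #|face S| + \sum_(s | boundary_side s) 1)%N.
  rewrite big_split/= sum1_card !card_prod card_ord card_bool; congr addn.
    by rewrite -mulnA mulnC.
  by rewrite [RHS]big_mkcond; apply: eq_bigr => s _; case: boundary_side.
move: sE sB; rewrite sm => sE sB; rewrite -(@leq_pmul2l 2)// mulnDr mulnA.
by rewrite [leqRHS]mulnA; apply: leq_trans sE; rewrite leq_add2l.
Qed.

End Combinatorics.

(** * The bound on each triangle *)

Section TriangleBound.
Context {R : realType} (M : gen_hyp_3manifold R) (S : tri_hyp_surface R).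
Variables (f : face S -> 'rV[R]_3 -> M) (D : {set {set corner S}}).
Hypothesis f_hmap : h_map f D.
Implicit Types (s : side S) (c : corner S) (t : face S).

Lemma slength_ge0 s : 0 <= slength s.
Proof. by apply: hdist_ge0; exact: vtx_hyp. Qed.

Lemma slength_glue s : slength (Defs.glue s) = slength s.
Proof. exact: glue_length. Qed.

Lemma slength_srev s : slength (srev s) = slength s.
Proof.
rewrite /slength -/(srev s).1 hdistC; congr (hdist (vtx _) _).
by rewrite -[in RHS](srevK s).
Qed.

Lemma slength_eq0 s : (slength s == 0) = (vtx s.1 == vtx (send s)).
Proof.
apply/eqP/eqP => [|e]; first by apply: hdist_eq0; exact: vtx_hyp.
by rewrite /slength e hdistxx//; exact: vtx_hyp.
Qed.

Lemma triangle_hcone t (i : 'I_3) : forall x, hyp x -> triangle t x ->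
  hcone (vtx (t, i)) (vtx (t, ordS i)) (vtx (t, ord_pred i)) x.
Proof.
move=> x _ [hx [a [a0 _ xE]]]; split; first by [].
by exists (a i), (a (ordS i)), (a (ord_pred i)); rewrite xE (sum_I3 _ i).
Qed.

Lemma vtx_triangle t i : triangle t (vtx (t, i)).
Proof.
split; first exact: vtx_hyp.
exists (fun j => (j == i)%:R); split=> [j|j|]; rewrite ?ler0n//.
rewrite (bigD1 i)//= eqxx scale1r big1 ?addr0// => j /negbTE ->.
by rewrite scale0r.
Qed.

Definition degenerate_corner c : bool :=
  (slength (c, true) == 0) || (slength (c, false) == 0).

Lemma corner_angle_le_hangle c : ~~ degenerate_corner c ->
  corner_angle f c <= hangle (vtx c) (vtx (send (c, true))) (vtx (send (c, false))).
Proof.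
case: c => t i; rewrite negb_or !slength_eq0 => /andP[h1 h2].
have [_ iso _ _] := f_hmap.
by apply: (develop_angle_le (hconvex_hhull _) (iso t)) => //; exact: vtx_triangle.
Qed.

Lemma corner_angle_degenerate c : degenerate_corner c -> corner_angle f c = 0.
Proof.
by move=> /orP[] /eqP h; apply: angle_zero_length; rewrite h lexx; [left|right].
Qed.

Lemma corner_angle_ge0 c : 0 <= corner_angle f c.
Proof. exact: angle_ge0. Qed.

Definition degenerate_count t : nat :=
  #|[set i | degenerate_corner (t, i) && (vertex_of (t, i) \in D)]|.

(* In a degenerate triangle the angle excess pi is shared equally by the
   distinguished corners lying on a side of length 0. *)
Definition slack c : R :=
  if degenerate_corner c && (vertex_of c \in D) then pi / (degenerate_count c.1)%:R
  else 0.

Lemma slack_ge0 c : 0 <= slack c.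
Proof. by rewrite /slack; case: ifP => // _; rewrite divr_ge0 ?pi_ge0. Qed.

Lemma sum_slack_le t : \sum_i slack (t, i) <= pi.
Proof.
rewrite /slack -big_mkcond/= sumr_const.
set n := #|_|; have -> : degenerate_count t = n by apply: eq_card => i; rewrite inE.
case: n => [|n]; first by rewrite mulr0n pi_ge0.
by rewrite -(mulr_natr (pi / _)) divfK ?pnatr_eq0.
Qed.

Lemma triangle_bound t :
  (hyp_area (triangle t) <= (pi - \sum_i (corner_angle f (t, i) + slack (t, i)))%:E)%E.
Proof.
apply: le_trans (hyp_area_mono (@triangle_hcone t 0)) _.
pose p := vtx (t, 0); pose q := vtx (t, ordS 0); pose r := vtx (t, ord_pred 0).
have hp : hyp p by exact: vtx_hyp.
have hq : hyp q by exact: vtx_hyp.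
have hr : hyp r by exact: vtx_hyp.
have d0 : degenerate_corner (t, 0) = (p == q) || (p == r).
  by rewrite /degenerate_corner !slength_eq0.
have d1 : degenerate_corner (t, ordS 0) = (q == r) || (q == p).
  by rewrite /degenerate_corner !slength_eq0 /send/= ordSS ordSK.
have d2 : degenerate_corner (t, ord_pred 0) = (r == p) || (r == q).
  by rewrite /degenerate_corner !slength_eq0 /send/= ord_predpred ord_predK.
have a0 := @corner_angle_le_hangle (t, 0).
have a1 := @corner_angle_le_hangle (t, ordS 0).
have a2 := @corner_angle_le_hangle (t, ord_pred 0).
rewrite /send/= ?ordSS ?ordSK ?ord_predpred ?ord_predK -/p -/q -/r in a0 a1 a2.
have hxx (x y : 'rV[R]_3) : hyp x -> hyp y -> x != y -> hangle x y y = 0.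
  by move=> hx hy xy; rewrite /hangle hdir_unit// acos1.
have := sum_slack_le t.
rewrite big_split/= (sum_I3 (fun i => corner_angle f (t, i)) 0).
have [deg sl|] := boolP [|| p == q, q == r | p == r].
  (* A corner on a collapsed side has angle 0 by the default value of [angle]; at a corner facing
     it, the two sides coincide. *)
  have z0 : corner_angle f (t, 0) <= 0.
    have [/corner_angle_degenerate ->//|nd] := boolP (degenerate_corner (t, 0)).
    apply: le_trans (a0 nd) _; move: nd deg; rewrite d0 negb_or => /andP[pq /negbTE pr].
    by rewrite (negbTE pq) pr/= orbF => /eqP <-; rewrite hxx.
  have z1 : corner_angle f (t, ordS 0) <= 0.
    have [/corner_angle_degenerate ->//|nd] := boolP (degenerate_corner (t, ordS 0)).
    apply: le_trans (a1 nd) _; move: nd deg; rewrite d1 negb_or => /andP[/negbTE qr qp].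
    by rewrite (eq_sym p q) (negbTE qp) qr/= => /eqP <-; rewrite hxx.
  have z2 : corner_angle f (t, ord_pred 0) <= 0.
    have [/corner_angle_degenerate ->//|nd] := boolP (degenerate_corner (t, ord_pred 0)).
    apply: le_trans (a2 nd) _; move: nd deg; rewrite d2 negb_or => /andP[rp /negbTE rq].
    by rewrite (eq_sym q r) (eq_sym p r) (negbTE rp) rq/= orbF => /eqP <-; rewrite hxx.
  apply: (@le_trans _ _ 0%E); last first.
    rewrite lee_fin; move: z0 z1 z2 sl {a0 a1 a2}.
    move: (corner_angle f (t, 0)) (corner_angle f (t, ordS 0)).
    move: (corner_angle f (t, ord_pred 0)) (\sum_i slack _) => A B C L.
    clear; lra.
  apply: hyp_area_degenerate => //.
  by case/or3P: deg => /eqP; [left|right; left|right; right].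
rewrite !negb_or => /and3P[pq qr pr] _.
rewrite (_ : \sum_i slack (t, i) = 0); last first.
  apply: big1 => i _.
  have nd : ~~ degenerate_corner (t, i).
    have : [\/ i = 0, i = ordS 0 | i = ord_pred 0].
      by case: i => -[|[|[|//]]] k; [constructor 1|constructor 2|constructor 3]; apply/val_inj.
    case=> ->; rewrite ?d0 ?d1 ?d2 negb_or.
    - by rewrite pq pr.
    - by rewrite qr eq_sym pq.
    - by rewrite eq_sym pr eq_sym qr.
  by rewrite /slack (negbTE nd).
apply: le_trans (hyp_area_triangle hp hq hr pq qr pr) _.
rewrite lee_fin addr0.
have {}a0 : corner_angle f (t, 0) <= hangle p q r by apply: a0; rewrite d0 negb_or pq.
have {}a1 : corner_angle f (t, ordS 0) <= hangle q p r.
  by rewrite hangleC; apply: a1; rewrite d1 negb_or qr eq_sym.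
have {}a2 : corner_angle f (t, ord_pred 0) <= hangle r p q.
  by apply: a2; rewrite d2 negb_or eq_sym pr eq_sym.
move: a0 a1 a2; move: (corner_angle f (t, 0)) (corner_angle f (t, ordS 0)).
move: (corner_angle f (t, ord_pred 0)) (hangle p q r) (hangle q p r) (hangle r p q).
clear; move=> *; lra.
Qed.

End TriangleBound.

(** * Distinguished vertices *)

Local Arguments fan : simpl never.

Section DistinguishedVertex.
Context {R : realType} (M : gen_hyp_3manifold R) (S : tri_hyp_surface R).
Variables (f : face S -> 'rV[R]_3 -> M) (D : {set {set corner S}}).
Hypotheses (f_hmap : h_map f D) (bd_geod : geodesic_boundary f D).
Implicit Types (s e : side S) (c : corner S) (t : face S).

Lemma degenerate_cornerE s :
  degenerate_corner s.1 = (slength s == 0) || (slength (flip s) == 0).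
Proof. by case: s => c []; rewrite /degenerate_corner// orbC. Qed.

Lemma send_flip_srev s : send (flip (srev s)) = send (flip s).
Proof. by case: s => -[t i] []; rewrite /send/= ?ordSS ?ord_predpred. Qed.

(** The triangle is then a segment traversed twice, and the far end of [s] faces the collapsed
    side. *)
Lemma nondegenerate_send s : slength s != 0 -> slength (flip s) = 0 ->
  ~~ degenerate_corner (send s).
Proof.
move=> s0 /eqP fs0; rewrite (degenerate_cornerE (srev s)) slength_srev (negbTE s0)/=.
move: fs0 s0; rewrite !slength_eq0 send_flip_srev => /eqP e.
by apply: contraNN => /eqP /= ->; rewrite -e.
Qed.

(** With both ends distinguished, the side would be a whole boundary arc, of length 0. *)
Lemma zero_boundary_side e : boundary_side e -> vertex_of e.1 \in D ->
  slength e = 0 -> vertex_of (send e) \notin D.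
Proof.
move=> be ve e0; apply/negP => se; have [_ /(_ e [::])] := bd_geod.
rewrite /bd_arc /bd_chain -/(boundary_side e) be ve se => /(_ isT).
by rewrite /chain_length big_seq1 e0 ltxx.
Qed.

Definition counted c : bool := degenerate_corner c && (vertex_of c \in D).

Lemma send_case s (i : 'I_3) :
  [\/ (s.1.1, i) = s.1, (s.1.1, i) = send s | (s.1.1, i) = send (flip s)].
Proof.
have : [\/ i = s.1.2, i = ordS s.1.2 | i = ord_pred s.1.2].
  case: s => -[t k] b /=.
  by case: i => -[|[|[|//]]] ?; case: k => -[|[|[|//]]] ?;
    do ?[by constructor 1; apply/val_inj|by constructor 2; apply/val_inj|
         by constructor 3; apply/val_inj].
case: s => -[t k] [] /= [] ->; rewrite /send/=.
- by constructor 1.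
- by constructor 2.
- by constructor 3.
- by constructor 1.
- by constructor 3.
- by constructor 2.
Qed.

Lemma slack_counted c (n : nat) : (degenerate_count D c.1 <= n.+1)%N -> counted c ->
  pi / n.+1%:R <= slack D c.
Proof.
move=> cn cc; rewrite /slack -/(counted c) cc.
have c0 : (0 < degenerate_count D c.1)%N.
  by apply/card_gt0P; exists c.2; rewrite inE -surjective_pairing.
by rewrite ler_pM2l ?pi_gt0// lef_pV2 ?posrE ?ltr0n// ler_nat.
Qed.

Lemma slack_half s : counted s.1 -> ~~ counted (send s) -> pi / 2 <= slack D s.1.
Proof.
move=> cs ns; apply: (@slack_counted _ 1) => //.
apply: (@leq_trans #|[set~ (send s).2]|); last by rewrite cardsC1 card_ord.
apply/subset_leq_card/fintype.subsetP => i; rewrite !inE => ci.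
apply: contraNneq ns => iE; rewrite /counted.
by have -> : send s = (s.1.1, i) by rewrite iE.
Qed.

Lemma slack_full s : counted s.1 -> ~~ counted (send s) -> ~~ counted (send (flip s)) ->
  pi <= slack D s.1.
Proof.
move=> cs ns nf; rewrite -[leLHS]divr1; apply: (@slack_counted _ 0) => //.
apply: (@leq_trans #|[set s.1.2]|); last by rewrite cards1.
apply/subset_leq_card/fintype.subsetP => i; rewrite !inE => ci.
have [e|e|e] := send_case s i; first by rewrite -e.
- by move: ns; rewrite /counted -e ci.
- by move: nf; rewrite /counted -e ci.
Qed.

Lemma slength_flip_fan e i : slength (flip (fan e i)) = slength (fan e i.+1).
Proof. by rewrite -slength_glue. Qed.

Lemma vertex_of_fan e i : vertex_of (fan e i).1 = vertex_of e.1.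
Proof. exact: vertex_of_connect (fan_connect e i). Qed.

Lemma chain_length_ge e (es : seq (side S)) : slength e <= chain_length e es.
Proof.
rewrite /chain_length big_cons lerDl; apply: sumr_ge0 => s _; exact: slength_ge0.
Qed.

Lemma chain_pathE e es u : u < slength e -> chain_path f e es u = side_path f e u.
Proof. by case: es => //= e' es /ltW ->. Qed.

Lemma angle_chain_le e es e' es' : slength e != 0 -> slength e' != 0 ->
  angle (chain_length e es) (chain_path f e es) (chain_length e' es') (chain_path f e' es')
  <= angle (slength e) (side_path f e) (slength e') (side_path f e').
Proof.
move=> z z'; have p : 0 < slength e by rewrite lt_def z slength_ge0.
have p' : 0 < slength e' by rewrite lt_def z' slength_ge0.
apply: (angle_germ (d := Num.min (slength e) (slength e'))) => //.
- exact: lt_le_trans p (chain_length_ge _ _).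
- exact: lt_le_trans p' (chain_length_ge _ _).
- by rewrite lt_min p.
- by move=> t; rewrite lt_min => /and3P[_ h _]; exact: chain_pathE.
- by move=> t; rewrite lt_min => /and3P[_ _ h]; exact: chain_pathE.
Qed.

Section Fan.
Variables (e1 : side S) (n : nat).
Hypotheses (e1_bd : boundary_side e1) (n_bd : boundary_side (flip (fan e1 n)))
  (e1_D : vertex_of e1.1 \in D).

(** The fan has triangles 0 to n and sides 0 to n + 1; the last side, being in the boundary, is
    glued to itself. *)
Let last_fan : fan e1 n.+1 = flip (fan e1 n).
Proof. exact/eqP. Qed.

(* Along the fan of a distinguished vertex, let a and b be the first and the last
   sides of length 0.  On the outer side of a, the triangle has a corner that does
   not share its excess, and likewise for b; so each of the two triangles gives at
   least pi / 2, or pi if they coincide.  When a or b is a boundary side, this is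
   where positivity of the length of boundary arcs is used. *)
Lemma sum_slack_fan : (exists2 a, (a <= n.+1)%N & slength (fan e1 a) = 0) ->
  pi <= \sum_(i < n.+1) slack D (fan e1 i).1.
Proof.
move=> [a0 a0n /eqP z0].
have fanD i : vertex_of (fan e1 i).1 \in D by rewrite vertex_of_fan.
have [i0 [i0n c0 s0]] : exists i, [/\ (i <= n)%N, counted (fan e1 i).1
    & ~~ counted (send (fan e1 i))].
  case: (ex_minnP (ex_intro (fun a => slength (fan e1 a) == 0) a0 z0)) => -[|a] za min.
    exists 0%N; split => //.
      by rewrite /counted fanD degenerate_cornerE za.
    by rewrite /counted negb_and zero_boundary_side ?orbT//; exact/eqP.
  have an : (a <= n)%N by have := leq_trans (min _ z0) a0n.
  have na : slength (fan e1 a) != 0 by apply/negP => /min; rewrite ltnn.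
  exists a; split => //.
    by rewrite /counted fanD degenerate_cornerE slength_flip_fan za orbT.
  by rewrite /counted negb_and nondegenerate_send// slength_flip_fan; exact/eqP.
have [i1 [i1n c1 s1]] : exists i, [/\ (i <= n)%N, counted (fan e1 i).1
    & ~~ counted (send (flip (fan e1 i)))].
  have ex : exists a, (a <= n.+1)%N && (slength (fan e1 a) == 0) by exists a0; rewrite a0n.
  have bnd a : (a <= n.+1)%N && (slength (fan e1 a) == 0) -> (a <= n.+1)%N by case/andP.
  case: (ex_maxnP ex bnd) => b /andP[bn zb] max.
  move: bn; rewrite leq_eqVlt => /predU1P[bE|bn].
    exists n; split => //.
      by rewrite /counted fanD degenerate_cornerE slength_flip_fan -bE zb orbT.
    rewrite /counted negb_and zero_boundary_side ?orbT//.
      exact: fanD.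
    by rewrite -last_fan -bE; exact/eqP.
  rewrite ltnS in bn; exists b; split => //.
    by rewrite /counted fanD degenerate_cornerE zb.
  rewrite /counted negb_and nondegenerate_send ?flipK//; last exact/eqP.
  rewrite slength_flip_fan; apply/negP => z.
  by have := max b.+1; rewrite ltnS bn z ltnn => /(_ isT).
pose o0 : 'I_n.+1 := Ordinal (i0n : (i0 < n.+1)%N).
pose o1 : 'I_n.+1 := Ordinal (i1n : (i1 < n.+1)%N).
have [e|ne] := eqVneq o0 o1.
  have e01 : i0 = i1 by have := congr1 val e.
  rewrite (bigD1 o0)//= -[leLHS]addr0 lerD ?sumr_ge0// => [|? _]; last exact: slack_ge0.
  by apply: slack_full; rewrite // e01.
rewrite (bigD1 o0)//= (bigD1 o1) 1?eq_sym//= addrA -[leLHS]addr0 lerD//; last first.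
  by apply: sumr_ge0 => ? _; exact: slack_ge0.
rewrite [leLHS](splitr pi) lerD//; first exact: slack_half.
exact: (@slack_half (flip (fan e1 i1))).
Qed.

Lemma side_path0 s : side_path f s 0 = f s.1.1 (vtx s.1).
Proof. by rewrite /side_path hgeod0//; exact: vtx_hyp. Qed.

Lemma turn_angle s :
  angle (slength s) (side_path f s) (slength (flip s)) (side_path f (flip s)) =
  corner_angle f s.1.
Proof.
by case: s => c []; [|rewrite angleC; [|rewrite !side_path0]].
Qed.

Lemma side_path_glue s u : 0 <= u <= slength s ->
  side_path f (Defs.glue s) u = side_path f s u.
Proof. by have [h _ _ _] := f_hmap => /h ->. Qed.

Lemma side_path_unit_speed s : slength s != 0 -> unit_speed_at0 (side_path f s).
Proof.
case: s => -[t i] b; rewrite slength_eq0 => ne; have [_ iso _ _] := f_hmap.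
by apply: (develop_unit_speed (hconvex_hhull _) (iso t)) => //; exact: vtx_triangle.
Qed.

Lemma side_path_fan0 i : side_path f (fan e1 i) 0 = side_path f e1 0.
Proof.
elim: i => // i <-; rewrite -[fan e1 i.+1]/(Defs.glue (flip (fan e1 i))).
have h : (0 : R) <= 0 <= slength (flip (fan e1 i)) by rewrite lexx slength_ge0.
by rewrite (side_path_glue h) !side_path0.
Qed.

(** The triangle inequality is applied along the fan. It needs a direction on each intermediate
    side, hence nonzero lengths. *)
Lemma angle_fan_le (m : nat) : (forall a, (a <= m.+1)%N -> slength (fan e1 a) != 0) ->
  angle (slength e1) (side_path f e1)
        (slength (fan e1 m.+1)) (side_path f (fan e1 m.+1)) <=
  \sum_(i < m.+1) corner_angle f (fan e1 i).1.
Proof.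
have pos a : slength (fan e1 a) != 0 -> 0 < slength (fan e1 a).
  by move=> h; rewrite lt_def h slength_ge0.
have step a : slength (fan e1 a) != 0 -> slength (fan e1 a.+1) != 0 ->
    angle (slength (fan e1 a)) (side_path f (fan e1 a))
      (slength (fan e1 a.+1)) (side_path f (fan e1 a.+1)) <= corner_angle f (fan e1 a).1.
  move=> za zb; rewrite -turn_angle.
  have z' := pos _ zb; rewrite -slength_flip_fan in z'.
  apply: (angle_germ (d := slength (flip (fan e1 a)))) => //; do ?exact: pos.
  move=> t /andP[t0 tl]; rewrite -[fan e1 a.+1]/(Defs.glue (flip (fan e1 a))).
  by rewrite side_path_glue// t0 ltW.
elim: m => [|m IH] nz.
  by rewrite big_ord1; have := step 0%N (nz 0%N isT) (nz 1%N isT).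
rewrite big_ord_recr/=.
have nz1 := nz m.+1 (leqnSn _); have nz2 := nz m.+2 (leqnn _); have nz0 := nz 0%N isT.
apply: (@le_trans _ _ (angle (slength e1) (side_path f e1)
    (slength (fan e1 m.+1)) (side_path f (fan e1 m.+1)) +
  angle (slength (fan e1 m.+1)) (side_path f (fan e1 m.+1))
    (slength (fan e1 m.+2)) (side_path f (fan e1 m.+2)))).
  apply: (angle_triangle (pos _ nz1) (pos _ nz0) (pos _ nz2)).
  - exact: side_path_fan0.
  - exact: etrans (side_path_fan0 _) (esym (side_path_fan0 _)).
  - exact: side_path_unit_speed.
  - exact: (side_path_unit_speed nz0).
  - exact: side_path_unit_speed.
by apply: lerD (step _ nz1 nz2); apply: IH => a am; apply: nz; exact: leqW.
Qed.

End Fan.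

Lemma distinguished_vertex_sum v theta : v \in D -> is_exterior_angle f D v theta ->
  pi - theta <= \sum_(c in v) (corner_angle f c + slack D c).
Proof.
move=> vD [e1 [s1 [e2 [s2 [[a1 a2] [v1 v2] ne ->]]]]].
have b1 : boundary_side e1 by case/and3P: a1 => /andP[].
have b2 : boundary_side e2 by case/and3P: a2 => /andP[].
have [n [first n_bd inj]] := fan_end b1.
have last_fan : fan e1 n.+1 = flip (fan e1 n) by exact/eqP.
have conn c : (c \in v) = connect (@corner_adj R S) e1.1 c by rewrite -v1 mem_vertex_of.
have e2E : e2 = fan e1 n.+1.
  have c2 : connect (@corner_adj R S) e1.1 e2.1.
    by rewrite -conn -v2 mem_vertex_of connect0.
  rewrite last_fan; have [e|//] := fan_boundary_side b1 first n_bd c2 b2.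
  by rewrite e eqxx in ne.
have vE : v = [set (fan e1 i).1 | i : 'I_n.+1].
  apply/setP => c; rewrite conn; apply/idP/imsetP => [|[i _ ->]].
    by case/(fan_all b1 n_bd) => i ni ->; exists (Ordinal (ni : (i < n.+1)%N)).
  exact: fan_connect.
have -> : \sum_(c in v) (corner_angle f c + slack D c) =
    \sum_(i < n.+1) corner_angle f (fan e1 i).1 + \sum_(i < n.+1) slack D (fan e1 i).1.
  rewrite vE big_imset/= => [|i j _ _ ij]; first by rewrite -big_split.
  by apply/val_inj; apply: inj ij; rewrite -ltnS.
set A := angle _ _ _ _; rewrite opprB addrC subrK.
(* If some side at v has length 0, the slack alone gives pi, which bounds any angle; otherwise the
   corner angles alone are enough. *)
have [[a an za]|nz] := pselect (exists2 a, (a <= n.+1)%N & slength (fan e1 a) = 0).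
  rewrite -[leLHS]add0r lerD//; first by apply: sumr_ge0 => ? _; exact: corner_angle_ge0.
  apply: le_trans (angle_le_pi _ _ _ _) _; apply: sum_slack_fan => //.
  - by rewrite v1.
  - by exists a.
have {}nz a : (a <= n.+1)%N -> slength (fan e1 a) != 0.
  by move=> an; apply/eqP => za; apply: nz; exists a.
rewrite -[leLHS]addr0 lerD//; last by apply: sumr_ge0 => ? _; exact: slack_ge0.
apply: (le_trans _ (angle_fan_le nz)); rewrite -e2E; apply: angle_chain_le.
- exact: (nz 0%N).
- by rewrite e2E; exact: nz.
Qed.

End DistinguishedVertex.

Local Close Scope set_scope.

(** * Summation over the vertices *)

Section VertexSums.
Local Open Scope set_scope.
Context {R : realType} (M : gen_hyp_3manifold R) (S : tri_hyp_surface R).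
Variables (f : face S -> 'rV[R]_3 -> M) (D : {set {set corner S}}).
Variable theta : {set corner S} -> R.
Hypotheses (D_bd : D \subset boundary_vertices S) (f_hmap : h_map f D)
  (bd_geod : geodesic_boundary f D)
  (theta_ext : forall v, v \in D -> is_exterior_angle f D v (theta v)).

(** One formula for the three kinds of vertices, so that its sum over all of them splits into
    cardinals and the sum of the exterior angles. *)
Lemma vertex_sum v : v \in vertices S ->
  2 * pi - (pi *+ (v \in boundary_vertices S) + theta v *+ (v \in D)) <=
  \sum_(c in v) (corner_angle f c + slack D c).
Proof.
move=> vV; have [vD|vD] := boolP (v \in D).
  have /fintype.subsetP/(_ _ vD) -> := D_bd.
  apply: le_trans (distinguished_vertex_sum f_hmap bd_geod vD (theta_ext vD)).
  rewrite mulr1n mulr1n; lra.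
have sl : angle_sum f v <= \sum_(c in v) (corner_angle f c + slack D c).
  by apply: ler_sum => c _; rewrite lerDl; exact: slack_ge0.
have [_ _ int bd] := f_hmap; rewrite mulr0n addr0.
have [vb|vb] := boolP (v \in boundary_vertices S).
  by apply: le_trans sl; apply: le_trans (bd _ vb vD); rewrite mulr1n; lra.
by apply: le_trans sl; rewrite mulr0n subr0; exact: int.
Qed.

Lemma sum_corners_ge :
  2 * pi * #|vertices S|%:R - pi * #|boundary_vertices S|%:R - \sum_(v in D) theta v <=
  \sum_c (corner_angle f c + slack D c).
Proof.
have bV : boundary_vertices S \subset vertices S.
  by apply/fintype.subsetP => v; rewrite inE => /andP[].
have -> : \sum_c (corner_angle f c + slack D c) =
    \sum_(c in [set: corner S]) (corner_angle f c + slack D c).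
  by apply: eq_bigl => c; rewrite inE.
rewrite (set_partition_big _ (vertices_partition S))/=.
apply: le_trans (ler_sum _ vertex_sum).
have sub (A : {set {set corner S}}) (F : {set corner S} -> R) : A \subset vertices S ->
    \sum_(v in vertices S) F v *+ (v \in A) = \sum_(v in A) F v.
  move=> /finset.setIidPr AV; rewrite (big_setID A)/= AV [X in _ + X]big1 => [|v].
    by rewrite addr0; apply: eq_bigr => v ->.
  by rewrite inE => /andP[/negbTE ->].
rewrite sumrB big_split/= sub// (sub _ theta (fintype.subset_trans D_bd bV)).
rewrite !sumr_const -(mulr_natr (2 * pi)) -(mulr_natr pi).
by rewrite opprD addrA.
Qed.

Lemma area_le :
  (area S <= (pi * #|face S|%:R - \sum_c (corner_angle f c + slack D c))%:E)%E.
Proof.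
rewrite /area.
apply: le_trans (_ : _ <= (\sum_(t : face S)
   (pi - \sum_i (corner_angle f (t, i) + slack D (t, i))))%:E)%E _.
  by rewrite -sumEFin; apply: lee_sum => t _; exact: triangle_bound.
rewrite lee_fin sumrB sumr_const -(mulr_natr _ #|_|).
rewrite (pair_bigA _ (fun t i => corner_angle f (t, i) + slack D (t, i)))/=.
by rewrite le_eqVlt; apply/orP; left; apply/eqP; congr (_ - _); apply: eq_bigr => -[].
Qed.
End VertexSums.

Theorem theorem7p2 (R : realType) (M : gen_hyp_3manifold R)
    (S : tri_hyp_surface R) (f : face S -> 'rV[R]_3 -> M)
    (D : {set {set corner S}}) (theta : {set corner S} -> R)
    (D_bd : D \subset boundary_vertices S)
    (f_hmap : h_map f D)
    (bd_geod : geodesic_boundary f D)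
    (theta_ext : forall v, v \in D -> is_exterior_angle f D v (theta v)) :
  (area S <= (\sum_(v in D) theta v - 2 * pi * (euler_char S)%:~R)%:E)%E.
Proof.
apply: le_trans (area_le f_hmap) _; rewrite lee_fin.
have := sum_corners_ge D_bd f_hmap bd_geod theta_ext.
have : (3 * #|face S|%:R + #|boundary_vertices S|%:R <= 2 * #|edges S|%:R :> R).
  by rewrite -!natrM -natrD ler_nat edges_bound.
have -> : (euler_char S)%:~R =
    #|vertices S|%:R - #|edges S|%:R + #|face S|%:R :> R.
  by rewrite /euler_char intrD intrB.
(* Once the edge count is multiplied by pi, the conclusion is linear in the products of pi with the
   cardinals. *)
move=> h; have {h} := ler_wpM2l (pi_ge0 R) h.
move: (\sum_c _) (\sum_(v in D) _) #|_|%:R #|_|%:R #|_|%:R #|_|%:R pi.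
by clear => *; lra.
Qed.
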